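(* Let $\lambda\in\mathbb{C}$, let $m$ be a nonnegative integer and let $|t|<1$. For each nonnegative integer $j$ put $$\Psi_j(x_1,\dots,x_r)={}^{(k)}E^{(r)}\left(\alpha,\beta_{k+1},\dots,\beta_r;1-\lambda-j,\gamma_2,\dots,\gamma_r;x_1,\dots,x_r\right).$$ Then $$\sum_{n=0}^{\infty}\binom{\lambda+m+n-1}{n}\Psi_{m+n}(x_1,\dots,x_r)\,t^n=(1-t)^{-\lambda-m}\,\Psi_m\left(x_1(1-t),x_2,\dots,x_r\right).$$
   Context: The Pochhammer symbol is $(\lambda)_\nu=\Gamma(\lambda+\nu)/\Gamma(\lambda)$ for $\lambda\in\mathbb{C}\setminus\{0,-1,-2,\dots\}$; moreover $(\lambda)_0=1$ and $(\lambda)_n=\lambda(\lambda+1)\cdots(\lambda+n-1)$ for every positive integer $n$ and every $\lambda\in\mathbb{C}$. For complex $a$ and nonnegative integer $n$, $\binom{a}{n}=a(a-1)\cdots(a-n+1)/n!$. Let $r\ge 1$ and $0\le k\le r$ be integers and $\rho\ge 0$. The multivariable hypergeometric function ${}^{(k)}E^{(r)}$ (depending on $\rho$) with complex parameters $\alpha,\beta_{k+1},\dots,\beta_r,\gamma_1,\dots,\gamma_r$ and complex variables $x_1,\dots,x_r$ is $${}^{(k)}E^{(r)}(\alpha,\beta_{k+1},\dots,\beta_r;\gamma_1,\dots,\gamma_r;x_1,\dots,x_r):=\sum_{m_1,\dots,m_r=0}^{\infty}(\alpha)_{\rho(m_1+\dots+m_k)+m_{k+1}+\dots+m_r}\frac{(\beta_{k+1})_{m_{k+1}}\cdots(\beta_r)_{m_r}}{(\gamma_1)_{m_1}\cdots(\gamma_r)_{m_r}}\frac{x_1^{m_1}}{m_1!}\cdots\frac{x_r^{m_r}}{m_r!},$$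 where $\rho(\sqrt{|x_1|}+\dots+\sqrt{|x_k|})+|x_{k+1}|+\dots+|x_r|<1$. Identities are understood for parameters and variables for which the functions occurring in them are defined (Pochhammer symbols defined, denominators nonzero, arguments satisfying this condition, defining series convergent). Powers of $1-t$ are principal.
   Formalization: The series in t on the left can diverge for |t|<1, so the formal theorem assumes that this series converges, or that the series of Ψ_m converges absolutely at (s x_1, x_2, ..., x_r) for some real s > 1+|t|. *)

(* Defs.v *)
(* The complex numbers are R[i] for R : realType. R[i]^o is R[i] seen as a
   normed module over itself; only this copy carries the topology used by lim,
   series and summability.sum. *)
From mathcomp Require Import all_boot all_order all_algebra.
From mathcomp Require Import all_classical all_reals all_analysis.
From mathcomp Require Import complex.
From mathcomp Require showcase.summability.

Set Implicit Arguments.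
Unset Strict Implicit.
Unset Printing Implicit Defensive.

Import Order.TTheory GRing.Theory Num.Theory.
Import numFieldNormedType.Exports.

Local Open Scope classical_set_scope.
Local Open Scope ring_scope.
Local Open Scope complex_scope.

Section ComplexFunctions.
Variable R : realType.
Implicit Types (z a : R[i]) (nu : R) (n : nat).

(* Real-valued modulus; `|z| would be an element of R[i]. *)
Definition cmod z : R := Normc.normc z.

Definition cexp z : R[i] :=
  (expR (complex.Re z))%:C * (cos (complex.Im z) +i* sin (complex.Im z)).

(* Principal argument, in ]-pi, pi] (for z != 0). *)
Definition carg z : R :=
  let theta := acos (complex.Re z / cmod z) in
  if 0 <= complex.Im z then theta else - theta.

Definition clog z : R[i] := ln (cmod z) +i* carg z.

(* Principal power, meaningful for z != 0. *)
Definition cpow z a : R[i] := cexp (a * clog z).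

Definition nonpos_integer z : Prop := exists n, z = - n%:R.

(* Gauss's limit, n! n^z / (z (z+1) ... (z+n)) as n tends to infinity;
   meaningless at the poles. *)
Definition cGamma z : R[i] :=
  limn (fun n => n`!%:R * cpow n%:R z / \prod_(i < n.+1) (z + i%:R) : R[i]^o).

Definition rising z n : R[i] := \prod_(i < n) (z + i%:R).

Definition pochhammer z nu : R[i] :=
  if nu \is a Num.nat then rising z (Num.truncn nu)
  else cGamma (z + nu%:C) / cGamma z.

(* A natural index is allowed for every z. Otherwise neither of the two Gamma
   values may be taken at a pole. *)
Definition pochhammer_defined z nu : Prop :=
  nu \is a Num.nat \/ (~ nonpos_integer z /\ ~ nonpos_integer (z + nu%:C)).

Definition cbinom a n : R[i] := (\prod_(i < n) (a - i%:R)) / n`!%:R.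

End ComplexFunctions.

(* Indices are shifted by one: the variables x_1, ..., x_r are x 0, ...,
   x (r-1), and "the first k" are those with i < k. The family beta is indexed
   by all of 'I_r, but beta i is never read for i < k. *)
Section HypergeometricE.
Variables (R : realType) (r k : nat) (rho : R).
Implicit Types (alpha : R[i]) (beta gamma x : 'I_r -> R[i]).
Implicit Types p : {ffun 'I_r -> nat}.

Definition E_index p : R :=
  rho * (\sum_(i < r | (i < k)%N) p i)%:R + (\sum_(i < r | (k <= i)%N) p i)%:R.

Definition E_term alpha beta gamma x p : R[i] :=
  pochhammer alpha (E_index p)
  * ((\prod_(i < r | (k <= i)%N) rising (beta i) (p i))
     / \prod_(i < r) rising (gamma i) (p i))
  * \prod_(i < r) (x i ^+ p i / (p i)`!%:R).

(* Sum along the filter of finite sets of multi-indices. *)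
Definition E alpha beta gamma x : R[i] :=
  summability.sum (E_term alpha beta gamma x : {ffun 'I_r -> nat} -> R[i]^o).

(* Convergence of the multiple series is unconditional, i.e. absolute. *)
Definition E_convergent alpha beta gamma x : Prop :=
  summable [set: {ffun 'I_r -> nat}]
    (fun p => (cmod (E_term alpha beta gamma x p))%:E).

Definition E_region x : Prop :=
  rho * (\sum_(i < r | (i < k)%N) Num.sqrt (cmod (x i)))
  + \sum_(i < r | (k <= i)%N) cmod (x i) < 1.

Definition E_defined alpha beta gamma x : Prop :=
  [/\ forall p, pochhammer_defined alpha (E_index p),
      forall i n, rising (gamma i) n != 0,
      E_region x
    & E_convergent alpha beta gamma x].

End HypergeometricE.

Definition replace_first (T : Type) (r : nat) (a : T) (f : 'I_r -> T) :
    'I_r -> T :=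
  fun i => if i == 0 :> nat then a else f i.

Definition scale_first (R : realType) (r : nat) (c : R[i])
    (x : 'I_r -> R[i]) : 'I_r -> R[i] :=
  fun i => if i == 0 :> nat then x i * c else x i.

(* The lower parameters of Psi_j; the first entry of gamma is not read. *)
Definition gamma_shift (R : realType) (r : nat) (lambda : R[i])
    (gamma : 'I_r -> R[i]) (j : nat) : 'I_r -> R[i] :=
  replace_first (1 - lambda - j%:R) gamma.

Definition Psi (R : realType) (r k : nat) (rho : R) (alpha : R[i])
    (beta gamma : 'I_r -> R[i]) (lambda : R[i]) (j : nat)
    (x : 'I_r -> R[i]) : R[i] :=
  E k rho alpha beta (gamma_shift lambda gamma j) x.

(* Main.v *)
Require Import Defs.
From mathcomp Require Import all_boot all_order all_algebra.
From mathcomp Require Import all_classical all_reals all_analysis.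
From mathcomp Require Import complex finmap.
From mathcomp Require showcase.summability.
From mathcomp Require Import ring lra zify.

(** Write [b = lambda + m], let [A p] be the term of index [p] of the series of
    [Psi_m] at [x], and let [e p] be the first component of [p]. The coefficients
    [binc y n = (y)_n / n!] are those of the expansion of [(1 - t)] to the power
    [- y]. The summand of index [n] on the left is, term by term, the sum over [p]
    of [A p * binc (b - e p) n * t ^ n] ([E_term_shift]): shifting the first lower
    parameter of the series only shifts [b] by [e p]. Summing over [n] first gives
    [A p] times the power [e p - b] of [1 - t], which is the right-hand side.

    To justify this, let [f z] be the sum over [p] of the [A p * z ^ e p]. By the
    Vandermonde identity the series in [t] is the Cauchy product of the binomial
    series of [(1 - t)] to the power [- b] and of the Taylor series of [f] at 1,
    taken at the point [1 - t]. If the series of [f] converges absolutely at some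
    [s > 1 + |t|], this Taylor series converges to [f (1 - t)], and Mertens' theorem
    concludes ([generating_radius]).

    If instead the series in [t] is assumed to converge, Mertens' theorem applied
    with the inverse binomial series shows that the Taylor series of [f] at 1
    converges at [1 - t], perhaps conditionally; its sum has to be identified with
    [f (1 - t)], though [1 - t] may lie outside the discs centred at 1 in which [f]
    is known to be analytic. The two functions are analytic along the open segment
    from 1 to [1 - t], agree near 1, and Abel's theorem reaches the end point
    ([taylor_series_value], [generating_convergent]).

    This needs [f] to be analytic at 1, that is, convergence of the multiple series
    for a slightly larger first variable ([E_convergent_enlarge]). For [rho <= 2] it
    follows from the openness of the region, by comparing each term with a term of
    a multinomial expansion. For [rho > 2] the Pochhammer symbol of [alpha] grows so
    fast that the assumed convergence forces the first variable to vanish, or the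
    series to terminate. When [rho] is not an integer both arguments need bounds,
    above and below, for [|Gamma (alpha + nu)|] as [nu] grows: consecutive terms of
    Gauss's limit have ratio [1 + O(1 / n ^ 2)] uniformly on discs, which yields
    the existence of the limit together with these bounds ([gauss_product_cvg]). *)

Set Implicit Arguments.
Unset Strict Implicit.
Unset Printing Implicit Defensive.
Import Order.TTheory GRing.Theory Num.Theory.
Import numFieldNormedType.Exports.
Local Open Scope classical_set_scope.
Local Open Scope ring_scope.
Local Open Scope complex_scope.

(** * Modulus and limits of complex numbers *)

Section Modulus.
Variable R : realType.
Implicit Types (z w : R[i]) (x : R).

Lemma normC_cmod z : `|z| = (cmod z)%:C. Proof. by []. Qed.

Lemma cmodM z w : cmod (z * w) = cmod z * cmod w.
Proof. exact: Normc.normcM. Qed.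

Lemma cmodV z : cmod z^-1 = (cmod z)^-1.
Proof. exact: Normc.normcV. Qed.

Lemma cmodN z : cmod (- z) = cmod z.
Proof. exact: normcN. Qed.

Lemma cmod_le_add z w : cmod (z + w) <= cmod z + cmod w.
Proof. exact: le_normcD. Qed.

Lemma cmod_le_sub z w : cmod (z - w) <= cmod z + cmod w.
Proof. by rewrite -(cmodN w) cmod_le_add. Qed.

Lemma cmodB z w : cmod (z - w) = cmod (w - z).
Proof. by rewrite -cmodN opprB. Qed.

Lemma cmod_sub_le z w : cmod z - cmod w <= cmod (z + w).
Proof. by rewrite lerBlDr -{1}(addrK w z) cmod_le_sub. Qed.

Lemma cmod0 : cmod (0 : R[i]) = 0. Proof. exact: Normc.normc0. Qed.

Lemma cmod1 : cmod (1 : R[i]) = 1. Proof. exact: Normc.normc1. Qed.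

Lemma cmod_ge0 z : 0 <= cmod z.
Proof. by rewrite -ler0c -normC_cmod normr_ge0. Qed.

Lemma cmod_eq0 z : (cmod z == 0) = (z == 0).
Proof.
by apply/eqP/eqP => [/Normc.eq0_normc //|->]; rewrite cmod0.
Qed.

Lemma cmod_gt0 z : (0 < cmod z) = (z != 0).
Proof. by rewrite lt_neqAle cmod_ge0 andbT eq_sym cmod_eq0. Qed.

Lemma cmodX z n : cmod (z ^+ n) = cmod z ^+ n.
Proof. by elim: n => [|n IH]; rewrite ?cmod1// !exprS cmodM IH. Qed.

Lemma cmodr x : cmod x%:C = `|x|.
Proof. by rewrite /cmod /= expr0n /= addr0 sqrtr_sqr. Qed.

Lemma cmod_nat n : cmod (n%:R : R[i]) = n%:R.
Proof.
have -> : (n%:R : R[i]) = (n%:R : R)%:C by rewrite rmorph_nat.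
by rewrite cmodr ger0_norm.
Qed.

Lemma cmodMn z n : cmod (z *+ n) = cmod z *+ n.
Proof. by rewrite -mulr_natr cmodM cmod_nat mulr_natr. Qed.

Lemma cmod_sum (I : Type) (s : seq I) (P : pred I) (f : I -> R[i]) :
  cmod (\sum_(i <- s | P i) f i) <= \sum_(i <- s | P i) cmod (f i).
Proof.
elim/big_rec2: _ => [|i y z _ h]; first by rewrite cmod0.
by rewrite (le_trans (cmod_le_add _ _))// lerD2l.
Qed.

Lemma cmod_prod (I : Type) (s : seq I) (P : pred I) (f : I -> R[i]) :
  cmod (\prod_(i <- s | P i) f i) = \prod_(i <- s | P i) cmod (f i).
Proof. by elim/big_rec2: _ => [|i y z _ <-]; rewrite ?cmod1 ?cmodM. Qed.

Lemma Re_le_cmod z : `|complex.Re z| <= cmod z.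
Proof. by rewrite -lecR -normC_cmod normc_ge_Re. Qed.

Lemma Im_le_cmod z : `|complex.Im z| <= cmod z.
Proof.
case: z => a b; rewrite /cmod /= -sqrtr_sqr ler_sqrt ?lerDr ?sqr_ge0//.
by rewrite addr_ge0 ?sqr_ge0.
Qed.

Lemma cmod_le_ReIm z : cmod z <= `|complex.Re z| + `|complex.Im z|.
Proof.
rewrite {1}(complexE z) (le_trans (cmod_le_add _ _))// cmodM !cmodr.
rewrite /cmod /Normc.normc /= expr0n expr1n add0r sqrtr1 mul1r //.
Qed.

(** Limits are handled through the real number [cmod (f x - l)]: the norm of
    [R[i]^o] is itself an element of [R[i]]. *)
Lemma ccvgP (T : Type) (F : set_system T) {FF : Filter F} (f : T -> R[i])
    (l : R[i]) :
  (f @ F --> (l : R[i]^o)) <->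
  (forall e : R, 0 < e -> \forall x \near F, cmod (f x - l) < e).
Proof.
have cP := @cvgrPdist_lt R[i] R[i]^o T F FF f l.
split=> [/cP fl e e0|fl].
  have := fl e%:C; rewrite ltcR => /(_ e0); apply: filterS => x.
  by rewrite normC_cmod ltcR cmodB.
apply/cP => -[e e']; rewrite ltcE /= => /andP[/eqP -> e0].
by have := fl e e0; apply: filterS => x; rewrite normC_cmod -/(e%:C) ltcR cmodB.
Qed.

Lemma ccvg_unique (T : Type) (F : set_system T) {FF : ProperFilter F}
    (f : T -> R[i]) (l l' : R[i]) :
  f @ F --> (l : R[i]^o) -> f @ F --> (l' : R[i]^o) -> l = l'.
Proof.
exact: (@cvg_unique R[i]^o (@norm_hausdorff R[i] R[i]^o) (f @ F) _ l l').
Qed.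

Lemma ccvgM (T : Type) (F : set_system T) {FF : Filter F}
    (f g : T -> R[i]) (l l' : R[i]) :
  f @ F --> (l : R[i]^o) -> g @ F --> (l' : R[i]^o) ->
  (fun x : T => f x * g x) @ F --> (l * l' : R[i]^o).
Proof. by move=> h h'; exact: (cvgM h h'). Qed.

Lemma ccvgD (T : Type) (F : set_system T) {FF : Filter F}
    (f g : T -> R[i]) (l l' : R[i]) :
  f @ F --> (l : R[i]^o) -> g @ F --> (l' : R[i]^o) ->
  (fun x : T => f x + g x) @ F --> (l + l' : R[i]^o).
Proof. by move=> h h'; exact: (@cvgD _ R[i]^o _ F _ f g l l' h h'). Qed.

Lemma ccvgB (T : Type) (F : set_system T) {FF : Filter F}
    (f g : T -> R[i]) (l l' : R[i]) :
  f @ F --> (l : R[i]^o) -> g @ F --> (l' : R[i]^o) ->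
  (fun x : T => f x - g x) @ F --> (l - l' : R[i]^o).
Proof. by move=> h h'; exact: (@cvgB _ R[i]^o _ F _ f g l l' h h'). Qed.

Lemma ccvg_cst (T : Type) (F : set_system T) {FF : Filter F} (l : R[i]) :
  (fun _ : T => l) @ F --> (l : R[i]^o).
Proof.
by apply/ccvgP => e e0; apply: nearW => x; rewrite subrr cmod0.
Qed.

Lemma ccvg_ReIm (T : Type) (F : set_system T) {FF : Filter F} (f : T -> R[i])
    (a b : R) :
  (fun x : T => complex.Re (f x)) @ F --> a ->
  (fun x : T => complex.Im (f x)) @ F --> b ->
  f @ F --> (a +i* b : R[i]^o).
Proof.
move=> /cvgrPdist_lt fa /cvgrPdist_lt fb; apply/ccvgP => e e0.
have e2 : 0 < e / 2 by rewrite divr_gt0.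
have := fb _ e2; have := fa _ e2; apply: filterS2 => x h h'.
apply: (le_lt_trans (cmod_le_ReIm _)); rewrite (splitr e).
by case: (f x) h h' => u v /= h h'; rewrite ltrD// distrC.
Qed.

Lemma ccvg_Re (T : Type) (F : set_system T) {FF : Filter F} (f : T -> R[i])
    (l : R[i]) :
  f @ F --> (l : R[i]^o) -> (fun x : T => complex.Re (f x)) @ F --> complex.Re l.
Proof.
move=> /ccvgP fl; apply/cvgrPdist_lt => e e0; have := fl e e0.
apply: filterS => x; apply: le_lt_trans; rewrite cmodB.
apply: le_trans (Re_le_cmod _); by case: (l) (f x) => [a b] [u v].
Qed.

Lemma ccvg_Im (T : Type) (F : set_system T) {FF : Filter F} (f : T -> R[i])
    (l : R[i]) :
  f @ F --> (l : R[i]^o) -> (fun x : T => complex.Im (f x)) @ F --> complex.Im l.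
Proof.
move=> /ccvgP fl; apply/cvgrPdist_lt => e e0; have := fl e e0.
apply: filterS => x; apply: le_lt_trans; rewrite cmodB.
apply: le_trans (Im_le_cmod _); by case: (l) (f x) => [a b] [u v].
Qed.

End Modulus.

(** * Unconditional sums and dominated convergence *)

#[local] Existing Instance summability.totally_filter.

Section Sums.
Variables (R : realType) (I : choiceType).
Implicit Types (M : I -> R) (f g : I -> R[i]) (F : {fset I}).

(** Finite sums are bounded by a real number, without extended reals, since
    every use is a comparison with a majorant. *)
Definition summable_bound M :=
  (forall i, 0 <= M i) /\ exists B, forall F, \sum_(i <- F) M i <= B.

Definition csum f : R[i] := summability.sum (f : I -> R[i]^o).

(** A finite set whose sum is within [e] of the supremum of all finite sums leaves
    at most [e] for any finite set disjoint from it. The set depends on [M] alone,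
    hence is uniform over all families that [M] dominates. *)
Lemma summable_bound_tail M (e : R) : summable_bound M -> 0 < e ->
  exists F0, forall F, [disjoint F & F0]%fset -> \sum_(i <- F) M i <= e.
Proof.
move=> [M0 [B MB]] e0.
pose S := [set s | exists F, s = \sum_(i <- F) M i].
have hS : has_sup S.
  split; first by exists (\sum_(i <- fset0) M i), fset0.
  by exists B => _ [F ->].
have [_ [F0 ->] lt] := sup_adherent e0 hS.
exists F0 => F dF.
have : \sum_(i <- (F `|` F0)%fset) M i <= sup S.
  by apply: sup_upper_bound => //; exists (F `|` F0)%fset.
have -> : \sum_(i <- (F `|` F0)%fset) M i
        = \sum_(i <- F) M i + \sum_(i <- F0) M i.
  rewrite -big_cat; apply/perm_big/uniq_perm; rewrite ?fset_uniq//=.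
    rewrite cat_uniq !fset_uniq/= andbT -all_predC; apply/allP => i iF0 /=.
    by apply: contraL iF0 => /(fdisjointP dF).
  by move=> i; rewrite mem_cat !inE.
move=> le.
by move: lt; rewrite ltrBlDr => /(le_lt_trans le); rewrite addrC ltrD2l => /ltW.
Qed.

Lemma summable_bound_le M M' : (forall i, 0 <= M' i <= M i) ->
  summable_bound M -> summable_bound M'.
Proof.
move=> MM [M0 [B MB]]; split=> [i|]; first by case/andP: (MM i).
exists B => F; apply: le_trans (MB F); apply: ler_sum => i _.
by case/andP: (MM i).
Qed.

Lemma summable_boundZ M (c : R) : 0 <= c -> summable_bound M ->
  summable_bound (fun i => c * M i).
Proof.
move=> c0 [M0 [B MB]]; split=> [i|]; first by rewrite mulr_ge0.
by exists (c * B) => F; rewrite -mulr_sumr ler_wpM2l.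
Qed.

Lemma sum_fset_tail M f (e : R) F0 :
  (forall i, cmod (f i) <= M i) ->
  (forall F, [disjoint F & F0]%fset -> \sum_(i <- F) M i <= e) ->
  forall F, (F0 `<=` F)%fset ->
  cmod (\sum_(i <- F) f i - \sum_(i <- F0) f i) <= e.
Proof.
move=> fM tail F sF.
have -> : \sum_(i <- F) f i - \sum_(i <- F0) f i = \sum_(i <- (F `\` F0)%fset) f i.
  rewrite (big_fsetID _ (mem F0)) /=.
  have -> : [fset x in F | x \in F0]%fset = F0.
    apply/fsetP => i; rewrite !inE; case: (boolP (i \in F0)) => //=.
      by rewrite andbT => /(fsubsetP sF).
    by rewrite andbF.
  have -> : [fset x in F | x \notin F0]%fset = (F `\` F0)%fset.
    by apply/fsetP => i; rewrite !inE andbC.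
  by rewrite addrAC subrr add0r.
apply: (le_trans (cmod_sum _ _ _)).
apply: le_trans (tail (F `\` F0)%fset _); first exact: ler_sum.
by apply/fdisjointP => i; rewrite !inE => /andP[].
Qed.

Lemma totallyP (P : set {fset I}) :
  (\forall F \near summability.totally, P F) <->
  exists F0, forall F, (F0 `<=` F)%fset -> P F.
Proof. by split=> [[F0 _ h]|[F0 h]]; exists F0. Qed.

(** The finite sums are Cauchy along the filter of finite sets, separately for
    real and imaginary parts, so that the limit defining [csum] exists. *)
Lemma csum_cvg M f : summable_bound M -> (forall i, cmod (f i) <= M i) ->
  (fun F => \sum_(i <- F) f i) @ summability.totally --> (csum f : R[i]^o).
Proof.
move=> hM fM.
have cvgR (p : R[i] -> R) : (forall z w, `|p z - p w| <= cmod (z - w)) ->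
    cvg ((fun F => p (\sum_(i <- F) f i)) @ summability.totally).
  move=> pl; apply/cauchy_cvgP/cauchy_exP => e e0.
  have e2 : 0 < e / 2 by rewrite divr_gt0.
  have [F0 tail] := summable_bound_tail hM e2.
  exists (p (\sum_(i <- F0) f i)); apply/totallyP; exists F0 => F sF.
  rewrite /ball /= distrC; apply: (le_lt_trans (pl _ _)).
  apply: (le_lt_trans (sum_fset_tail fM tail sF)).
  by rewrite ltr_pdivrMr// ltr_pMr// ltr1n.
have /cvg_ex[a ha] := cvgR (@complex.Re R)
  (fun z w => ltac:(by apply: le_trans (Re_le_cmod _); case: (z) (w) => ? ? [])).
have /cvg_ex[b hb] := cvgR (@complex.Im R)
  (fun z w => ltac:(by apply: le_trans (Im_le_cmod _); case: (z) (w) => ? ? [])).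
have h := ccvg_ReIm ha hb.
suff -> : csum f = (a +i* b) by exact: h.
rewrite /csum /summability.sum.
have -> : summability.partial_sum (f : I -> R[i]^o)
        = (fun F => \sum_(i <- F) f i).
  by apply/funext => F; rewrite /summability.partial_sum big_seq_fsetE.
exact: (@cvg_lim R[i]^o (@norm_hausdorff R[i] R[i]^o) _ _ _ _ (a +i* b) (h _)).
Qed.

Lemma csum_tail M f (e : R) F0 : summable_bound M ->
  (forall i, cmod (f i) <= M i) ->
  (forall F, [disjoint F & F0]%fset -> \sum_(i <- F) M i <= e) ->
  cmod (csum f - \sum_(i <- F0) f i) <= e.
Proof.
move=> hM fM tail; apply/ler_addgt0Pr => d d0.
have /ccvgP/(_ d d0)/totallyP[F1 h] := csum_cvg hM fM.
have {h} := h _ (fsubsetUr F0 F1); set s := \sum_(i <- _) f i => h.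
have h' := sum_fset_tail fM tail (fsubsetUl F0 F1).
rewrite -/s in h'.
have -> : csum f - \sum_(i <- F0) f i = (s - \sum_(i <- F0) f i) - (s - csum f).
  by ring.
by rewrite (le_trans (cmod_le_sub _ _))// lerD// ltW.
Qed.

(** Dominated convergence: one finite set controls the tails of all the sums at
    once, and on this finite set the convergence is termwise. Mertens' theorem,
    Taylor expansion and continuity of power series on the boundary of their disc
    are all obtained from this statement, in place of Fubini's theorem for double
    series. *)
Lemma csum_dominated (T : Type) (G : set_system T) {GG : Filter G} M
    (u : T -> I -> R[i]) f :
  summable_bound M -> (forall i, cmod (f i) <= M i) ->
  (\forall x \near G, forall i, cmod (u x i) <= M i) ->
  (forall i, (fun x => u x i) @ G --> (f i : R[i]^o)) ->
  (fun x => csum (u x)) @ G --> (csum f : R[i]^o).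
Proof.
move=> hM fM uM uf; apply/ccvgP => e e0.
have e3 : 0 < e / 3 by rewrite divr_gt0.
have [F0 tail] := summable_bound_tail hM e3.
have h : (fun x => \sum_(i <- F0) u x i) @ G --> (\sum_(i <- F0) f i : R[i]^o).
  elim: (enum_fset F0) => [|i s IH].
    have -> : (fun x => \sum_(i <- [::]) u x i) = (fun=> 0).
      by apply/funext => x; rewrite big_nil.
    by rewrite big_nil; exact: ccvg_cst.
  have -> : (fun x => \sum_(j <- i :: s) u x j)
          = (fun x => u x i + \sum_(j <- s) u x j).
    by apply/funext => x; rewrite big_cons.
  by rewrite big_cons; exact: (ccvgD (uf i) IH).
have /ccvgP/(_ _ e3) := h.
move: uM; apply: filterS2 => x ux hx.
have h1 := csum_tail hM ux tail.
have h2 := csum_tail hM fM tail.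
have -> : csum (u x) - csum f = (csum (u x) - \sum_(i <- F0) u x i)
   + (\sum_(i <- F0) u x i - \sum_(i <- F0) f i)
   - (csum f - \sum_(i <- F0) f i) by ring.
apply: (le_lt_trans (cmod_le_sub _ _)).
have -> : e = (e / 3 + e / 3) + e / 3 by field.
rewrite ltr_leD//.
by apply: (le_lt_trans (cmod_le_add _ _)); rewrite ler_ltD.
Qed.

Lemma csum_le M f B : (forall i, cmod (f i) <= M i) -> (forall i, 0 <= M i) ->
  (forall F, \sum_(i <- F) M i <= B) -> cmod (csum f) <= B.
Proof.
move=> fM M0 MB; have hM : summable_bound M by split => //; exists B.
apply/ler_addgt0Pr => d d0.
have /ccvgP/(_ d d0)/totallyP[F0 /(_ _ (fsubset_refl _)) h] := csum_cvg hM fM.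
rewrite -[csum f](subKr (\sum_(i <- F0) f i)).
apply: (le_trans (cmod_le_sub _ _)); apply: lerD; last exact: ltW.
by apply: (le_trans (cmod_sum _ _ _)); apply: le_trans (MB F0); exact: ler_sum.
Qed.

Lemma csumD M M' f g : summable_bound M -> (forall i, cmod (f i) <= M i) ->
  summable_bound M' -> (forall i, cmod (g i) <= M' i) ->
  csum (fun i => f i + g i) = csum f + csum g.
Proof.
move=> hM fM hM' gM.
have hfg : summable_bound (fun i => M i + M' i).
  case: hM hM' => [M0 [B MB]] [M0' [B' MB']]; split=> [i|].
    by rewrite addr_ge0.
  by exists (B + B') => F; rewrite big_split lerD.
have fgM i : cmod (f i + g i) <= M i + M' i.
  by rewrite (le_trans (cmod_le_add _ _))// lerD.
have := ccvgD (csum_cvg hM fM) (csum_cvg hM' gM).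
have := csum_cvg hfg fgM.
have -> : (fun F => \sum_(i <- F) (f i + g i))
        = (fun F => \sum_(i <- F) f i + \sum_(i <- F) g i).
  by apply/funext => F; rewrite big_split.
by move=> h1 h2; exact: (ccvg_unique h1 (h2 _)).
Qed.

Lemma csumZ M f c : summable_bound M -> (forall i, cmod (f i) <= M i) ->
  csum (fun i => c * f i) = c * csum f.
Proof.
move=> hM fM.
have hcM := summable_boundZ (cmod_ge0 c) hM.
have cfM i : cmod (c * f i) <= cmod c * M i.
  by rewrite cmodM ler_wpM2l ?cmod_ge0.
have hc : (fun _ : {fset I} => c) @ summability.totally --> (c : R[i]^o).
  exact: ccvg_cst.
have := ccvgM hc (csum_cvg hM fM).
have := csum_cvg hcM cfM.
have -> : (fun F => \sum_(i <- F) (c * f i)) = (fun F => c * \sum_(i <- F) f i).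
  by apply/funext => F; rewrite mulr_sumr.
by move=> h1 h2; exact: (ccvg_unique h1 (h2 _)).
Qed.

Lemma summable_bound_sum (N : nat) (M : nat -> I -> R) :
  (forall n, summable_bound (M n)) ->
  summable_bound (fun i => \sum_(n < N) M n i).
Proof.
move=> hM; split=> [i|]; first by rewrite sumr_ge0// => n _; case: (hM n).
have /choice[B hB] : forall n, exists B, forall F, \sum_(i <- F) M n i <= B.
  by move=> n; case: (hM n).
exists (\sum_(n < N) B n) => F; rewrite exchange_big /=.
by apply: ler_sum => n _; exact: hB.
Qed.

Lemma csum_sum (N : nat) (M : nat -> I -> R) (f : nat -> I -> R[i]) :
  (forall n, summable_bound (M n)) -> (forall n i, cmod (f n i) <= M n i) ->
  csum (fun i => \sum_(n < N) f n i) = \sum_(n < N) csum (f n).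
Proof.
move=> hM fM; elim: N => [|N IH].
  rewrite big_ord0 -[LHS]subr0; apply/eqP.
  under eq_fun do rewrite big_ord0.
  have := @csumZ _ _ 0 (hM 0%N) (fM 0%N); rewrite mul0r.
  by under eq_fun do rewrite mul0r; move=> ->; rewrite subr0.
rewrite big_ord_recr -IH /=.
under eq_fun do rewrite big_ord_recr /=.
apply: (@csumD (fun i => \sum_(n < N) M n i) (M N)) => //; last first.
  by move=> i; rewrite (le_trans (cmod_sum _ _ _))// ler_sum.
exact: summable_bound_sum.
Qed.

End Sums.


Section SumsNat.
Variable R : realType.

Lemma sum_fset_seq (V : zmodType) (I : choiceType) (f : I -> V) (s : seq I) :
  uniq s -> \sum_(i <- [fset i in s]%fset) f i = \sum_(i <- s) f i.
Proof.
move=> us; apply/perm_big/uniq_perm; rewrite ?fset_uniq//.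
by move=> i; rewrite inE.
Qed.

Lemma csum_series (M : nat -> R) (f : nat -> R[i]) : summable_bound M ->
  (forall n, cmod (f n) <= M n) ->
  series f @ \oo --> (csum f : R[i]^o).
Proof.
move=> hM fM; apply/ccvgP => e e0.
have /ccvgP/(_ e e0)/totallyP[F0 h] := csum_cvg hM fM.
exists (\max_(i <- F0) i).+1 => // n /= hn.
have := h [fset i in index_iota 0 n]%fset.
rewrite sum_fset_seq ?iota_uniq//; apply.
apply/fsubsetP => i iF0; rewrite !inE mem_index_iota/=.
by apply: leq_trans hn; rewrite ltnS (leq_bigmax_seq (P := xpredT) (F := id)).
Qed.

(** Finite sets of natural numbers lie in initial segments. *)
Lemma summable_bound_series (M : nat -> R) B : (forall n, 0 <= M n) ->
  (forall n, \sum_(i < n) M i <= B) -> summable_bound M.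
Proof.
move=> M0 MB; split=> //; exists B => F.
pose N := (\max_(i <- F) i).+1; apply: le_trans (MB N).
have -> : \sum_(i <- F) M i = \sum_(i <- F | (i < N)%N) M i.
  rewrite big_seq_cond [RHS]big_seq_cond; apply: eq_bigl => i.
  case: (boolP (i \in F)) => //= iF.
  by rewrite ltnS (leq_bigmax_seq (P := xpredT) (F := id)).
rewrite -(big_mkord xpredT M) [leRHS](bigID (mem F)) /=.
apply: ler_wpDr; first by rewrite sumr_ge0.
rewrite -[leRHS]big_filter -[leLHS]big_filter le_eqVlt; apply/orP; left.
apply/eqP/perm_big/uniq_perm; rewrite ?filter_uniq ?fset_uniq ?iota_uniq//.
by move=> i; rewrite !mem_filter mem_index_iota /= andbC.
Qed.

Lemma summable_boundP (I : choiceType) (f : I -> R[i]) :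
  summable [set: I] (fun p => (cmod (f p))%:E) <->
  summable_bound (fun p => cmod (f p)).
Proof.
have -> : summable [set: I] (fun p => (cmod (f p))%:E)
        = (\esum_(p in [set: I]) (cmod (f p))%:E < +oo)%E.
  by rewrite /summable; under eq_esum do rewrite abse_EFin ger0_norm ?cmod_ge0//.
split=> [fin|[M0 [B MB]]].
  split=> [i|]; first exact: cmod_ge0.
  have nneg : (0 <= \esum_(p in [set: I]) (cmod (f p))%:E)%E.
    by apply: esum_ge0 => i _; rewrite lee_fin cmod_ge0.
  exists (fine (\esum_(p in [set: I]) (cmod (f p))%:E)) => F.
  rewrite -lee_fin fineK ?ge0_fin_numE//.
  apply: esum_ge; exists [set` F]; first by split.
  by rewrite fsbig_finite//= set_fsetK -sumEFin.
apply: (@le_lt_trans _ _ B%:E); last by rewrite ltry.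
apply: ub_ereal_sup => _ [A [Afin _] <-].
by rewrite fsbig_finite//= sumEFin lee_fin MB.
Qed.

End SumsNat.

(** * Series indexed by the natural numbers *)

Section Series.
Variable R : realType.
Implicit Types (a b c : nat -> R[i]).

Lemma geometric_sum_le (q : R) n : 0 <= q < 1 ->
  \sum_(i < n) q ^+ i <= (1 - q)^-1.
Proof.
move=> /andP[q0 q1]; have q10 : 0 < 1 - q by rewrite subr_gt0.
rewrite -[leRHS]mul1r ler_pdivlMr// mulrC.
have -> : (1 - q) * \sum_(i < n) q ^+ i = 1 - q ^+ n.
  by rewrite -(opprB q) mulNr -subrX1 opprB.
by rewrite lerBlDr lerDl exprn_ge0.
Qed.

Lemma geometric_summable (K q : R) : 0 <= K -> 0 <= q < 1 ->
  summable_bound (fun n => K * q ^+ n).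
Proof.
move=> K0 /[dup] q01 /andP[q0 q1]; apply: summable_boundZ => //.
apply: (@summable_bound_series R _ (1 - q)^-1) => [n|n].
  by rewrite exprn_ge0.
exact: geometric_sum_le.
Qed.

Lemma ccvg_bounded a (l : R[i]) : a @ \oo --> (l : R[i]^o) ->
  exists2 K : R, 0 < K & forall n, cmod (a n) <= K.
Proof.
move=> /ccvgP/(_ 1 ltr01)[N _ h].
have S0 : 0 <= \sum_(i < N) cmod (a i) by rewrite sumr_ge0// => i _; rewrite cmod_ge0.
exists (\sum_(i < N) cmod (a i) + (1 + cmod l)).
  by rewrite ltr_wpDl// ltr_wpDr// cmod_ge0.
move=> n; have [nN|Nn] := ltnP n N.
  rewrite (bigD1 (Ordinal nN))//= -addrA lerDl addr_ge0//.
    by rewrite sumr_ge0// => i _; rewrite cmod_ge0.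
  by rewrite addr_ge0// cmod_ge0.
apply: ler_wpDl => //; rewrite -[a n](subrK l) (le_trans (cmod_le_add _ _))//.
by rewrite lerD2r ltW// h.
Qed.

Lemma series_ord (V : zmodType) (u : nat -> V) n : series u n = \sum_(i < n) u i.
Proof. by rewrite /series /= big_mkord. Qed.

Lemma ccvg_series_term c l : series c @ \oo --> (l : R[i]^o) ->
  exists2 K : R, 0 < K & forall n, cmod (c n) <= K.
Proof.
move=> /ccvg_bounded[K K0 h]; exists (K + K) => [|n]; first by rewrite addr_gt0.
have -> : c n = series c n.+1 - series c n.
  by rewrite !series_ord big_ord_recr /= addrAC subrr add0r.
by rewrite (le_trans (cmod_le_sub _ _))// lerD.
Qed.

Lemma csum_finite (f : nat -> R[i]) N : (forall n, (N <= n)%N -> f n = 0) ->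
  csum f = \sum_(n < N) f n.
Proof.
move=> f0.
have fM : summable_bound (fun n => cmod (f n)).
  apply: (@summable_bound_series R _ (\sum_(n < N) cmod (f n))) => [n|n].
    exact: cmod_ge0.
  have [nN|Nn] := leqP n N.
    rewrite -(subnKC nN) big_split_ord /= lerDl sumr_ge0// => i _.
    exact: cmod_ge0.
  rewrite -(subnKC (ltnW Nn)) big_split_ord /= [X in _ + X]big1 ?addr0//.
  by move=> i _; rewrite f0 ?cmod0// leq_addr.
have h := csum_series fM (fun n => lexx _).
apply: (ccvg_unique h); apply/ccvgP => e e0; exists N => // n /= Nn.
have -> : series f n = \sum_(i < N) f i; last by rewrite subrr cmod0.
rewrite series_ord -(subnKC Nn) big_split_ord /= [X in _ + X]big1 ?addr0//.
by move=> i _; rewrite f0// leq_addr.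
Qed.

Lemma cauchy_product_sum a b N :
  \sum_(n < N) \sum_(j < n.+1) a j * b (n - j)%N
  = \sum_(j < N) a j * \sum_(i < N - j) b i.
Proof.
elim: N => [|N IH]; first by rewrite !big_ord0.
rewrite big_ord_recr /= IH [RHS]big_ord_recr /= subSnn big_ord1.
rewrite big_ord_recr /= subnn addrA; congr (_ + _).
rewrite -big_split /=; apply: eq_bigr => j _.
by rewrite subSn ?big_ord_recr/= ?mulrDr// ltnW.
Qed.

(** Mertens' theorem. The partial sums of the Cauchy product are the sums over
    [j] of [a j] times a partial sum of [b]; partial sums of [b] are bounded, so
    dominated convergence applies with majorant a multiple of [cmod (a j)]. The
    series of [b] need only converge conditionally, which is essential here. *)
Lemma cauchy_product_cvg a b (B : R[i]) :
  summable_bound (fun n => cmod (a n)) -> series b @ \oo --> (B : R[i]^o) ->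
  series (fun n => \sum_(j < n.+1) a j * b (n - j)%N) @ \oo
    --> (csum a * B : R[i]^o).
Proof.
move=> aM hb; have [K K0 bK] := ccvg_bounded hb.
pose M j := K * cmod (a j).
have hM : summable_bound M by apply: summable_boundZ => //; exact: ltW.
have abM n j : cmod (a j * series b (n - j)%N) <= M j.
  by rewrite cmodM mulrC ler_wpM2r ?cmod_ge0.
have BK : cmod B <= K.
  apply/ler_addgt0Pr => e e0; have /ccvgP/(_ e e0)[N _ /(_ N (leqnn N)) h] := hb.
  rewrite -[B](subKr (series b N)) (le_trans (cmod_le_sub _ _))// lerD//.
  exact: ltW.
have aBM j : cmod (a j * B) <= M j by rewrite cmodM mulrC ler_wpM2r ?cmod_ge0.
have -> : csum a * B = csum (fun j => a j * B).
  rewrite mulrC -(csumZ _ aM (fun j => lexx _)); congr csum.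
  by apply/funext => j; rewrite mulrC.
have -> : series (fun n => \sum_(j < n.+1) a j * b (n - j)%N)
        = (fun n => csum (fun j => a j * series b (n - j)%N)).
  apply/funext => n; rewrite series_ord cauchy_product_sum (@csum_finite _ n).
    by apply: eq_bigr => j _; rewrite series_ord.
  by move=> j nj; rewrite (eqP nj) series_ord big_ord0 mulr0.
apply: (@csum_dominated R _ _ _ _ M _ _ hM aBM).
  by apply: nearW => n j.
move=> j; apply: (@ccvgM R _ _ _ (fun=> a j) (fun n => series b (n - j)%N)).
  exact: ccvg_cst.
apply/ccvgP => e e0; have /ccvgP/(_ e e0)[N _ h] := hb.
exists (N + j)%N => //= n /= Nn.
have Nnj : (N <= n - j)%N by rewrite leq_subRL ?[(j + N)%N]addnC // (leq_trans _ Nn) // leq_addl.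
exact: (h _ Nnj).
Qed.

(** Abel's theorem. Summation by parts writes the series at [u] as a weighted mean
    of the partial sums of [c], in which the weight of any given partial sum
    tends to 0 as [u] tends to 1. *)
Lemma abel_limit c (S : R[i]) (g : R -> R[i]) :
  series c @ \oo --> (S : R[i]^o) ->
  (forall u, 0 <= u < 1 ->
     series (fun n => c n * u%:C ^+ n) @ \oo --> (g u : R[i]^o)) ->
  forall e : R, 0 < e -> exists2 d, 0 < d &
    forall u, 0 <= u < 1 -> 1 - d < u -> cmod (g u - S) <= e.
Proof.
move=> hc hg e e0.
pose T n := series c n - S.
have T0 : T 0%N = - S by rewrite /T series_ord big_ord0 sub0r.
(* Summation by parts; the term S comes from T 0 = - S. *)
have abel u N : \sum_(n < N) c n * u ^+ n =
    T N * u ^+ N + S + (1 - u) * \sum_(n < N) T n.+1 * u ^+ n.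
  elim: N => [|N IH]; first by rewrite !big_ord0 T0 mulr1 mulr0; ring.
  have -> : c = (fun n => T n.+1 - T n).
    apply/funext => n; rewrite /T !series_ord big_ord_recr /=; ring.
  have {}IH : \sum_(n < N) (T n.+1 - T n) * u ^+ n =
      T N * u ^+ N + S + (1 - u) * \sum_(n < N) T n.+1 * u ^+ n.
    rewrite -IH; apply: eq_bigr => n _; congr (_ * _).
    by rewrite /T !series_ord big_ord_recr /=; ring.
  by rewrite big_ord_recr /= IH big_ord_recr /= exprS; ring.
have hT : T @ \oo --> (0 : R[i]^o).
  by apply/ccvgP => d d0; have /ccvgP/(_ d d0) := hc; apply: filterS => n; rewrite subr0.
have [K K0 TK] := ccvg_bounded hT.
have e4 : 0 < e / 4 by rewrite divr_gt0.
have /ccvgP/(_ _ e4)[N0 _ hN0] := hT.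
have NK : 0 < N0%:R * K + 1 by rewrite ltr_wpDl// mulr_ge0// ltW.
exists (e / 4 / (N0%:R * K + 1)) => [|u /andP[u0 u1] du]; first by rewrite divr_gt0.
have u10 : 0 < 1 - u by rewrite subr_gt0.
have un n : 0 <= u ^+ n <= 1 by rewrite exprn_ge0// exprn_ile1// ltW.
have u01 : 0 <= u < 1 by rewrite u0.
(* The first N0 terms are bounded by K, the others by e / 4. *)
have sumT N : \sum_(n < N) cmod (T n.+1) * u ^+ n
    <= N0%:R * K + e / 4 / (1 - u).
  apply: (@le_trans _ _ (\sum_(n < N) ((n < N0)%N%:R * K + e / 4 * u ^+ n))).
    apply: ler_sum => n _; have [nN|Nn] := ltnP n N0.
      have /andP[un0 un1] := un n.
      rewrite mul1r; apply: ler_wpDr; first by rewrite mulr_ge0 // ltW.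
      by rewrite -[leRHS]mulr1; apply: ler_pM => //; exact: cmod_ge0.
    rewrite mul0r add0r ler_wpM2r ?exprn_ge0//.
    by have := hN0 n.+1; rewrite /= subr0 => h; rewrite ltW// h// ltnW.
  rewrite big_split /= -mulr_suml -mulr_sumr lerD//; last first.
    by rewrite ler_wpM2l ?(ltW e4)// geometric_sum_le.
  apply: ler_wpM2r; first exact: ltW.
  have -> : \sum_(n < N) ((n < N0)%N%:R : R) = (minn N N0)%:R.
    elim: (N) => [|k IH]; first by rewrite big_ord0 min0n.
    by rewrite big_ord_recr /= IH -natrD; congr (_%:R); lia.
  by rewrite ler_nat geq_minr.
have /ccvgP/(_ _ e4)[N1 _ hN1] := hg u u01.
pose N := maxn N0 N1.
have {hN1}h1 : cmod (\sum_(n < N) c n * u%:C ^+ n - g u) < e / 4.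
  by have := hN1 N (leq_maxr _ _); rewrite /= series_ord.
have hT2 : cmod (T N) < e / 4.
  by have := hN0 N; rewrite /= subr0; apply; rewrite leq_maxl.
have h2 : cmod (\sum_(n < N) c n * u%:C ^+ n - S) <= e / 4 + (e / 4 + e / 4).
  rewrite abel; set Z := \sum_(n < N) T n.+1 * _.
  have -> : T N * u%:C ^+ N + S + (1 - u%:C) * Z - S = T N * u%:C ^+ N + (1 - u)%:C * Z.
    by rewrite rmorphB; ring.
  rewrite (le_trans (cmod_le_add _ _))// !cmodM cmodX !cmodr !ger0_norm ?(ltW u10)//.
  have /andP[un0 un1] := un N.
  rewrite lerD//; first by rewrite -[leRHS]mulr1 ler_pM// ?cmod_ge0// ltW.
  have ZN : cmod Z <= N0%:R * K + e / 4 / (1 - u).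
    apply: le_trans (sumT N); rewrite (le_trans (cmod_sum _ _ _))//.
    by apply: ler_sum => n _; rewrite cmodM cmodX cmodr ger0_norm.
  apply: (le_trans (ler_wpM2l (ltW u10) ZN)); rewrite mulrDr lerD//; last first.
    by rewrite mulrCA divff ?mulr1// gt_eqF.
  move: du; rewrite ltrBlDr -ltrBlDl => /ltW du.
  apply: (le_trans (ler_wpM2r _ du)); first by rewrite mulr_ge0// ltW.
  rewrite -[leLHS]mulrA; apply: ler_piMr; first exact: ltW.
  by rewrite mulrC ler_pdivrMr// mul1r lerDl.
have -> : g u - S = (\sum_(n < N) c n * u%:C ^+ n - S)
   - (\sum_(n < N) c n * u%:C ^+ n - g u) by ring.
apply: (le_trans (cmod_le_sub _ _)).
have -> : e = (e / 4 + (e / 4 + e / 4)) + e / 4 by field.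
by rewrite lerD// ltW.
Qed.

End Series.

(** * Taylor expansion and the identity theorem on a segment *)

Section Taylor.
Variable R : realType.

Lemma binomial_sum (K : comPzRingType) (x y : K) e N : (e < N)%N ->
  \sum_(k < N) x ^+ (e - k) * y ^+ k *+ 'C(e, k) = (x + y) ^+ e.
Proof.
move=> eN; rewrite exprDn -(subnKC eN) big_split_ord /= [X in _ + X]big1 ?addr0//.
by move=> i _; rewrite bin_small ?mulr0n// ltn_addr.
Qed.

(** A partial sum of the binomial expansion with nonnegative terms; this is the
    majorant that lets dominated convergence sum Taylor expansions. *)
Lemma binomial_partial_le (x y : R) e N : 0 <= x -> 0 <= y ->
  \sum_(k < N) x ^+ (e - k) * y ^+ k *+ 'C(e, k) <= (x + y) ^+ e.
Proof.
move=> x0 y0; rewrite -(@binomial_sum _ x y e (N + e.+1)) ?leq_addl//.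
rewrite big_split_ord /= lerDl sumr_ge0// => k _.
by rewrite mulrn_wge0// mulr_ge0// exprn_ge0.
Qed.

Lemma binomial_term_le (x y : R) e k : 0 <= x -> 0 <= y ->
  x ^+ (e - k) * y ^+ k *+ 'C(e, k) <= (x + y) ^+ e.
Proof.
move=> x0 y0; apply: le_trans (binomial_partial_le e k.+1 x0 y0).
rewrite big_ord_recr /= lerDr sumr_ge0// => j _.
by rewrite mulrn_wge0// mulr_ge0// exprn_ge0.
Qed.

Section Expansion.
Variables (I : choiceType) (A : I -> R[i]) (e : I -> nat) (z0 : R[i]) (r eta : R).
Hypotheses (hA : summable_bound (fun i => cmod (A i) * r ^+ e i))
  (eta0 : 0 < eta) (z0r : cmod z0 + eta <= r).

(** The Taylor coefficients at [z0] of the function sending [z] to the sum of the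
    [A i * z ^+ e i]. The index set [I] is arbitrary and [e] need not be injective,
    so that a multiple series can be expanded in one variable without first being
    regrouped into a power series. *)
Definition taylor_coef k := csum (fun i => A i * (z0 ^+ (e i - k) *+ 'C(e i, k))).

Let r0 : 0 <= r.
Proof. by rewrite (le_trans _ z0r)// addr_ge0 ?cmod_ge0// ltW. Qed.

Lemma taylor_term_le k i :
  cmod (A i * (z0 ^+ (e i - k) *+ 'C(e i, k)))
  <= eta ^- k * (cmod (A i) * r ^+ e i).
Proof.
rewrite [leRHS]mulrC ler_pdivlMr ?exprn_gt0// cmodM -mulrA ler_wpM2l ?cmod_ge0//.
rewrite cmodMn cmodX mulrnAl.
apply: (@le_trans _ _ ((cmod z0 + eta) ^+ e i)).
  by rewrite binomial_term_le ?cmod_ge0// ltW.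
by rewrite lerXn2r ?nnegrE// addr_ge0 ?cmod_ge0// ltW.
Qed.

Lemma taylor_summable k :
  summable_bound (fun i => eta ^- k * (cmod (A i) * r ^+ e i)).
Proof. by apply: summable_boundZ => //; rewrite invr_ge0 exprn_ge0// ltW. Qed.

Lemma taylor_coef_bounded : exists B, forall k, cmod (taylor_coef k) * eta ^+ k <= B.
Proof.
have [M0 [B MB]] := hA; exists B => k.
rewrite -ler_pdivlMr ?exprn_gt0// [leRHS]mulrC.
apply: (@csum_le _ _ _ _ _ (taylor_term_le k)) => [i|F].
  by case: (taylor_summable k) => + _; apply.
rewrite -mulr_sumr ler_wpM2l ?invr_ge0 ?exprn_ge0// ltW//.
Qed.

(** The [N]-th partial sum of the Taylor series is the sum over [i] of partial
    binomial expansions of [(z0 + w) ^+ e i], dominated by [r ^+ e i]. *)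
Lemma taylor_cvg w : cmod w <= eta ->
  series (fun k => taylor_coef k * w ^+ k) @ \oo
    --> (csum (fun i => A i * (z0 + w) ^+ e i) : R[i]^o).
Proof.
move=> weta.
pose T N i := A i * \sum_(k < N) z0 ^+ (e i - k) * w ^+ k *+ 'C(e i, k).
have -> : series (fun k => taylor_coef k * w ^+ k) = (fun N => csum (T N)).
  apply/funext => N; rewrite series_ord.
  transitivity (\sum_(k < N) csum (fun i =>
      w ^+ k * (A i * (z0 ^+ (e i - k) *+ 'C(e i, k))))).
    apply: eq_bigr => k _; rewrite mulrC.
    by rewrite (csumZ _ (taylor_summable k) (taylor_term_le k)).
  pose f k i := w ^+ k * (A i * (z0 ^+ (e i - k) *+ 'C(e i, k))).
  rewrite -(@csum_sum R I N
    (fun k i => cmod w ^+ k * (eta ^- k * (cmod (A i) * r ^+ e i))) f).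
  - congr csum; apply/funext => i; rewrite /T mulr_sumr; apply: eq_bigr => k _.
    by rewrite /f mulrCA; congr (_ * _); rewrite mulrnAr mulrC.
  - by move=> k; apply: (summable_boundZ _ (taylor_summable k)); rewrite exprn_ge0 ?cmod_ge0.
  - by move=> k i; rewrite cmodM cmodX ler_wpM2l ?exprn_ge0 ?cmod_ge0 ?taylor_term_le.
have le_r x : cmod x <= eta -> (cmod z0 + cmod x) ^+ _ <= r ^+ _ :=
  fun h => lerXn2r _ (addr_ge0 (cmod_ge0 _) (cmod_ge0 _)) r0
    (le_trans (lerD (lexx _) h) z0r).
apply: (@csum_dominated R I _ _ _ (fun i => cmod (A i) * r ^+ e i)) => //.
- move=> i; rewrite cmodM cmodX ler_wpM2l ?cmod_ge0//.
  apply: le_trans (le_r _ _ weta).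
  by rewrite lerXn2r ?nnegrE ?addr_ge0 ?cmod_ge0// cmod_le_add.
- apply: nearW => N i; rewrite cmodM ler_wpM2l ?cmod_ge0//.
  apply: le_trans (le_r _ _ weta).
  apply: le_trans (binomial_partial_le (e i) N (cmod_ge0 _) (cmod_ge0 _)).
  rewrite (le_trans (cmod_sum _ _ _))// ler_sum// => k _.
  by rewrite cmodMn cmodM !cmodX.
- move=> i; apply/ccvgP => d d0; exists (e i).+1 => //= N /= eN.
  by rewrite /T binomial_sum// subrr cmod0.
Qed.

End Expansion.

(** The bound on [a n * eta ^+ n] gives the expansion geometric tails near [v], as a
    radius of convergence would. *)
Definition analytic_at (h : R -> R[i]) (v : R) :=
  exists eta (a : nat -> R[i]) B, [/\ 0 < eta,
    forall n, cmod (a n) * eta ^+ n <= B &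
    forall v', `|v' - v| <= eta ->
      series (fun n => a n * (v' - v)%:C ^+ n) @ \oo --> (h v' : R[i]^o)].

Lemma analytic_at_shrink h v eta' : 0 < eta' -> analytic_at h v ->
  exists eta (a : nat -> R[i]) B, [/\ 0 < eta <= eta',
    forall n, cmod (a n) * eta ^+ n <= B &
    forall v', `|v' - v| <= eta ->
      series (fun n => a n * (v' - v)%:C ^+ n) @ \oo --> (h v' : R[i]^o)].
Proof.
move=> eta'0 [eta [a [B [eta0 aB ha]]]].
exists (Num.min eta eta'), a, B; split.
- by rewrite lt_min eta0 eta'0 ge_min lexx orbT.
- move=> n; apply: le_trans (aB n); rewrite ler_wpM2l ?cmod_ge0//.
  by rewrite lerXn2r ?nnegrE ?ge_min ?lexx// ?le_min ?ltW.
- by move=> v' h'; apply: ha; rewrite (le_trans h')// ge_min lexx.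
Qed.

Lemma analytic_atB h g v : analytic_at h v -> analytic_at g v ->
  analytic_at (fun u => h u - g u) v.
Proof.
move=> hh [eta [b [B' [eta0 bB hb]]]].
have [eta' [a [B [/andP[eta'0 le] aB ha]]]] := analytic_at_shrink eta0 hh.
exists eta', (fun n => a n - b n), (B + B'); split=> [//|n|v' v'v].
  rewrite (le_trans (ler_wpM2r _ (cmod_le_sub _ _))) ?exprn_ge0 ?(ltW eta'0)//.
  rewrite mulrDl lerD// (le_trans _ (bB n))// ler_wpM2l ?cmod_ge0//.
  by rewrite lerXn2r// ?nnegrE ltW.
have -> : series (fun n => (a n - b n) * (v' - v)%:C ^+ n)
    = (fun N => series (fun n => a n * (v' - v)%:C ^+ n) N
              - series (fun n => b n * (v' - v)%:C ^+ n) N).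
  apply/funext => N.
  by rewrite !series_ord -sumrB; apply: eq_bigr => k _; rewrite mulrBl.
exact: (ccvgB (ha _ v'v) (hb _ (le_trans v'v le))).
Qed.

(** If [a n] is the first nonzero coefficient, dividing by [y ^+ n] bounds
    [cmod (a n)] by a multiple of [y], for all small [y]. Points on one side
    of the centre are enough, which is what the identity theorem needs at the end of
    an interval of zeros. *)
Lemma power_series_eq0 (a : nat -> R[i]) (B eta : R) : 0 < eta ->
  (forall n, cmod (a n) * eta ^+ n <= B) ->
  (forall y, 0 < y < eta -> series (fun n => a n * (- y)%:C ^+ n) @ \oo --> (0 : R[i]^o)) ->
  forall n, a n = 0.
Proof.
move=> eta0 aB ha n; elim/ltn_ind: n => n IH.
have B0 : 0 <= B by rewrite (le_trans _ (aB 0%N))// mulr_ge0 ?cmod_ge0// exprn_ge0// ltW.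
have small y : 0 < y -> y <= eta / 2 -> cmod (a n) * eta ^+ n <= 2 * B / eta * y.
  move=> y0 ye; pose q := y / eta.
  have q0 : 0 < q by rewrite divr_gt0.
  have q2 : q <= 2^-1 by rewrite ler_pdivrMr// mulrC.
  have q1 : 0 <= q < 1 by rewrite ltW//= (le_lt_trans q2)// invf_lt1// ltr1n.
  have yq : y = q * eta by rewrite /q divfK// gt_eqF.
  have ye1 : 0 < y < eta by rewrite y0 (le_lt_trans ye)// ltr_pdivrMr// ltr_pMr// ltr1n.
  have tail N : (n < N)%N ->
      cmod (a n) * y ^+ n <= cmod (\sum_(k < N) a k * (- y)%:C ^+ k) + 2 * B * q ^+ n.+1.
    move=> nN; rewrite -(subnKC nN) big_split_ord /= big_ord_recr /= big1; last first.
      by move=> k _; rewrite IH ?mul0r.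
    rewrite add0r; set Z := \sum_(i < _) _.
    rewrite -lerBlDr; apply: (@le_trans _ _ (cmod (a n * (- y)%:C ^+ n) - cmod Z)); last first.
      exact: cmod_sub_le.
    rewrite cmodM cmodX cmodr normrN ger0_norm ?(ltW y0)// lerD2l lerN2.
    rewrite (le_trans (cmod_sum _ _ _))//.
    apply: (@le_trans _ _ (\sum_(i < N - n.+1) B * q ^+ n.+1 * q ^+ i)).
      apply: ler_sum => i _; rewrite -mulrA -exprD cmodM cmodX cmodr normrN ger0_norm ?(ltW y0)//.
      rewrite yq exprMn mulrA mulrAC; apply: ler_wpM2r; first by rewrite exprn_ge0// ltW.
      exact: aB.
    rewrite -mulr_sumr [2 * B]mulrC -!mulrA ler_wpM2l// mulrC ler_wpM2r ?exprn_ge0 ?(ltW q0)//.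
    apply: (le_trans (geometric_sum_le _ q1)).
    rewrite -[leRHS]invrK lef_pV2 ?posrE ?invr_gt0 ?subr_gt0//; last by case/andP: q1.
    by rewrite lerBrDl -lerBrDr; apply: (le_trans q2); lra.
  have main : cmod (a n) * y ^+ n <= 2 * B * q ^+ n.+1.
    apply/ler_addgt0Pr => d d0.
    have /ccvgP/(_ d d0)[N _ hN] := ha y ye1.
    have := hN (maxn N n.+1) (leq_maxl _ _).
    rewrite /= subr0 series_ord => hlt.
    apply: (le_trans (tail (maxn N n.+1) (leq_maxr _ _))).
    by rewrite addrC lerD2l ltW.
  move: main; rewrite {1}yq exprMn exprS mulrCA [2 * B * _]mulrA [leRHS]mulrC.
  rewrite ler_pM2l ?exprn_gt0// /q => h.
  by rewrite (le_trans h)// mulrA mulrAC.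
have e0 : cmod (a n) * eta ^+ n <= 0.
  apply/ler_addgt0Pr => d d0; rewrite add0r.
  pose y := Num.min (eta / 2) (d / (2 * B / eta + 1)).
  have c0 : 0 < 2 * B / eta + 1 by rewrite ltr_wpDl// divr_ge0 ?mulr_ge0// ltW.
  have y0 : 0 < y by rewrite lt_min !divr_gt0.
  have ye : y <= eta / 2 by rewrite ge_min lexx.
  apply: (le_trans (small y y0 ye)).
  apply: (@le_trans _ _ ((2 * B / eta + 1) * y)).
    by rewrite ler_wpM2r ?(ltW y0)// lerDl.
  by rewrite mulrC -ler_pdivlMr// ge_min lexx orbT.
apply/eqP; rewrite -cmod_eq0 eq_le cmod_ge0 andbT.
by rewrite pmulr_lle0 ?exprn_gt0// in e0.
Qed.

(** Let [s] be the supremum of the lengths on which [h] vanishes. If [s < 1], the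
    expansion of [h] at [s] vanishes to the left of [s], hence has only zero
    coefficients, and [h] vanishes beyond [s]. *)
Lemma identity_segment (h : R -> R[i]) (u0 : R) : 0 < u0 ->
  (forall v, 0 <= v < 1 -> analytic_at h v) ->
  (forall v, 0 <= v < u0 -> h v = 0) ->
  forall v, 0 <= v < 1 -> h v = 0.
Proof.
move=> u00 ha h0 v /andP[v0 v1]; apply: contrapT => hv.
pose S := [set s | 0 <= s < 1 /\ forall u, 0 <= u <= s -> h u = 0].
have Sv s : S s -> s <= v.
  move=> [_ hs]; rewrite leNgt; apply/negP => vs.
  by apply: hv; apply: hs; rewrite v0 ltW.
have S0 : S 0.
  split=> [|u /andP[u0' u1]]; first by rewrite lexx ltr01.
  by apply: h0; rewrite u0' (le_lt_trans u1).
have hS : has_sup S by split; [exists 0|exists v].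
have sup0 : 0 <= sup S by apply: sup_upper_bound.
have supv : sup S <= v by apply: ge_sup => //; exists 0.
have sup1 : sup S < 1 := le_lt_trans supv v1.
have below u : 0 <= u < sup S -> h u = 0.
  move=> /andP[u0' us]; have sg : 0 < sup S - u by rewrite subr_gt0.
  have [s [_ hs] lt] := sup_adherent sg hS.
  by apply: hs; rewrite u0' /= ltW// (le_lt_trans _ lt)// subKr.
have spos : 0 < sup S.
  pose s := Num.min (u0 / 2) (2^-1).
  apply: (@lt_le_trans _ _ s); first by rewrite lt_min divr_gt0//= invr_gt0.
  apply: sup_upper_bound => //; split.
    rewrite le_min divr_ge0 ?(ltW u00)//= invr_ge0 ler0n /=.
    by rewrite gt_min invf_lt1// ltr1n orbT.
  move=> u /andP[u1 us]; apply: h0; rewrite u1 /=; apply: (le_lt_trans us).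
  by rewrite gt_min ltr_pdivrMr// ltr_pMr// ltr1n.
have d0 : 0 < Num.min (sup S) (1 - sup S) by rewrite lt_min spos subr_gt0.
have s01 : 0 <= sup S < 1 by rewrite sup0.
have [eta [a [B [/andP[eta0 etad] aB haS]]]] := analytic_at_shrink d0 (ha _ s01).
(* The expansion at the supremum vanishes on its left. *)
have a0 : forall n, a n = 0.
  apply: (power_series_eq0 eta0 aB) => y /andP[y0 ye].
  have := haS (sup S - y).
  rewrite addrAC subrr sub0r normrN ger0_norm ?(ltW y0)// below; last first.
    rewrite subr_ge0 ltrBlDr ltrDl y0 andbT.
    by rewrite (le_trans (ltW ye))// (le_trans etad)// ge_min lexx.
  by move=> /(_ (ltW ye)).
have near_s u : `|u - sup S| <= eta -> h u = 0.
  move=> us; apply: (ccvg_unique (haS u us)).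
  apply/ccvgP => d dpos; apply: nearW => N.
  rewrite series_ord big1 ?subrr ?cmod0// => k _; by rewrite a0 mul0r.
have : S (sup S + eta / 2).
  split.
    rewrite addr_ge0 ?divr_ge0 ?(ltW eta0)//= -ltrBrDl.
    rewrite (@lt_le_trans _ _ eta)//; first by rewrite ltr_pdivrMr// ltr_pMr// ltr1n.
    by rewrite (le_trans etad)// ge_min lexx orbT.
  move=> u /andP[u0' us]; have [lt|ge] := ltP u (sup S); first by rewrite below ?u0'.
  apply: near_s; rewrite ger0_norm ?subr_ge0// lerBlDl (le_trans us)// lerD2l.
  by rewrite ler_pdivrMr// ler_pMr// ler1n.
move=> /(sup_upper_bound hS); apply/negP; rewrite -ltNge ltrDl.
by rewrite divr_gt0.
Qed.

End Taylor.

(** * A convergent Taylor series at 1 represents its function *)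

Section Core.
Variable R : realType.

Lemma csum_power_analytic (c : nat -> R[i]) K v : (forall n, cmod (c n) <= K) ->
  0 <= v < 1 -> analytic_at (fun u => csum (fun n => c n * u%:C ^+ n)) v.
Proof.
move=> cK /andP[v0 v1].
have K0 : 0 <= K := le_trans (cmod_ge0 _) (cK 0%N).
pose r := (1 + v) / 2; pose eta := (1 - v) / 2.
have r01 : 0 <= r < 1 by rewrite /r; lra.
have eta0 : 0 < eta by rewrite /eta; lra.
have hc : summable_bound (fun n => cmod (c n) * r ^+ n).
  apply: (summable_bound_le _ (geometric_summable K0 r01)) => n.
  case/andP: r01 => r0 _.
  by rewrite mulr_ge0 ?cmod_ge0 ?exprn_ge0//= ler_wpM2r ?exprn_ge0.
have hr : cmod v%:C + eta <= r by rewrite cmodr ger0_norm// /r /eta; lra.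
have [B aB] := taylor_coef_bounded hc eta0 hr.
exists eta, (taylor_coef c id v%:C), B; split; [exact: eta0|exact: aB|].
move=> v' v'v.
have w : cmod (v' - v)%:C <= eta by rewrite cmodr.
have := taylor_cvg hc eta0 hr w.
by have -> : v%:C + (v' - v)%:C = v'%:C by rewrite -rmorphD addrC subrK.
Qed.

Section Family.
Variables (I : choiceType) (A : I -> R[i]) (e : I -> nat) (t : R[i]) (delta : R).
Hypotheses (delta0 : 0 < delta)
  (hA : summable_bound (fun i => cmod (A i) * (1 + delta) ^+ e i))
  (hAt : summable_bound (fun i => cmod (A i) * cmod (1 - t) ^+ e i))
  (t1 : cmod t < 1).

Let g u := csum (fun i => A i * (1 - u%:C * t) ^+ e i).
Let r := Num.max (1 + delta) (cmod (1 - t)).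

Let r1 : 1 < r.
Proof. by rewrite /r lt_max ltrDl delta0. Qed.

Let hr : summable_bound (fun i => cmod (A i) * r ^+ e i).
Proof. by rewrite /r; case: leP => _; [exact: hAt|exact: hA]. Qed.

Let segment_lt v : 0 <= v <= 1 -> cmod (1 - v%:C * t) <= (1 - v) + v * r.
Proof.
move=> /andP[v0 v1].
have -> : 1 - v%:C * t = (1 - v)%:C + v%:C * (1 - t) by rewrite rmorphB; ring.
apply: (le_trans (cmod_le_add _ _)); rewrite cmodM !cmodr.
rewrite (ger0_norm v0) ger0_norm ?subr_ge0// lerD2l ler_wpM2l// /r.
by rewrite le_max lexx orbT.
Qed.

Let g_analytic v : 0 <= v < 1 -> analytic_at g v.
Proof.
move=> /andP[v0 v1].
have lt : cmod (1 - v%:C * t) < r.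
  apply: (@le_lt_trans _ _ ((1 - v) + v * r)).
    by apply: segment_lt; rewrite v0 ltW.
  by rewrite -subr_gt0 (_ : _ - _ = (1 - v) * (r - 1)); [rewrite mulr_gt0 ?subr_gt0|ring].
pose eta := r - cmod (1 - v%:C * t).
have eta0 : 0 < eta by rewrite subr_gt0.
have hz : cmod (1 - v%:C * t) + eta <= r by rewrite /eta addrC subrK.
have [B aB] := taylor_coef_bounded hr eta0 hz.
pose a := taylor_coef A e (1 - v%:C * t).
exists eta, (fun k => a k * (- t) ^+ k), B; split; [exact: eta0| |].
  move=> n; apply: le_trans (aB n); rewrite cmodM cmodX cmodN -mulrA ler_wpM2l ?cmod_ge0//.
  by rewrite ler_piMl ?exprn_ge0 ?(ltW eta0)// exprn_ile1 ?cmod_ge0// ltW.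
move=> v' v'v.
have w : cmod (- t * (v' - v)%:C) <= eta.
  rewrite cmodM cmodN cmodr (le_trans _ v'v)// ler_piMl// ltW//.
have := taylor_cvg hr eta0 hz w.
have -> : 1 - v%:C * t + - t * (v' - v)%:C = 1 - v'%:C * t by rewrite rmorphB; ring.
have <- : (fun k => a k * (- t * (v' - v)%:C) ^+ k)
        = (fun k => a k * (- t) ^+ k * (v' - v)%:C ^+ k).
  by apply/funext => k; rewrite exprMn mulrA.
by [].
Qed.

Let g_left_cvg : (fun n => g (1 - n.+1%:R^-1)) @ \oo --> (g 1 : R[i]^o).
Proof.
have le_r v n : 0 <= v <= 1 -> cmod ((1 - v%:C * t) ^+ n) <= r ^+ n.
  move=> v01; rewrite cmodX lerXn2r ?nnegrE ?cmod_ge0//; first by rewrite ltW// (lt_trans _ r1).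
  apply: (le_trans (segment_lt v01)); case/andP: v01 => v0 v1.
  by rewrite -subr_ge0 (_ : _ - _ = (1 - v) * (r - 1)); [rewrite mulr_ge0 ?subr_ge0// ltW|ring].
have u01 n : 0 <= (1 - n.+1%:R^-1 : R) <= 1.
  by rewrite subr_ge0 invf_le1 ?ler1n ?ltr0n//= gerBl invr_ge0.
apply: (@csum_dominated R I _ _ _ (fun i => cmod (A i) * r ^+ e i)).
- exact: hr.
- by move=> i; rewrite cmodM ler_wpM2l ?cmod_ge0// le_r// lexx ler01.
- by apply: nearW => n i; rewrite cmodM ler_wpM2l ?cmod_ge0// le_r.
move=> i.
have hu : (fun n => (1 - (1 - n.+1%:R^-1)%:C * t) : R[i]) @ \oo --> (1 - 1%:C * t : R[i]^o).
  apply/ccvgP => d d0.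
  have [N _ hN] : \forall n \near \oo, (n.+1%:R^-1 : R) < d.
    have /cvgrPdist_lt/(_ d d0) := @cvg_harmonic R.
    by apply: filterS => n /=; rewrite sub0r normrN ger0_norm ?invr_ge0.
  exists N => //= n Nn.
  have -> : 1 - (1 - n.+1%:R^-1)%:C * t - (1 - 1%:C * t) = (n.+1%:R^-1)%:C * t.
    by rewrite rmorphB; ring.
  rewrite cmodM cmodr ger0_norm ?invr_ge0// (le_lt_trans _ (hN n Nn))//.
  by rewrite ler_piMr ?invr_ge0// ltW.
have hX m : (fun n => (1 - (1 - n.+1%:R^-1)%:C * t) ^+ m : R[i]) @ \oo
    --> ((1 - 1%:C * t) ^+ m : R[i]^o).
  elim: m => [|m IH].
    rewrite expr0; under eq_fun do rewrite expr0; exact: ccvg_cst.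
  rewrite exprS; under eq_fun do rewrite exprS; exact: (ccvgM hu IH).
exact: (ccvgM (@ccvg_cst R _ _ _ (A i)) (hX (e i))).
Qed.

(** Let [f z] be the sum of the [A i * z ^+ e i]. Its Taylor series at 1 is only
    known to converge at the point [1 - t], possibly conditionally, whereas [f] is
    analytic in a disc centred at 0 of radius greater than 1. On the segment from
    1 to [1 - t] both are analytic, except perhaps at the end point, and they agree
    near 1; the identity theorem makes them agree up to the end point, which is
    reached by Abel's theorem for the series and by dominated convergence for [f].
    Without analyticity of [f] at 1 the statement would fail, as flat functions
    show. *)
Lemma taylor_series_value (L : R[i]) :
  series (fun n => taylor_coef A e 1 n * (- t) ^+ n) @ \oo --> (L : R[i]^o) ->
  L = csum (fun i => A i * (1 - t) ^+ e i).
Proof.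
set c := (fun n => _) => hL.
have [K K0 cK] := ccvg_series_term hL.
pose D u := csum (fun n => c n * u%:C ^+ n).
have hD u : 0 <= u < 1 -> series (fun n => c n * u%:C ^+ n) @ \oo --> (D u : R[i]^o).
  move=> u01; apply: (csum_series (geometric_summable (ltW K0) u01)) => n.
  case/andP: u01 => u0 _.
  by rewrite cmodM cmodX cmodr ger0_norm// ler_wpM2r ?exprn_ge0.
(* For u < delta the Taylor series at 1 converges at 1 - u t, to g u. *)
have Dg u : 0 <= u < 1 -> D u = g u.
  move=> u01; apply/eqP; rewrite -subr_eq0; apply/eqP; move: u u01.
  have m0 : 0 < Num.min 1 delta by rewrite lt_min ltr01.
  apply: (identity_segment m0) => v /andP[v0 v1].
    apply: analytic_atB; last by apply: g_analytic; rewrite v0.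
    by apply: (csum_power_analytic cK); rewrite v0.
  move: v1; rewrite lt_min => /andP[v1 vd].
  have v01 : 0 <= v < 1 by rewrite v0.
  apply/eqP; rewrite subr_eq0; apply/eqP; apply: (ccvg_unique (hD v v01)).
  have z1 : cmod (1 : R[i]) + delta <= 1 + delta by rewrite cmod1.
  have w : cmod (- (v%:C * t)) <= delta.
    rewrite cmodN cmodM cmodr ger0_norm// (le_trans _ (ltW vd))//.
    by rewrite ler_piMr// ltW.
  have := taylor_cvg hA delta0 z1 w.
  have <- : (fun k => taylor_coef A e 1 k * (- (v%:C * t)) ^+ k)
          = (fun k => c k * v%:C ^+ k).
    by apply/funext => k; rewrite /c -mulrA -exprMn mulNr [t * _]mulrC.
  by [].
have -> : csum (fun i => A i * (1 - t) ^+ e i) = g 1.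
  by rewrite /g; congr csum; apply/funext => i; rewrite mul1r.
apply: (ccvg_unique _ g_left_cvg).
apply/ccvgP => d d0; have d2 : 0 < d / 2 by rewrite divr_gt0.
have [eps eps0 heps] := abel_limit hL hD d2.
have [N _ hN] : \forall n \near \oo, (n.+1%:R^-1 : R) < eps.
  have /cvgrPdist_lt/(_ eps eps0) := @cvg_harmonic R.
  by apply: filterS => n /=; rewrite sub0r normrN ger0_norm ?invr_ge0.
exists N => //= n Nn.
have u01 : 0 <= (1 - n.+1%:R^-1 : R) < 1.
  by rewrite subr_ge0 invf_le1 ?ler1n ?ltr0n//= gtrBl invr_gt0.
rewrite -Dg//; apply: (@le_lt_trans _ _ (d / 2)); last by rewrite ltr_pdivrMr// ltr_pMr// ltr1n.
by apply: heps => //; rewrite ltrD2l ltrN2 hN.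
Qed.

End Family.
End Core.

(** * Rising factorials and binomial coefficients *)

Section Binc.
Variable R : realType.
Implicit Types (x y z t : R[i]).

(** The finitely many terms before the index [N] only affect the constant. *)
Lemma eventually_geometric (u : nat -> R) (q : R) N : 0 < q ->
  (forall n, 0 <= u n) -> (forall n, (N <= n)%N -> u n.+1 <= q * u n) ->
  exists2 C, 0 < C & forall n, u n <= C * q ^+ n.
Proof.
move=> q0 u0 uq.
have S0 n : 0 <= u n / q ^+ n by rewrite divr_ge0 ?u0// exprn_ge0// ltW.
exists (1 + \sum_(i < N.+1) u i / q ^+ i); first by rewrite ltr_wpDr// sumr_ge0.
have low n : (n <= N)%N -> u n <= (1 + \sum_(i < N.+1) u i / q ^+ i) * q ^+ n.
  move=> nN; rewrite -ler_pdivrMr ?exprn_gt0//.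
  rewrite (bigD1 (Ordinal (nN : (n < N.+1)%N)))//= addrCA lerDl addr_ge0//.
  by rewrite sumr_ge0.
elim=> [|n IH]; first exact: low.
have [nN|Nn] := leqP n.+1 N; first exact: low.
rewrite (le_trans (uq n _))// exprS mulrCA ler_wpM2l// ltW//.
Qed.

Lemma archi_nat (x : R) : exists N, forall n, (N <= n)%N -> x <= n%:R.
Proof.
exists (Num.truncn x).+1 => n Nn; apply: (@le_trans _ _ (Num.truncn x).+1%:R).
  exact/ltW/truncnS_gt.
by rewrite ler_nat.
Qed.

Lemma risingS x n : rising x n.+1 = rising x n * (x + n%:R).
Proof. by rewrite /rising big_ord_recr. Qed.

Lemma rising0 x : rising x 0 = 1.
Proof. by rewrite /rising big_ord0. Qed.

Lemma rising_shift x n : rising x n.+1 = x * rising (x + 1) n.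
Proof.
rewrite /rising big_ord_recl /= addr0; congr (_ * _); apply: eq_bigr => i _.
by rewrite -addrA -natr1 [X in _ + X]addrC.
Qed.

Lemma cmod_rising_le x n : cmod (rising x n) <= \prod_(i < n) (cmod x + i%:R).
Proof.
rewrite /rising cmod_prod ler_prod// => i _; rewrite cmod_ge0 /=.
by rewrite (le_trans (cmod_le_add _ _))// cmod_nat.
Qed.

(** The ratio of two consecutive values of [rising x n / n!] has modulus at most
    [(K + n) / (n + 1)], eventually below [1 + eps]. *)
Lemma rising_le_uniform (K eps : R) : 0 < eps -> 0 <= K -> exists2 C, 0 < C &
  forall x n, cmod x <= K -> cmod (rising x n) <= C * (1 + eps) ^+ n * n`!%:R.
Proof.
move=> eps0 K0; have [N hN] := archi_nat (K / eps).
pose u n := (\prod_(i < n) (K + i%:R)) / n`!%:R.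
have [] := @eventually_geometric u (1 + eps) N _ _ _.
- by rewrite addr_gt0.
- by move=> n; rewrite divr_ge0// prodr_ge0// => i _; rewrite addr_ge0.
- move=> n Nn; rewrite /u big_ord_recr /= factS natrM.
  have P0 : 0 <= \prod_(i < n) (K + i%:R) by rewrite prodr_ge0// => i _; rewrite addr_ge0.
  have f0 : (n`!%:R : R) != 0 by rewrite pnatr_eq0 -lt0n fact_gt0.
  move: (\prod_(i < n) _) P0 => P P0.
  have -> : P * (K + n%:R) / (n.+1%:R * n`!%:R) = P / n`!%:R * ((K + n%:R) / n.+1%:R).
    by rewrite invfM; ring.
  rewrite [leRHS]mulrC; apply: ler_wpM2l; first by rewrite divr_ge0.
  rewrite ler_pdivrMr// -natr1 mulrDl mul1r mulrDr mulr1.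
  have : K <= eps * n%:R by rewrite mulrC -ler_pdivrMr// hN.
  move: eps0; lra.
move=> C C0 hC; exists C => // x n xK.
rewrite -ler_pdivrMr ?ltr0n ?fact_gt0//; apply: le_trans (hC n).
rewrite /u ler_wpM2r ?invr_ge0// (le_trans (cmod_rising_le _ _))//.
by rewrite ler_prod// => i _; rewrite addr_ge0 ?cmod_ge0//= lerD2r.
Qed.

Lemma rising_le x (eps : R) : 0 < eps -> exists2 C, 0 < C &
  forall n, cmod (rising x n) <= C * (1 + eps) ^+ n * n`!%:R.
Proof.
move=> eps0; have [C C0 hC] := rising_le_uniform eps0 (cmod_ge0 x).
by exists C => // n; apply: hC.
Qed.

Lemma rising_ge x (eps : R) : 0 < eps -> (forall n, rising x n != 0) ->
  exists2 C, 0 < C &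
  forall n, n`!%:R <= C * (1 + eps) ^+ n * cmod (rising x n).
Proof.
move=> eps0 x0; have [N hN] := archi_nat ((1 + (1 + eps) * cmod x) / eps).
pose u n := n`!%:R / cmod (rising x n).
have x0' n : 0 < cmod (rising x n) by rewrite cmod_gt0.
have xn n : 0 < cmod (x + n%:R).
  by have := x0' n.+1; rewrite risingS cmodM pmulr_rgt0.
have [] := @eventually_geometric u (1 + eps) N _ _ _.
- by rewrite addr_gt0.
- by move=> n; rewrite divr_ge0// cmod_ge0.
- move=> n Nn; rewrite /u risingS cmodM factS natrM invfM.
  have -> : n.+1%:R * n`!%:R * ((cmod (rising x n))^-1 * (cmod (x + n%:R))^-1)
      = n`!%:R / cmod (rising x n) * (n.+1%:R / cmod (x + n%:R)) by ring.
  rewrite [leRHS]mulrC; apply: ler_wpM2l; first by rewrite divr_ge0// cmod_ge0.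
  rewrite ler_pdivrMr//.
  have h : 1 + (1 + eps) * cmod x <= eps * n%:R by rewrite [leRHS]mulrC -ler_pdivrMr// hN.
  have h2 : n%:R - cmod x <= cmod (x + n%:R).
    by have := cmod_sub_le (n%:R) x; rewrite cmod_nat [_ + x]addrC.
  have e1 : 0 <= 1 + eps by rewrite addr_ge0// ltW.
  apply: le_trans (ler_wpM2l e1 h2).
  by rewrite -natr1; move: h; lra.
move=> C C0 hC; exists C => // n.
by rewrite -ler_pdivrMr//; apply: hC.
Qed.

(** The coefficient of [t ^+ n] in the expansion of [(1 - t)] to the power [- x]. *)
Definition binc x n : R[i] := rising x n / n`!%:R.

Lemma bincS x n : n.+1%:R * binc x n.+1 = (x + n%:R) * binc x n.
Proof.
rewrite /binc risingS factS natrM invfM.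
have n0 : (n.+1%:R : R[i]) / n.+1%:R = 1 by rewrite divff// pnatr_eq0.
move: (n.+1%:R : R[i]) n0 => N1 n0; rewrite -[RHS]mul1r -n0; ring.
Qed.

Lemma binc0 x : binc x 0 = 1.
Proof. by rewrite /binc rising0 divr1. Qed.

(** Both sides satisfy the recurrence [(n + 1) u (n + 1) = (x + y + n) u n]: split
    [n + 1] as [j + (n + 1 - j)] inside the sum. *)
Lemma vandermonde x y n :
  \sum_(j < n.+1) binc x j * binc y (n - j)%N = binc (x + y) n.
Proof.
elim: n => [|n IH]; first by rewrite big_ord1 !binc0 mulr1.
have n0 : (n.+1%:R : R[i]) != 0 by rewrite pnatr_eq0.
apply: (mulfI n0); rewrite bincS -IH.
have -> : n.+1%:R * (\sum_(j < n.+2) binc x j * binc y (n.+1 - j)%N)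
  = \sum_(j < n.+2) (j%:R * binc x j) * binc y (n.+1 - j)%N
  + \sum_(j < n.+2) binc x j * ((n.+1 - j)%N%:R * binc y (n.+1 - j)%N).
  rewrite mulr_sumr -big_split; apply: eq_bigr => j _ /=.
  have -> : (n.+1%:R : R[i]) = j%:R + (n.+1 - j)%N%:R.
    by rewrite -natrD subnKC// -ltnS ltn_ord.
  by ring.
rewrite big_ord_recl /= mul0r mul0r add0r [X in _ + X]big_ord_recr /=.
rewrite subnn mul0r mulr0 addr0 -big_split mulr_sumr /=.
apply: eq_bigr => j _; rewrite /bump /= add1n subSS.
have jn : (j <= n)%N by rewrite -ltnS ltn_ord.
rewrite subSn// !bincS natrB//; ring.
Qed.

Lemma bincNn p n : binc (- p%:R) n = (-1) ^+ n * 'C(p, n)%:R.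
Proof.
elim: n => [|n IH]; first by rewrite binc0 bin0 mulr1.
have n0 : (n.+1%:R : R[i]) != 0 by rewrite pnatr_eq0.
apply: (mulfI n0); rewrite bincS IH exprS.
have : (n.+1%:R * 'C(p, n.+1)%:R : R[i]) = (p%:R - n%:R) * 'C(p, n)%:R.
  have [np|pn] := leqP n p; last first.
    by rewrite !bin_small ?mulr0// ltnW.
  by rewrite -natrB// -!natrM mul_bin_left.
move=> h; transitivity ((-1) ^+ n * -1 * (n.+1%:R * 'C(p, n.+1)%:R) : R[i]); last by ring.
rewrite h; ring.
Qed.

Lemma binc_summable x (r : R) : 0 <= r < 1 ->
  summable_bound (fun n => cmod (binc x n) * r ^+ n).
Proof.
move=> /andP[r0 r1].
have [eps eps0 er] : exists2 eps, 0 < eps & (1 + eps) * r < 1.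
  by exists ((1 - r) / 2); nra.
have [C C0 hC] := rising_le x eps0.
have er01 : 0 <= (1 + eps) * r < 1 by rewrite er mulr_ge0// addr_ge0// ltW.
apply: (summable_bound_le _ (geometric_summable (ltW C0) er01)) => n.
rewrite mulr_ge0 ?cmod_ge0 ?exprn_ge0//= exprMn mulrA ler_wpM2r ?exprn_ge0//.
by rewrite cmodM cmodV cmod_nat ler_pdivrMr ?ltr0n ?fact_gt0.
Qed.

End Binc.

Section BincProduct.
Variable R : realType.

Lemma binc_cvg_bound (x t : R[i]) : cmod t < 1 ->
  summable_bound (fun n => cmod (binc x n * t ^+ n)).
Proof.
move=> t1; have t01 : 0 <= cmod t < 1 by rewrite cmod_ge0.
have := binc_summable x t01; congr summable_bound.
by apply/funext => n; rewrite cmodM cmodX.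
Qed.

Lemma binc_series (x t : R[i]) : cmod t < 1 ->
  series (fun n => binc x n * t ^+ n) @ \oo
    --> (csum (fun n => binc x n * t ^+ n) : R[i]^o).
Proof. by move=> t1; exact: (csum_series (binc_cvg_bound x t1)). Qed.

Lemma binc_product (x y t : R[i]) : cmod t < 1 ->
  csum (fun n => binc x n * t ^+ n) * csum (fun n => binc y n * t ^+ n)
  = csum (fun n => binc (x + y) n * t ^+ n).
Proof.
move=> t1.
have := cauchy_product_cvg (binc_cvg_bound x t1) (binc_series (x := y) t1).
have -> : (fun n => \sum_(j < n.+1)
      (binc x j * t ^+ j) * (binc y (n - j) * t ^+ (n - j)))
    = (fun n => binc (x + y) n * t ^+ n).
  apply/funext => n; rewrite -vandermonde mulr_suml; apply: eq_bigr => j _.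
  by rewrite mulrACA -exprD subnKC// -ltnS ltn_ord.
by move=> h; exact: (ccvg_unique h (binc_series t1)).
Qed.

Lemma binc_sum_N1 (t : R[i]) : csum (fun n => binc (-1) n * t ^+ n) = 1 - t.
Proof.
have N1 : (-1 : R[i]) = - 1%:R by [].
rewrite (@csum_finite _ _ 2) => [|n n2].
  rewrite !big_ord_recl big_ord0 N1 !bincNn /= expr0 bin0 /bump /= bin1.
  by rewrite !mul1r expr0 !expr1; ring.
by rewrite N1 bincNn bin_small// mulr0 mul0r.
Qed.

(** The derivative of the binomial series of parameter [x] is [x] times the one
    of parameter [x + 1]; this relation turns that fact into a differential
    equation. *)
Lemma binc_ode (x t : R[i]) : cmod t < 1 ->
  (1 - t) * csum (fun n => binc (x + 1) n * t ^+ n)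
  = csum (fun n => binc x n * t ^+ n).
Proof.
move=> t1; rewrite -binc_sum_N1 binc_product//.
by rewrite addrCA addNr addr0.
Qed.

End BincProduct.

(** * Complex functions of a real variable *)

Section ComplexDerivative.
Variable R : realType.
Implicit Types (f g : R -> R[i]) (u : R) (z d : R[i]).

(** Complex-valued functions of a real variable are differentiated by components,
    so that the mean value theorem applies. *)
Definition cderiv f u d :=
  is_derive u 1 (fun v => complex.Re (f v)) (complex.Re d) /\
  is_derive u 1 (fun v => complex.Im (f v)) (complex.Im d).

Lemma Re_mulc z w : complex.Re (z * w) = complex.Re z * complex.Re w - complex.Im z * complex.Im w.
Proof. by case: z w => [a b] [c d]. Qed.

Lemma Im_mulc z w : complex.Im (z * w) = complex.Re z * complex.Im w + complex.Im z * complex.Re w.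
Proof. by case: z w => [a b] [c d]. Qed.

Lemma Re_addc z w : complex.Re (z + w) = complex.Re z + complex.Re w.
Proof. by case: z w => [a b] [c d]. Qed.

Lemma Im_addc z w : complex.Im (z + w) = complex.Im z + complex.Im w.
Proof. by case: z w => [a b] [c d]. Qed.

Lemma cderivM f g u d e : cderiv f u d -> cderiv g u e ->
  cderiv (fun v => f v * g v) u (d * g u + f u * e).
Proof.
move=> [f1 f2] [g1 g2]; split.
  rewrite Re_addc !Re_mulc; under eq_fun do rewrite Re_mulc.
  by apply: is_derive_eq; rewrite /GRing.scale /=; ring.
rewrite Im_addc !Im_mulc; under eq_fun do rewrite Im_mulc.
by apply: is_derive_eq; rewrite /GRing.scale /=; ring.
Qed.

Lemma cderiv_cexp f u d : cderiv f u d ->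
  cderiv (fun v => cexp (f v)) u (d * cexp (f u)).
Proof.
move=> [f1 f2].
have eR v : complex.Re (cexp (f v)) = expR (complex.Re (f v)) * cos (complex.Im (f v)).
  by rewrite /cexp Re_mulc /= mul0r subr0.
have eI v : complex.Im (cexp (f v)) = expR (complex.Re (f v)) * sin (complex.Im (f v)).
  by rewrite /cexp Im_mulc /= mul0r addr0.
have h1 := is_derive1_comp (is_derive_expR (complex.Re (f u))) f1.
have h2 := is_derive1_comp (is_derive_cos (complex.Im (f u))) f2.
have h3 := is_derive1_comp (is_derive_sin (complex.Im (f u))) f2.
split.
  under eq_fun do rewrite eR.
  rewrite Re_mulc eR eI; apply: (is_derive_eq (is_deriveM h1 h2)).
  by rewrite /GRing.scale /=; ring.
under eq_fun do rewrite eI.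
rewrite Im_mulc eR eI; apply: (is_derive_eq (is_deriveM h1 h3)).
by rewrite /GRing.scale /=; ring.
Qed.

Lemma cderivZ f u d c : cderiv f u d -> cderiv (fun v => c * f v) u (c * d).
Proof.
move=> [f1 f2]; split.
  rewrite Re_mulc; under eq_fun do rewrite Re_mulc.
  by apply: is_derive_eq; rewrite /GRing.scale /=; ring.
rewrite Im_mulc; under eq_fun do rewrite Im_mulc.
by apply: is_derive_eq; rewrite /GRing.scale /=; ring.
Qed.

Lemma cderiv0_cst f : (forall u, 0 <= u <= 1 -> cderiv f u 0) -> f 1 = f 0.
Proof.
move=> fd.
have aux (h : R -> R) : (forall u, 0 <= u <= 1 -> is_derive u 1 h 0) -> h 1 = h 0.
  move=> hd; have [||c _ /eqP] := @MVT _ h (fun=> 0) 0 1 ltr01.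
  - by move=> x; rewrite in_itv /= => /andP[x0 x1]; apply: hd; rewrite !ltW.
  - apply: derivable_within_continuous => x; rewrite in_itv /= => x01.
    by have := hd x x01; case.
  by rewrite mul0r subr_eq0 => /eqP.
apply/eqP; rewrite eq_complex; apply/andP; split; apply/eqP.
  by apply: (aux (fun v => complex.Re (f v))) => u /fd[].
by apply: (aux (fun v => complex.Im (f v))) => u /fd[].
Qed.

End ComplexDerivative.

Section Log.
Variable R : realType.

Lemma cexpN (z : R[i]) : cexp z * cexp (- z) = 1.
Proof.
case: z => a b; rewrite /cexp /= cosN sinN expRN.
have e0 : expR a != 0 by rewrite gt_eqF ?expR_gt0.
have := cos2Dsin2 b.
set c := cos b; set s := sin b => cs.
apply/eqP; rewrite eq_complex /= !mul0r !subr0 !addr0; apply/andP; split; apply/eqP.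
  transitivity ((expR a / expR a) * (c ^+ 2 + s ^+ 2)); first by ring.
  by rewrite cs divff// mulr1.
ring.
Qed.

Lemma cexp0 : cexp (0 : R[i]) = 1.
Proof. by rewrite /cexp /= expR0 cos0 sin0 mul1r. Qed.

Lemma cexp_neq0 (z : R[i]) : cexp z != 0.
Proof.
by apply: contra_eq_neq (cexpN z) => ->; rewrite mul0r eq_sym oner_neq0.
Qed.

(** In the right half plane the principal argument is an arctangent, which is
    smooth across the real axis, unlike its definition by cases. *)
Lemma clog_right (z : R[i]) : 0 < complex.Re z ->
  clog z = (ln (complex.Re z ^+ 2 + complex.Im z ^+ 2) / 2)
           +i* atan (complex.Im z / complex.Re z).
Proof.
case: z => a b /= a0; rewrite /clog.
have N0 : 0 < a ^+ 2 + b ^+ 2 by rewrite ltr_wpDr ?sqr_ge0// exprn_gt0.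
have cm : cmod (a +i* b) = Num.sqrt (a ^+ 2 + b ^+ 2) by [].
congr (_ +i* _).
  rewrite cm -{2}(sqr_sqrtr (ltW N0)) lnXn ?sqrtr_gt0//.
  by rewrite -[ln _ *+ 2]mulr_natr mulfK// pnatr_eq0.
rewrite /carg cm /=.
have -> : a / Num.sqrt (a ^+ 2 + b ^+ 2) = cos (atan (b / a)).
  rewrite cos_atan.
  have -> : 1 + (b / a) ^+ 2 = (a ^+ 2 + b ^+ 2) / a ^+ 2.
    by field; rewrite gt_eqF.
  rewrite sqrtrM ?(ltW N0)// sqrtrV ?sqr_ge0// sqrtr_sqr gtr0_norm//.
  by rewrite invfM invrK mulrC.
have pi0 := pi_gt0 R.
have ubd := atan_ltpi2 (b / a); have lbd := atan_gtNpi2 (b / a).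
case: ifP => [b0|/negbT].
  have t0 : 0 <= atan (b / a) by rewrite -atan0; apply: le_atan; rewrite divr_ge0// ltW.
  by rewrite cosK// in_itv /= t0; move: ubd pi0; lra.
rewrite -ltNge => b0; rewrite -cosN cosK ?opprK// in_itv /=.
have t0 : atan (b / a) <= 0.
  by rewrite -atan0; apply: le_atan; rewrite pmulr_lle0 ?invr_gt0// ltW.
by apply/andP; split; move: t0 lbd pi0; lra.
Qed.

(** The logarithm of [1 - v t] on the whole line, given by the formula valid in the
    right half plane, so that its derivative needs no localization. *)
Definition segment_log (t : R[i]) (v : R) : R[i] :=
  let z := 1 - v%:C * t in
  (ln (complex.Re z ^+ 2 + complex.Im z ^+ 2) / 2)
   +i* atan (complex.Im z / complex.Re z).

Lemma segment_log_derive (t : R[i]) u : 0 < complex.Re (1 - u%:C * t) ->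
  cderiv (segment_log t) u (- t / (1 - u%:C * t)).
Proof.
case: t => a b.
have reE v : complex.Re (1 - v%:C * (a +i* b)) = 1 - v * a by rewrite /= mul0r subr0.
have imE v : complex.Im (1 - v%:C * (a +i* b)) = - (v * b) by rewrite /= mul0r addr0 sub0r.
rewrite reE => X0.
have N0 : 0 < (1 - u * a) ^+ 2 + (- (u * b)) ^+ 2.
  by rewrite ltr_wpDr ?sqr_ge0// exprn_gt0.
have dX : is_derive u 1 (fun v => 1 - v * a) (- a).
  by apply: is_derive_eq; rewrite /GRing.scale /=; ring.
have dY : is_derive u 1 (fun v => - (v * b)) (- b).
  by apply: is_derive_eq; rewrite /GRing.scale /=; ring.
have Xn0 : 1 - u * a != 0 by rewrite gt_eqF.
have dV : is_derive u 1 (fun v => - (v * b) / (1 - v * a))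
   (- b / (1 - u * a) + (u * b) * (- (1 - u * a) ^- 2 * a)).
  have dXV := @is_deriveV R (fun v => 1 - v * a) u _ 1 Xn0 dX.
  by apply: (is_derive_eq (is_deriveM dY dXV)); rewrite /GRing.scale /=; ring.
have dN : is_derive u 1 (fun v => (1 - v * a) ^+ 2 + (- (v * b)) ^+ 2)
   (- 2 * a * (1 - u * a) + 2 * b * (u * b)).
  by apply: is_derive_eq; rewrite /GRing.scale /=; ring.
have dL := @is_derive1_comp R (@ln R)
  (fun v => (1 - v * a) ^+ 2 + (- (v * b)) ^+ 2) u _ _ (is_derive1_ln N0) dN.
have dA := @is_derive1_comp R (@atan R)
  (fun v => - (v * b) / (1 - v * a)) u _ _ (is_derive1_atan _) dV.
have wE : - (a +i* b) / (1 - u%:C * (a +i* b)) =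
  ((- a * (1 - u * a) + u * b * b) / ((1 - u * a) ^+ 2 + (u * b) ^+ 2))
   +i* (- b / ((1 - u * a) ^+ 2 + (u * b) ^+ 2)).
  have N0' : (1 - u * a) ^+ 2 + (u * b) ^+ 2 != 0 by rewrite -[(u * b) ^+ 2]sqrrN gt_eqF.
  apply/eqP; rewrite eq_complex /= !mul0r !subr0 !addr0 !sub0r sqrrN.
  by apply/andP; split; apply/eqP; field.
have rE v : segment_log (a +i* b) v = (ln ((1 - v * a) ^+ 2 + (- (v * b)) ^+ 2) / 2)
    +i* atan (- (v * b) / (1 - v * a)) by rewrite /segment_log reE imE.
have N0' : (1 - u * a) ^+ 2 + (u * b) ^+ 2 != 0.
  by rewrite -[(u * b) ^+ 2]sqrrN gt_eqF.
rewrite wE; split.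
  under eq_fun do rewrite rE /=.
  apply: (is_derive_eq (is_deriveM dL (is_derive_cst (2^-1 : R) u 1))).
  by rewrite /GRing.scale /= sqrrN; field.
under eq_fun do rewrite rE /=.
apply: (is_derive_eq dA).
by rewrite /=; field; rewrite Xn0 N0'.
Qed.

End Log.

(** * The binomial series *)

Section BinomialSeries.
Variable R : realType.
Implicit Types (c : nat -> R[i]).

(** A real power series for each component, so that termwise differentiation of
    real power series is available. *)
Definition real_power_sum c (v : R) : R[i] :=
  limn (pseries (fun n => complex.Re (c n)) v)
  +i* limn (pseries (fun n => complex.Im (c n)) v).

Lemma pseries_csum c (v : R) :
  summable_bound (fun n => cmod (c n * v%:C ^+ n)) ->
  pseries (fun n => complex.Re (c n)) v @ \oo --> complex.Re (csum (fun n => c n * v%:C ^+ n)) /\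
  pseries (fun n => complex.Im (c n)) v @ \oo --> complex.Im (csum (fun n => c n * v%:C ^+ n)).
Proof.
move=> hc; have h := csum_series hc (fun n => lexx _).
have vX n : (v%:C ^+ n : R[i]) = (v ^+ n)%:C by rewrite rmorphXn.
have rE : pseries (fun n => complex.Re (c n)) v
    = (fun N => complex.Re (series (fun n => c n * v%:C ^+ n) N)).
  apply/funext => N; rewrite /pseries !series_ord.
  elim: N => [|N IH]; first by rewrite !big_ord0.
  by rewrite !big_ord_recr /= Re_addc IH Re_mulc vX /= mulr0 subr0.
have iE : pseries (fun n => complex.Im (c n)) v
    = (fun N => complex.Im (series (fun n => c n * v%:C ^+ n) N)).
  apply/funext => N; rewrite /pseries !series_ord.
  elim: N => [|N IH]; first by rewrite !big_ord0.
  by rewrite !big_ord_recr /= Im_addc IH Im_mulc vX /= mulr0 add0r.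
by rewrite rE iE; split; [exact: (ccvg_Re h)|exact: (ccvg_Im h)].
Qed.

Lemma real_power_sumE c (v : R) : summable_bound (fun n => cmod (c n * v%:C ^+ n)) ->
  real_power_sum c v = csum (fun n => c n * v%:C ^+ n).
Proof.
move=> /pseries_csum[h1 h2]; rewrite /real_power_sum.
have -> := cvg_lim (@Rhausdorff R) h1.
have -> := cvg_lim (@Rhausdorff R) h2.
by case: (csum _).
Qed.

Definition deriv_coef c n : R[i] := n.+1%:R * c n.+1.

Lemma pseries_deriv_coef c :
  pseries_diffs (fun n => complex.Re (c n)) = (fun n => complex.Re (deriv_coef c n)) /\
  pseries_diffs (fun n => complex.Im (c n)) = (fun n => complex.Im (deriv_coef c n)).
Proof.
have nE n : (n.+1%:R : R[i]) = (n.+1%:R : R)%:C by rewrite rmorph_nat.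
by split; apply/funext => n; rewrite /pseries_diffs /deriv_coef nE ?Re_mulc ?Im_mulc /= mul0r
  ?subr0 ?addr0.
Qed.

Lemma real_power_sum_derive c (K v : R) :
  summable_bound (fun n => cmod (c n * K%:C ^+ n)) ->
  summable_bound (fun n => cmod (deriv_coef c n * K%:C ^+ n)) ->
  summable_bound (fun n => cmod (deriv_coef (deriv_coef c) n * K%:C ^+ n)) ->
  `|v| < `|K| ->
  cderiv (real_power_sum c) v (real_power_sum (deriv_coef c) v).
Proof.
move=> /pseries_csum[r0 i0] /pseries_csum[r1 i1] /pseries_csum[r2 i2] vK.
have [dR dI] := pseries_deriv_coef c; have [ddR ddI] := pseries_deriv_coef (deriv_coef c).
split; rewrite /real_power_sum /= -?dR -?dI.
  by apply: pseries_snd_diffs vK; rewrite ?dR ?ddR; apply/cvg_ex; eexists; eassumption.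
by apply: pseries_snd_diffs vK; rewrite ?dI ?ddI; apply/cvg_ex; eexists; eassumption.
Qed.

(** Along the segment from 0 to [t], the product of the series with
    [(1 - v t)] to the power [b] has zero derivative. *)
Lemma binc_value (b t : R[i]) : cmod t < 1 ->
  csum (fun n => binc b n * t ^+ n) = cpow (1 - t) (- b).
Proof.
move=> t1.
pose c x n : R[i] := binc x n * t ^+ n.
have cd x : deriv_coef (c x) = (fun n => x * t * c (x + 1) n).
  apply/funext => n; rewrite /deriv_coef /c mulrA bincS exprS.
  have -> : (x + n%:R) * binc x n = x * binc (x + 1) n.
    by rewrite /binc !mulrA -rising_shift risingS [_ * rising x n]mulrC.
  by ring.
(* Here 1 < K and K |t| < 1, so that [0, 1] is interior to all the domains of
   convergence. *)
pose K : R := 2 / (1 + cmod t).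
have t0 := cmod_ge0 t.
have c1 : 0 < 1 + cmod t by rewrite ltr_wpDr.
have K1 : 1 < K by rewrite ltr_pdivlMr// mul1r; move: t1; lra.
have tK (v : R) : `|v| <= K -> cmod (v%:C * t) < 1.
  move=> vK; rewrite cmodM cmodr (le_lt_trans (ler_wpM2r t0 vK))//.
  by rewrite /K mulrAC ltr_pdivrMr// mul1r; move: t1; lra.
have K0 : `|K| = K by rewrite ger0_norm// (le_trans _ (ltW K1)).
have cX x (v : R) : (fun n => c x n * v%:C ^+ n) = (fun n => binc x n * (v%:C * t) ^+ n).
  by apply/funext => n; rewrite /c exprMn -mulrA [t ^+ n * _]mulrC.
have cs x (v : R) : `|v| <= K -> summable_bound (fun n => cmod (c x n * v%:C ^+ n)).
  move=> /tK vt; have := @binc_cvg_bound _ x _ vt; congr summable_bound.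
  by apply/funext => n; have /(congr1 (fun f => f n)) /= -> := cX x v.
have csZ d x (v : R) : `|v| <= K -> summable_bound (fun n => cmod (d * c x n * v%:C ^+ n)).
  move=> vK; have := summable_boundZ (cmod_ge0 d) (cs x v vK); congr summable_bound.
  by apply/funext => n; rewrite -cmodM mulrA.
have cdd x : deriv_coef (deriv_coef (c x)) = (fun n => x * t * ((x + 1) * t) * c (x + 1 + 1) n).
  apply/funext => n; have /(congr1 (fun f => f n)) := cd (x + 1); rewrite /deriv_coef -/(deriv_coef (c x)).
  have := congr1 (fun f => f n.+1) (cd x); rewrite {1}/deriv_coef /= => ->.
  by move=> h; rewrite mulrCA h; ring.
have F_deriv v : `|v| < K -> cderiv (real_power_sum (c b)) v (b * t * real_power_sum (c (b + 1)) v).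
  move=> vK; have vK' := ltW vK.
  have -> : b * t * real_power_sum (c (b + 1)) v = real_power_sum (deriv_coef (c b)) v.
    rewrite cd !real_power_sumE; [|exact: csZ|exact: cs].
    rewrite -(csumZ _ (cs (b + 1) v vK') (fun n => lexx _)).
    by congr csum; apply/funext => n; rewrite mulrA.
  apply: (@real_power_sum_derive _ K); last by rewrite K0.
  - by apply: cs; rewrite K0.
  - by rewrite cd; apply: csZ; rewrite K0.
  - by rewrite cdd; apply: csZ; rewrite K0.
(* With F_deriv, this makes F a solution of (1 - v t) F' = b t F. *)
have F_ode v : `|v| <= K -> (1 - v%:C * t) * real_power_sum (c (b + 1)) v = real_power_sum (c b) v.
  move=> vK; rewrite !real_power_sumE; [|exact: cs|exact: cs].
  by rewrite !cX binc_ode// tK.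
have Re_pos v : `|v| <= K -> 0 < complex.Re (1 - v%:C * t).
  move=> /tK h; rewrite Re_addc /= -/(complex.Re _).
  have := le_lt_trans (Re_le_cmod _) h; rewrite ltr_norml => /andP[_].
  by case: (v%:C * t) => p q /=; rewrite subr_gt0.
have unit_K v : 0 <= v <= 1 -> `|v| < K.
  by move=> /andP[v0 v1]; rewrite ger0_norm// (le_lt_trans v1).
pose G v := real_power_sum (c b) v * cexp (b * segment_log t v).
have G_deriv v : 0 <= v <= 1 -> cderiv G v 0.
  move=> /unit_K vK; have vK' := ltW vK.
  have L := cderiv_cexp (cderivZ b (segment_log_derive (Re_pos v vK'))).
  have := cderivM (F_deriv v vK) L.
  have z0 : 1 - v%:C * t != 0.
    by apply: contraTneq (Re_pos v vK') => ->; rewrite /= ltxx.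
  congr cderiv; rewrite -(F_ode v vK').
  by field.
have G01 := cderiv0_cst G_deriv.
have rl v : `|v| <= K -> segment_log t v = clog (1 - v%:C * t).
  by move=> /Re_pos/clog_right ->.
have one_K : `|1| <= K by rewrite normr1 ltW.
have F1 : real_power_sum (c b) 1 = csum (fun n => binc b n * t ^+ n).
  rewrite real_power_sumE; last exact: cs.
  congr csum; apply/funext => n.
  by rewrite /c rmorph1 expr1n mulr1.
have F0 : real_power_sum (c b) 0 = 1.
  have zK : `|0 : R| <= K by rewrite normr0 (le_trans ler01 (ltW K1)).
  rewrite real_power_sumE; last exact: cs.
  rewrite (@csum_finite _ _ 1).
    by rewrite big_ord1 /c binc0 !expr0 !mulr1.
  by case=> // n _; rewrite rmorph0 expr0n mulr0.
have L0 : segment_log t 0 = 0.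
  rewrite /segment_log rmorph0 mul0r subr0 /= expr1n expr0n addr0 ln1 mul0r.
  by rewrite mul0r atan0.
move: G01; rewrite /G F1 F0 L0 mulr0 cexp0 mulr1 rl// rmorph1 mul1r => h.
rewrite /cpow mulNr.
have e0 := cexp_neq0 (b * clog (1 - t)).
by apply: (mulIf e0); rewrite h mulrC cexpN.
Qed.

Lemma cpowN (z a : R[i]) : cpow z a * cpow z (- a) = 1.
Proof. by rewrite /cpow mulNr cexpN. Qed.

End BinomialSeries.

(** * The generating function of a family of binomial coefficients *)

Section Generating.
Variables (R : realType) (I : choiceType) (A : I -> R[i]) (e : I -> nat).
Variables (b t : R[i]) (delta : R).
Hypotheses (delta0 : 0 < delta) (t1 : cmod t < 1)
  (hA : summable_bound (fun i => cmod (A i) * (1 + delta) ^+ e i)).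

Let z1 : cmod (1 : R[i]) + delta <= 1 + delta.
Proof. by rewrite cmod1. Qed.

(* The coefficients of the series in t, and up to sign those of the Taylor series
   at 1; each is the convolution of the other with a binomial series. *)
Let c n := csum (fun i => A i * binc (b - (e i)%:R) n).
Let d n := csum (fun i => A i * binc (- (e i)%:R) n).

Let dM n i : cmod (A i * binc (- (e i)%:R) n)
  <= delta ^- n * (cmod (A i) * (1 + delta) ^+ e i).
Proof.
apply: le_trans (taylor_term_le A e delta0 z1 n i).
by rewrite bincNn !cmodM cmodMn !cmodX cmodN cmod1 !expr1n cmod_nat mul1r.
Qed.

Let dS n := taylor_summable hA delta0 n.

Let d_taylor : (fun n => d n * t ^+ n) = (fun n => taylor_coef A e 1 n * (- t) ^+ n).
Proof.
apply/funext => n; rewrite [(- t) ^+ n]exprNn mulrA; congr (_ * _).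
rewrite mulrC /d /taylor_coef.
rewrite -(csumZ _ (dS n) (taylor_term_le A e delta0 z1 n)); congr csum.
by apply/funext => i; rewrite bincNn expr1n mulrCA.
Qed.

Let cM n i : cmod (A i * binc (b - (e i)%:R) n)
  <= \sum_(j < n.+1) cmod (binc b j) * (delta ^- (n - j) * (cmod (A i) * (1 + delta) ^+ e i)).
Proof.
rewrite -vandermonde mulr_sumr (le_trans (cmod_sum _ _ _))//.
apply: ler_sum => j _; rewrite mulrCA cmodM.
by apply: ler_wpM2l; [exact: cmod_ge0|exact: dM].
Qed.

Let cS n : summable_bound (fun i =>
  \sum_(j < n.+1) cmod (binc b j) * (delta ^- (n - j) * (cmod (A i) * (1 + delta) ^+ e i))).
Proof.
apply: (@summable_bound_sum R I n.+1 (fun j i =>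
  cmod (binc b j) * (delta ^- (n - j) * (cmod (A i) * (1 + delta) ^+ e i)))) => j.
exact: (summable_boundZ (cmod_ge0 _) (dS _)).
Qed.

Let c_conv n : c n = \sum_(j < n.+1) binc b j * d (n - j)%N.
Proof.
transitivity (\sum_(j < n.+1) csum (fun i => binc b j * (A i * binc (- (e i)%:R) (n - j)))).
  pose f j i := binc b j * (A i * binc (- (e i)%:R) (n - j)).
  rewrite -(@csum_sum R I n.+1 (fun j i => cmod (binc b j)
     * (delta ^- (n - j) * (cmod (A i) * (1 + delta) ^+ e i))) f).
  - rewrite /c; congr csum; apply/funext => i; rewrite -vandermonde mulr_sumr.
    by apply: eq_bigr => j _; rewrite mulrCA.
  - by move=> j; exact: (summable_boundZ (cmod_ge0 _) (dS _)).
  - move=> j i; rewrite /f cmodM; apply: ler_wpM2l; [exact: cmod_ge0|exact: dM].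
by apply: eq_bigr => j _; rewrite (csumZ _ (dS _) (dM _)).
Qed.

Let d_conv n : d n = \sum_(j < n.+1) binc (- b) j * c (n - j)%N.
Proof.
transitivity (\sum_(j < n.+1) csum (fun i => binc (- b) j * (A i * binc (b - (e i)%:R) (n - j)))).
  pose f j i := binc (- b) j * (A i * binc (b - (e i)%:R) (n - j)).
  pose M j i := \sum_(k < (n - j).+1) cmod (binc b k) *
    (delta ^- (n - j - k) * (cmod (A i) * (1 + delta) ^+ e i)).
  rewrite -(@csum_sum R I n.+1 (fun j i => cmod (binc (- b) j) * M j i) f).
  - rewrite /d; congr csum; apply/funext => i.
    rewrite -{1}[- (e i)%:R](addKr b) -vandermonde mulr_sumr.
    by apply: eq_bigr => j _; rewrite mulrCA.
  - by move=> j; exact: (summable_boundZ (cmod_ge0 _) (cS _)).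
  - by move=> j i; rewrite /f cmodM; apply: ler_wpM2l; [exact: cmod_ge0|exact: cM].
by apply: eq_bigr => j _; rewrite (csumZ _ (cS _) (cM _)).
Qed.

Let conv_term (u v : nat -> R[i]) (w : nat -> R[i]) :
  (forall n, w n = \sum_(j < n.+1) u j * v (n - j)%N) ->
  (fun n => \sum_(j < n.+1) (u j * t ^+ j) * (v (n - j)%N * t ^+ (n - j)))
  = (fun n => w n * t ^+ n).
Proof.
move=> wE; apply/funext => n; rewrite wE mulr_suml; apply: eq_bigr => j _.
by rewrite mulrACA -exprD subnKC// -ltnS ltn_ord.
Qed.

(** Since [binc (b - e)] is the convolution of [binc b] and [binc (- e)], the
    series is the Cauchy product of the binomial series and of the Taylor
    series at 1, evaluated at [1 - t], of the sum of the [A i * z ^+ e i]. Here that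
    Taylor series converges because [1 - t] is within [delta] of 1. *)
Lemma generating_radius : cmod t <= delta ->
  series (fun n => c n * t ^+ n) @ \oo
    --> (cpow (1 - t) (- b) * csum (fun i => A i * (1 - t) ^+ e i) : R[i]^o).
Proof.
move=> td; have tN : cmod (- t) <= delta by rewrite cmodN.
have hd : series (fun n => d n * t ^+ n) @ \oo
    --> (csum (fun i => A i * (1 - t) ^+ e i) : R[i]^o).
  by rewrite d_taylor; exact: (taylor_cvg hA delta0 z1 tN).
rewrite -(binc_value b t1) -(conv_term c_conv).
exact: (cauchy_product_cvg (binc_cvg_bound b t1) hd).
Qed.

(** When only the left side is known to converge, multiplying it by the binomial
    series of the inverse power recovers the Taylor series, whose value is then
    given by [taylor_series_value]. *)
Lemma generating_convergent (S : R[i]) :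
  summable_bound (fun i => cmod (A i) * cmod (1 - t) ^+ e i) ->
  series (fun n => c n * t ^+ n) @ \oo --> (S : R[i]^o) ->
  S = cpow (1 - t) (- b) * csum (fun i => A i * (1 - t) ^+ e i).
Proof.
move=> hAt hS.
have := cauchy_product_cvg (binc_cvg_bound (- b) t1) hS.
rewrite (conv_term d_conv) d_taylor binc_value// opprK => h.
rewrite -(taylor_series_value delta0 hA hAt t1 h).
by rewrite mulrA [_ (- b) * _]mulrC cpowN mul1r.
Qed.

End Generating.

(** * Infinite products and the Gamma function *)

Section AlmostOneProduct.
Variables (R : realType) (v : nat -> R[i]) (C : R) (N : nat).
Hypotheses (C0 : 0 < C) (N0 : (0 < N)%N) (CN : 2 * C <= N%:R)
  (vS : forall n, (N <= n)%N -> exists2 eps : R[i],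
     v n.+1 = v n * (1 + eps) & cmod eps <= C / n.+1%:R ^+ 2).

(* An explicit bound for the partial sums of C / (i + 1) ^ 2 from N to n - 1. *)
Let s n : R := C * (N%:R^-1 - n%:R^-1).

Let sS n : (N <= n)%N -> s n + C / n.+1%:R ^+ 2 <= s n.+1.
Proof.
move=> Nn; have n0 : (0 < n)%N := leq_trans N0 Nn.
rewrite /s -mulrDr ler_wpM2l ?(ltW C0)// -addrA lerD2l.
have n1 : 0 < (n%:R : R) by rewrite ltr0n.
have n2 : 0 < (n.+1%:R : R) by rewrite ltr0n.
rewrite -subr_ge0.
have -> : - n.+1%:R^-1 - (- n%:R^-1 + n.+1%:R ^- 2) = (n%:R * n.+1%:R ^+ 2)^-1 :> R.
  have aux (a b : R) : a != 0 -> b != 0 -> b = a + 1 ->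
      - b^-1 - (- a^-1 + b ^- 2) = (a * b ^+ 2)^-1.
    by move=> a0 b0 bE; rewrite bE in b0 *; field; rewrite a0 b0.
  by apply: aux; rewrite ?natr1// lt0r_neq0.
by rewrite invr_ge0 mulr_ge0 ?exprn_ge0// ltW.
Qed.

Let s_half n : (N <= n)%N -> 0 <= s n <= 1 / 2.
Proof.
move=> Nn; have N1 : 0 < (N%:R : R) by rewrite ltr0n.
have n1 : 0 < (n%:R : R) by rewrite ltr0n (leq_trans N0).
rewrite mulr_ge0 ?(ltW C0)//=; last by rewrite subr_ge0 lef_pV2 ?posrE// ler_nat.
apply: (@le_trans _ _ (C / N%:R)).
  by rewrite ler_wpM2l ?(ltW C0)// lerBlDr lerDl invr_ge0 ltW.
by rewrite ler_pdivrMr//; move: CN; lra.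
Qed.

(** By induction the bound is [cmod (v N) / (1 - s n)], from
    [(1 + x) (1 - s - x) <= 1 - s]; and [s n] stays below one half. *)
Lemma almost_one_upper n : (N <= n)%N -> cmod (v n) <= 2 * cmod (v N).
Proof.
move=> Nn.
suff h : cmod (v n) * (1 - s n) <= cmod (v N).
  have /andP[_ sn] := s_half Nn.
  have : cmod (v n) * (1 / 2) <= cmod (v n) * (1 - s n).
    by rewrite ler_wpM2l ?cmod_ge0//; lra.
  by move: h; lra.
elim: n Nn => [|n IH]; first by rewrite leqn0 => /eqP N00; move: N0; rewrite N00.
rewrite leq_eqVlt => /orP[/eqP <-|]; first by rewrite /s subrr mulr0 subr0 mulr1.
rewrite ltnS => Nn; have [eps -> epsC] := vS Nn.
apply: le_trans (IH Nn); rewrite cmodM.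
have x0 : 0 <= C / n.+1%:R ^+ 2 by rewrite divr_ge0 ?(ltW C0)// exprn_ge0.
have sx := sS Nn.
have e1 : cmod (1 + eps) <= 1 + C / n.+1%:R ^+ 2.
  by rewrite (le_trans (cmod_le_add _ _))// cmod1 lerD2l.
have /andP[s0 _] := s_half Nn.
have /andP[s1 s2] := s_half (leqW Nn).
rewrite -mulrA ler_wpM2l ?cmod_ge0//.
move: (C / _) x0 sx e1 => x x0 sx e1.
apply: (@le_trans _ _ ((1 + x) * (1 - s n.+1))).
  by apply: ler_wpM2r => //; lra.
apply: (@le_trans _ _ ((1 + x) * (1 - s n - x))).
  by apply: ler_wpM2l => //; lra.
by nra.
Qed.

(** By induction the bound is [(1 - s n) * cmod (v N)], from
    [(1 - s) (1 - x) >= 1 - s - x]. *)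
Lemma almost_one_lower n : (N <= n)%N -> cmod (v N) <= 2 * cmod (v n).
Proof.
move=> Nn.
suff h : cmod (v N) * (1 - s n) <= cmod (v n).
  have /andP[_ sn] := s_half Nn.
  have : cmod (v N) * (1 / 2) <= cmod (v N) * (1 - s n).
    by rewrite ler_wpM2l ?cmod_ge0//; lra.
  by move: h; lra.
elim: n Nn => [|n IH]; first by rewrite leqn0 => /eqP N00; move: N0; rewrite N00.
rewrite leq_eqVlt => /orP[/eqP <-|]; first by rewrite /s subrr mulr0 subr0 mulr1.
rewrite ltnS => Nn; have [eps -> epsC] := vS Nn.
rewrite cmodM.
have x0 : 0 <= C / n.+1%:R ^+ 2 by rewrite divr_ge0 ?(ltW C0)// exprn_ge0.
have sx := sS Nn.
have e1 : 1 - C / n.+1%:R ^+ 2 <= cmod (1 + eps).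
  by apply: le_trans (cmod_sub_le _ _); rewrite cmod1 lerD2l lerN2.
have /andP[s0 s01] := s_half Nn.
have /andP[s1 s2] := s_half (leqW Nn).
move: (C / _) x0 sx e1 => x x0 sx e1.
apply: (@le_trans _ _ (cmod (v n) * (1 - x))); last by rewrite ler_wpM2l ?cmod_ge0.
apply: (@le_trans _ _ (cmod (v N) * (1 - s n) * (1 - x))); last first.
  by apply: ler_wpM2r; [lra|exact: IH].
rewrite -mulrA ler_wpM2l ?cmod_ge0//; nra.
Qed.

(** The increments of [v] are dominated by those of [s], which telescope. The
    limit inherits the two-sided bounds, in particular it does not vanish when
    [v N] does not. *)
Lemma almost_one_cvg : exists2 l : R[i], v @ \oo --> (l : R[i]^o) &
  cmod l <= 2 * cmod (v N) /\ cmod (v N) <= 2 * cmod l.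
Proof.
pose f n := v (N + n.+1)%N - v (N + n)%N.
pose M n := 2 * cmod (v N) * (s (N + n.+1)%N - s (N + n)%N).
have fM n : cmod (f n) <= M n.
  have Nn : (N <= N + n)%N by rewrite leq_addr.
  rewrite /f addnS; have [eps -> epsC] := vS Nn.
  rewrite mulrDr mulr1 addrAC subrr add0r cmodM /M addnS.
  apply: ler_pM; rewrite ?cmod_ge0//; first exact: almost_one_upper.
  by rewrite (le_trans epsC)// lerBrDl sS.
have M0 n : 0 <= M n := le_trans (cmod_ge0 _) (fM n).
have hM : summable_bound M.
  apply: (@summable_bound_series R _ (cmod (v N))) => // n.
  rewrite /M -mulr_sumr.
  have -> : \sum_(i < n) (s (N + i.+1)%N - s (N + i)%N) = s (N + n)%N - s N.
    elim: (n) => [|k IH]; first by rewrite big_ord0 addn0 subrr.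
    by rewrite big_ord_recr /= IH; ring.
  have -> : s N = 0 by rewrite /s subrr mulr0.
  rewrite subr0.
  have /andP[s1 s2] := s_half (leq_addr n N).
  have := ler_wpM2l (cmod_ge0 (v N)) s2; lra.
have h := csum_series hM fM.
have fE n : series f n = v (N + n)%N - v N.
  rewrite series_ord; elim: n => [|k IH]; first by rewrite big_ord0 addn0 subrr.
  by rewrite big_ord_recr /= IH /f; ring.
have hv : v @ \oo --> (csum f + v N : R[i]^o).
  apply/ccvgP => d d0; have /ccvgP/(_ d d0)[N1 _ hN1] := h.
  exists (N + N1)%N => //= n /= Nn.
  have N1n : (N1 <= n - N)%N by rewrite leq_subRL// (leq_trans _ Nn)// leq_addr.
  have := hN1 _ N1n; rewrite /= fE subnKC ?(leq_trans _ Nn)// ?leq_addr//.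
  by rewrite opprD addrA addrAC.
exists (csum f + v N); first exact: hv.
split.
  apply/ler_addgt0Pr => d d0; have /ccvgP/(_ d d0)[N1 _ hN1] := hv.
  have := hN1 (maxn N N1) (leq_maxr _ _) => /= hlt.
  rewrite -[csum f + v N](subKr (v (maxn N N1))) (le_trans (cmod_le_sub _ _))//.
  by rewrite lerD ?almost_one_upper ?leq_maxl// ltW.
apply/ler_addgt0Pr => d d0.
have d2 : 0 < d / 2 by rewrite divr_gt0.
have /ccvgP/(_ _ d2)[N1 _ hN1] := hv.
have := hN1 (maxn N N1) (leq_maxr _ _) => /= hlt.
have h1 := almost_one_lower (leq_maxl N N1).
have h2 : cmod (v (maxn N N1)) <= cmod (csum f + v N) + d / 2.
  rewrite -[v (maxn N N1)](subrK (csum f + v N)) (le_trans (cmod_le_add _ _))//.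
  by rewrite addrC lerD2l ltW.
by lra.
Qed.

End AlmostOneProduct.

Section Gamma.
Variable R : realType.
Implicit Types (z w : R[i]) (n : nat).

Definition gauss_product z n : R[i] := n`!%:R * cpow n%:R z / rising z n.+1.

Lemma cexpD z w : cexp (z + w) = cexp z * cexp w.
Proof.
case: z w => [a b] [c d]; rewrite /cexp /= expRD cosD sinD.
by apply/eqP; rewrite eq_complex /=; apply/andP; split; apply/eqP; ring.
Qed.

Lemma clog_pos (a : R) : 0 < a -> clog a%:C = (ln a)%:C.
Proof.
move=> a0; rewrite clog_right//= expr0n addr0 mul0r atan0; congr (_ +i* _).
by rewrite lnXn// -[ln a *+ 2]mulr_natr mulfK// pnatr_eq0.
Qed.

Lemma natrC n : (n%:R : R[i]) = (n%:R : R)%:C.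
Proof. by rewrite rmorph_nat. Qed.

Lemma cpow_nat_cmod n z : (0 < n)%N ->
  cmod (cpow n%:R z) = expR (complex.Re z * ln n%:R).
Proof.
move=> n0; rewrite /cpow natrC clog_pos ?ltr0n//.
case: z => a b; rewrite /cexp cmodM cmodr ger0_norm ?expR_ge0//=.
rewrite mulr0 subr0 mulr0 add0r /cmod /Normc.normc /= cos2Dsin2 sqrtr1 mulr1//.
Qed.

(** This writes the factor [((n + 1) / n)] to the power [z] as a value of a
    binomial series at [t = 1 / (n + 1)]. *)
Lemma cpow_succ n z : (0 < n)%N ->
  cpow n.+1%:R z = cpow n%:R z * cpow (1 - n.+1%:R^-1) (- z).
Proof.
move=> n0; have n1 : 0 < (n%:R : R) by rewrite ltr0n.
have n2 : 0 < (n.+1%:R : R) by rewrite ltr0n.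
have -> : (1 - n.+1%:R^-1 : R[i]) = (n%:R / n.+1%:R : R)%:C.
  rewrite rmorphM fmorphV /= !rmorph_nat.
  have nn : (n.+1%:R : R[i]) != 0 by rewrite pnatr_eq0.
  by apply: (mulIf nn); rewrite divfK// mulrBl mulVf// mul1r -natr1 addrK.
rewrite /cpow !natrC !clog_pos ?divr_gt0// -cexpD; congr cexp.
rewrite lnM ?posrE ?invr_gt0// lnV ?posrE// rmorphB; ring.
Qed.

(** The coefficients are at most a constant times [(3/2) ^+ n], uniformly for [z] in
    a disc, so the terms of index at least 2 add up to [O(t ^ 2)]. *)
Lemma binc_two_terms (W : R) : 0 <= W -> exists2 C : R, 0 < C &
  forall z (t : R), cmod z <= W -> 0 <= t <= 3^-1 ->
  cmod (csum (fun n => binc z n * t%:C ^+ n) - (1 + z * t%:C)) <= C * t ^+ 2.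
Proof.
move=> W0; have h2 : 0 < (2^-1 : R) by rewrite invr_gt0.
have [C C0 hC] := rising_le_uniform h2 W0.
have h01 : 0 <= (2^-1 : R) < 1 by rewrite ltW//= invf_lt1// ltr1n.
have [_ [B hB]] := geometric_summable ler01 h01.
have B0 : 0 <= B by have := hB fset0; rewrite big_seq_fset0.
exists (9 * C * B + 1); first by rewrite ltr_wpDl// !mulr_ge0// ltW.
move=> z t zW /andP[t0 t3].
have bz n : cmod (binc z n) <= C * (1 + 2^-1) ^+ n.
  by rewrite cmodM cmodV cmod_nat ler_pdivrMr ?ltr0n ?fact_gt0// hC.
pose f n := binc z n * t%:C ^+ n.
pose f2 n := if (n < 2)%N then f n else 0.
pose f' n := if (n < 2)%N then 0 else f n.
have t1 : cmod t%:C < 1 by rewrite cmodr ger0_norm//; move: t3; lra.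
have hf := binc_cvg_bound z t1.
have le_f (n : nat) (b : bool) : cmod (if b then f n else 0) <= cmod (f n).
  by case: b => //; rewrite cmod0 cmod_ge0.
have le_f' (n : nat) (b : bool) : cmod (if b then 0 else f n) <= cmod (f n).
  by case: b => //; rewrite cmod0 cmod_ge0.
have -> : csum f = csum f2 + csum f'.
  rewrite -(csumD hf (fun n => le_f n _) hf (fun n => le_f' n _)).
  by congr csum; apply/funext => n; rewrite /f2 /f'; case: ifP => _; rewrite ?addr0 ?add0r.
have -> : csum f2 = 1 + z * t%:C.
  rewrite (@csum_finite _ _ 2); last by move=> n; rewrite /f2 leqNgt => /negbTE ->.
  rewrite !big_ord_recl big_ord0 /f2 /f /= binc0 /binc risingS rising0 /=.
  by rewrite addr0 /bump /= factS fact0 muln1 divr1; ring.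
rewrite addrAC subrr add0r.
pose M n := 9 * C * t ^+ 2 * (1 * 2^-1 ^+ n).
have f'M n : cmod (f' n) <= M n.
  rewrite /f'; case: ltnP => n2.
    by rewrite cmod0 !mulr_ge0 ?exprn_ge0// ltW.
  rewrite cmodM cmodX cmodr ger0_norm// /M mul1r.
  have q0 : 0 <= (1 + 2^-1) * t by rewrite mulr_ge0// addr_ge0// ltW.
  have q2 : (1 + 2^-1) * t <= 2^-1 by move: t3; lra.
  (* Split off (3/2 t) ^ 2 = 9 t ^ 2 / 2 ^ 2; the remaining factors 3/2 t are at
     most 1/2. *)
  have key : ((1 + 2^-1) * t) ^+ n <= 9 * t ^+ 2 * 2^-1 ^+ n.
    rewrite -(subnKC n2) !exprD [leRHS]mulrA; apply: ler_pM.
    - exact: sqr_ge0.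
    - by rewrite exprn_ge0.
    - have -> : 1 + 2^-1 = 3 * 2^-1 :> R by lra.
      by rewrite le_eqVlt; apply/orP; left; apply/eqP; ring.
    - by rewrite lerXn2r// nnegrE// ltW.
  apply: (le_trans (ler_wpM2r _ (bz n))); first by rewrite exprn_ge0.
  rewrite -[leLHS]mulrA -exprMn; apply: (le_trans (ler_wpM2l (ltW C0) key)).
  by rewrite le_eqVlt; apply/orP; left; apply/eqP; ring.
apply: (csum_le f'M) => [n|F]; first exact: le_trans (cmod_ge0 _) (f'M n).
rewrite -mulr_sumr; apply: (le_trans (ler_wpM2l _ (hB F))).
  by rewrite !mulr_ge0 ?sqr_ge0// ltW.
by rewrite mulrAC ler_wpM2r ?sqr_ge0// lerDl.
Qed.

(** The ratio of consecutive approximations is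
    [(1 + z t + O(t ^ 2)) / (1 + z t)] with [t = 1 / (n + 1)], uniformly in a disc. *)
Lemma gauss_product_ratio (W : R) : 0 <= W -> exists (C : R) (N : nat),
  0 < C /\ forall z n, cmod z <= W -> (N <= n)%N -> exists2 eps : R[i],
    gauss_product z n.+1 = gauss_product z n * (1 + eps) & cmod eps <= C / n.+1%:R ^+ 2.
Proof.
move=> W0; have [C C0 hC] := binc_two_terms W0.
have [N hN] := archi_nat (2 * W).
exists (2 * C), (maxn 2 N); split; first by rewrite mulr_gt0.
move=> z n zW; rewrite geq_max => /andP[n2 /hN nW].
have n0 : (0 < n)%N by exact: leq_trans n2.
pose t : R := n.+1%:R^-1.
have nn : (n.+1%:R : R[i]) != 0 by rewrite pnatr_eq0.
have tE : (t%:C : R[i]) = n.+1%:R^-1 by rewrite fmorphV rmorph_nat.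
have t0 : 0 <= t by rewrite invr_ge0.
have t3 : t <= 3^-1 by rewrite lef_pV2 ?posrE ?ltr0n// ler_nat.
have half : 1 / 2 <= cmod (1 + z * t%:C).
  apply: le_trans (cmod_sub_le _ _); rewrite cmod1 cmodM cmodr ger0_norm//.
  have : cmod z * t <= 1 / 2; last by lra.
  rewrite /t ler_pdivrMr ?ltr0n//.
  by move: zW nW; rewrite -[n.+1%:R]natr1; lra.
have nz0 : 1 + z * t%:C != 0 by rewrite -cmod_gt0 (lt_le_trans _ half)// divr_gt0.
pose E := csum (fun n => binc z n * t%:C ^+ n).
have t01 : 0 <= t <= 3^-1 by rewrite t0.
have hE : cmod (E - (1 + z * t%:C)) <= C * t ^+ 2 := hC z t zW t01.
exists ((E - (1 + z * t%:C)) / (1 + z * t%:C)).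
  rewrite /gauss_product cpow_succ// -tE -binc_value; last first.
    by rewrite cmodr ger0_norm//; move: t3; lra.
  rewrite -/E [rising z n.+2]risingS factS natrM invfM.
  have -> : z + n.+1%:R = n.+1%:R * (1 + z * t%:C).
    by rewrite tE mulrDr mulr1 mulrCA divff// mulr1 addrC.
  have -> : 1 + (E - (1 + z * t%:C)) / (1 + z * t%:C) = E / (1 + z * t%:C).
    by field.
  rewrite [(n.+1%:R * _)^-1]invfM.
  have n1 : (n.+1%:R : R[i]) / n.+1%:R = 1 by rewrite divff.
  move: (n.+1%:R : R[i]) n1 => N1 n1.
  rewrite -[RHS]mul1r -n1; ring.
rewrite cmodM cmodV ler_pdivrMr; last by rewrite cmod_gt0.
apply: (le_trans hE); rewrite -exprVn -/t.
have := ler_wpM2l (mulr_ge0 (ltW C0) (sqr_ge0 t)) half.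
by lra.
Qed.

(** The index [N] depends on the disc only, so that the approximation of order [N]
    gives bounds for the Gamma function itself, uniform in the disc. *)
Lemma gauss_product_cvg (W : R) : 0 <= W -> exists2 N : nat, (0 < N)%N &
  forall z, cmod z <= W ->
  gauss_product z @ \oo --> (cGamma z : R[i]^o) /\
  cmod (cGamma z) <= 2 * cmod (gauss_product z N) /\ cmod (gauss_product z N) <= 2 * cmod (cGamma z).
Proof.
move=> W0; have [C [N1 [C0 hC]]] := gauss_product_ratio W0.
have [N2 hN2] := archi_nat (2 * C).
pose N := maxn 1 (maxn N1 N2).
have N0 : (0 < N)%N by rewrite leq_max.
have N1N : (N1 <= N)%N by rewrite /N; lia.
have CN : 2 * C <= N%:R by apply: hN2; rewrite /N; lia.
exists N => // z zW.
have [l hl [l1 l2]] := almost_one_cvg C0 N0 CN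
  (fun n Nn => hC z n zW (leq_trans N1N Nn)).
have -> : cGamma z = l.
  exact: (@cvg_lim R[i]^o (@norm_hausdorff R[i] R[i]^o) _ _ _ (gauss_product z) l hl).
by split; [exact: hl|split].
Qed.

Lemma rising_neq0 z n : ~ nonpos_integer z -> rising z n != 0.
Proof.
move=> zn; apply/eqP => h; apply: zn; move: h.
rewrite /rising => /eqP /prodf_eq0[i _ /eqP zi]; exists i.
by apply/eqP; rewrite -addr_eq0 zi.
Qed.

Lemma cGammaS z : z != 0 -> cGamma (z + 1) = z * cGamma z.
Proof.
move=> z0.
have W0 : 0 <= cmod z + 1 by rewrite addr_ge0 ?cmod_ge0.
have [N _ hN] := gauss_product_cvg W0.
have zW : cmod z <= cmod z + 1 by rewrite lerDl.
have z1W : cmod (z + 1) <= cmod z + 1 by rewrite (le_trans (cmod_le_add _ _))// cmod1.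
have [h _] := hN z zW; have [h1 _] := hN (z + 1) z1W.
have [N1 hN1] := archi_nat (cmod z + 2).
apply: (ccvg_unique h1).
pose q n : R[i] := n%:R / (z + n.+1%:R).
have hq : q @ \oo --> (1 : R[i]^o).
  apply/ccvgP => d d0; have [N2 hN2] := archi_nat ((cmod z + 1) / d + cmod z).
  exists (maxn N1 N2) => //= n; rewrite /= geq_max => /andP[/hN1 n1 /hN2 n2].
  have lo : n%:R + 1 - cmod z <= cmod (z + n.+1%:R).
    by have := cmod_sub_le n.+1%:R z; rewrite cmod_nat [_ + z]addrC -[in X in X - _]natr1.
  have pos : 0 < cmod (z + n.+1%:R) by apply: lt_le_trans lo; lra.
  have nz : z + n.+1%:R != 0 by rewrite -cmod_gt0.
  have -> : q n - 1 = - (z + 1) / (z + n.+1%:R).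
    rewrite /q -natr1 in nz *.
    by field.
  rewrite cmodM cmodN cmodV ltr_pdivrMr// (le_lt_trans z1W)//.
  rewrite -ltr_pdivrMl// mulrC (lt_le_trans _ lo)//; lra.
(* The functional equation holds for the approximations up to a factor tending
   to 1. *)
have gE : \forall n \near \oo, z * gauss_product z n * q n = gauss_product (z + 1) n.
  exists (maxn 1 N1) => //= n; rewrite /= geq_max => /andP[n0 /hN1 n1].
  have nz : z + n.+1%:R != 0.
    rewrite -cmod_gt0; have := cmod_sub_le n.+1%:R z.
    by rewrite cmod_nat [_ + z]addrC -[in X in X - _]natr1; apply: lt_le_trans; lra.
  rewrite /gauss_product /q.
  have -> : cpow n%:R (z + 1) = cpow n%:R z * n%:R.
    rewrite /cpow mulrDl cexpD mul1r natrC clog_pos ?ltr0n//; congr (_ * _).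
    by rewrite /cexp /= cos0 sin0 mulr1 lnK ?posrE ?ltr0n.
  have rE : rising (z + 1) n.+1 = z^-1 * (rising z n.+1 * (z + n.+1%:R)).
    by apply: (mulfI z0); rewrite -rising_shift risingS mulrA divff// mul1r.
  by rewrite rE !invfM invrK; ring.
apply/ccvgP => d d0.
have hz : (fun _ : nat => z) @ \oo --> (z : R[i]^o) by exact: ccvg_cst.
have hh : (fun n => z * gauss_product z n * q n) @ \oo --> (z * cGamma z * 1 : R[i]^o).
  exact: (ccvgM (ccvgM hz h) hq).
have /ccvgP/(_ d d0) := hh.
move: gE; apply: filterS2 => n /= -> ; by rewrite mulr1.
Qed.

Lemma cGammaD z n : ~ nonpos_integer z -> cGamma (z + n%:R) = rising z n * cGamma z.
Proof.
move=> zn; elim: n => [|n IH]; first by rewrite addr0 rising0 mul1r.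
rewrite -natr1 addrA cGammaS.
  by rewrite IH risingS; ring.
by apply: contra_notN zn => /eqP h; exists n; apply/eqP; rewrite -addr_eq0 h.
Qed.

Lemma cGamma_neq0 z : ~ nonpos_integer z -> cGamma z != 0.
Proof.
move=> zn; have [N N0 /(_ z (lexx _))[_ [_ lo]]] := gauss_product_cvg (cmod_ge0 z).
rewrite -cmod_gt0; have : 0 < cmod (gauss_product z N); last by lra.
rewrite cmod_gt0 /gauss_product; apply: mulf_neq0; last by rewrite invr_eq0 rising_neq0.
apply: mulf_neq0; last exact: cexp_neq0.
by rewrite pnatr_eq0 -lt0n fact_gt0.
Qed.

Lemma Re_ge_rising w n : 1 <= complex.Re w -> n`!%:R <= cmod (rising w n).
Proof.
move=> w1; elim: n => [|n IH]; first by rewrite rising0 cmod1.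
rewrite risingS cmodM factS mulnC natrM ler_pM//.
apply: le_trans (Re_le_cmod _); apply: le_trans (ler_norm _).
by rewrite Re_addc natrC /= -natr1 addrC lerD2r.
Qed.

(** For real part at least 1, the rising factorial in the approximation of order
    [N] is bounded above and away from 0, and the modulus of [cpow N%:R w] lies between 1
    and a power of [N]. *)
Lemma cGamma_strip (W : R) : 0 <= W -> exists2 c : R, 0 < c &
  forall w, cmod w <= W -> 1 <= complex.Re w ->
  cmod (cGamma w) <= c /\ 1 <= c * cmod (cGamma w).
Proof.
move=> W0; have [N N0 hN] := gauss_product_cvg W0.
have N1 : 1 <= (N%:R : R) by rewrite ler1n.
have lnN : 0 <= ln (N%:R : R) by rewrite ln_ge0.
pose P : R := \prod_(i < N.+1) (W + i%:R).
pose u : R := 2 * (N`!%:R * expR (W * ln N%:R)).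
have f0 : 0 < (N`!%:R : R) by rewrite ltr0n fact_gt0.
have u0 : 0 < u by rewrite !mulr_gt0 ?expR_gt0.
have P0 : 0 <= P by rewrite prodr_ge0// => i _; rewrite addr_ge0.
exists (u + 2 * P); first by rewrite ltr_wpDr// mulr_ge0.
move=> w wW w1; have [_ [hi lo]] := hN w wW.
have r1 : N.+1`!%:R <= cmod (rising w N.+1) := Re_ge_rising N.+1 w1.
have r0 : 0 < cmod (rising w N.+1) by rewrite (lt_le_trans _ r1)// ltr0n fact_gt0.
have gE : cmod (gauss_product w N) = N`!%:R * expR (complex.Re w * ln N%:R) / cmod (rising w N.+1).
  by rewrite /gauss_product 2!cmodM cmodV cmod_nat cpow_nat_cmod.
have rW : complex.Re w <= W by rewrite (le_trans (ler_norm _))// (le_trans (Re_le_cmod _)).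
have c0 := cmod_ge0 (cGamma w).
split.
  apply: (le_trans hi); apply: (@le_trans _ _ u); last by rewrite lerDl mulr_ge0.
  rewrite /u ler_wpM2l// gE ler_pdivrMr//.
  rewrite -[leLHS]mulr1 ler_pM ?mulr_ge0 ?expR_ge0 ?(ltW f0)//.
    by rewrite ler_wpM2l ?(ltW f0)// ler_expR ler_wpM2r.
  by rewrite (le_trans _ r1)// ler1n fact_gt0.
have rP : cmod (rising w N.+1) <= P.
  rewrite (le_trans (cmod_rising_le _ _))// ler_prod// => i _.
  by rewrite addr_ge0 ?cmod_ge0//= lerD2r.
have : 1 <= P * cmod (gauss_product w N).
  rewrite gE; apply: (@le_trans _ _ (cmod (rising w N.+1) *
     (N`!%:R * expR (complex.Re w * ln N%:R) / cmod (rising w N.+1)))); last first.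
    by rewrite ler_wpM2r// divr_ge0 ?mulr_ge0 ?expR_ge0 ?(ltW f0)// ltW.
  rewrite mulrC divfK ?gt_eqF//.
  have w0 : 0 <= complex.Re w := le_trans ler01 w1.
  have e1 : 1 <= expR (complex.Re w * ln N%:R).
    by rewrite -{1}(@expR0 R) ler_expR mulr_ge0.
  have f1 : 1 <= (N`!%:R : R) by rewrite ler1n fact_gt0.
  by rewrite -[leLHS]mulr1; apply: ler_pM.
move=> h; have := ler_wpM2l P0 lo.
have := mulr_ge0 (ltW u0) c0.
by rewrite mulrDl; move: h; lra.
Qed.

End Gamma.

(** * Growth of Pochhammer symbols *)

Lemma fact_mul_le m n : (m`! * n`! <= (m + n)`!)%N.
Proof.
have := @bin_fact (m + n) m (leq_addr _ _).
rewrite addKn => <-; rewrite leq_pmull// bin_gt0 leq_addr//.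
Qed.

Section PochhammerBounds.
Variables (R : realType) (alpha : R[i]).

Let K0 : exists K : nat, cmod alpha + 1 <= K%:R.
Proof. by have [N hN] := archi_nat (cmod alpha + 1); exists N; apply: hN. Qed.

Lemma pochhammer_nat (nu : R) : nu \is a Num.nat ->
  pochhammer alpha nu = rising alpha (Num.truncn nu).
Proof. by rewrite /pochhammer => ->. Qed.

(** For large [nu] the functional equation moves [alpha + nu] to a point of
    real part at least 1 in a fixed disc, away from the poles. The fractional part
    of [nu] is arbitrary, so a bound that is uniform there is needed. *)
Lemma pochhammer_strip : exists (K : nat) (W : R), 0 <= W /\
  forall nu : R, K%:R <= nu -> ~~ (nu \is a Num.nat) -> exists w : R[i],
   [/\ cmod w <= W, 1 <= complex.Re w, (K <= Num.truncn nu)%N &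
    cmod (pochhammer alpha nu) = cmod (rising w (Num.truncn nu - K))
      * cmod (cGamma w) / cmod (cGamma alpha)].
Proof.
have [K hK] := K0; exists K, (cmod alpha + K%:R + 1).
have a0 := cmod_ge0 alpha.
split=> [|nu Knu nnat]; first by rewrite !addr_ge0.
have nu0 : 0 <= nu by rewrite (le_trans _ Knu).
have /andP[lo hi] := truncn_itv nu0.
set n := Num.truncn nu in lo hi *.
have Kn : (K <= n)%N.
  by rewrite -ltnS -(ltr_nat R) (le_lt_trans Knu hi).
pose w := alpha + K%:R + (nu - n%:R)%:C.
have th0 : 0 <= nu - n%:R by rewrite subr_ge0.
have th1 : nu - n%:R <= 1 by rewrite lerBlDl natr1 ltW.
have w1 : 1 <= complex.Re w.
  rewrite /w !Re_addc natrC /=.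
  have := Re_le_cmod alpha; rewrite ler_norml => /andP[h _].
  by lra.
exists w; split=> //.
  rewrite /w (le_trans (cmod_le_add _ _))// lerD//; last by rewrite cmodr ger0_norm.
  by rewrite (le_trans (cmod_le_add _ _))// cmod_nat.
rewrite /pochhammer (negbTE nnat) cmodM cmodV; congr (_ / _).
rewrite -cmodM -cGammaD; last first.
  move=> [i wi]; move: w1; rewrite wi natrC.
  by rewrite -rmorphN /=; apply/negP; rewrite -ltNge (le_lt_trans _ ltr01)// oppr_le0.
congr (cmod (cGamma _)); rewrite /w natrB// -addrA; apply/eqP.
rewrite rmorphB /= -(natrC R n) -!addrA; apply/eqP; congr (_ + _).
by ring.
Qed.

Lemma pochhammer_nat_upper (eps : R) : 0 < eps -> exists2 C : R, 0 < C &
  forall nu : R, nu \is a Num.nat ->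
  cmod (pochhammer alpha nu) <= C * (1 + eps) ^+ Num.truncn nu * (Num.truncn nu)`!%:R.
Proof.
move=> eps0; have [C C0 hC] := rising_le alpha eps0.
by exists C => // nu nunat; rewrite pochhammer_nat.
Qed.

Lemma pochhammer_upper (eps : R) : 0 < eps -> exists (K : nat) (C : R), 0 < C /\
  forall nu : R, K%:R <= nu ->
  cmod (pochhammer alpha nu) <= C * (1 + eps) ^+ Num.truncn nu * (Num.truncn nu)`!%:R.
Proof.
move=> eps0; have [K [W [W0 hK]]] := pochhammer_strip.
have [C1 C10 hC1] := pochhammer_nat_upper eps0.
have [C2 C20 hC2] := rising_le_uniform eps0 W0.
have [c c0 hc] := cGamma_strip W0.
pose C := C1 + C2 * c / cmod (cGamma alpha).
have CC : 0 <= C2 * c / cmod (cGamma alpha) by rewrite divr_ge0 ?cmod_ge0// mulr_ge0// ltW.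
have C0 : 0 < C by rewrite ltr_wpDr.
have e1 : 1 <= 1 + eps by rewrite lerDl ltW.
exists K, C; split=> // nu Knu; case: (boolP (nu \is a Num.nat)) => [nunat|nnat].
  apply: (le_trans (hC1 nu nunat)); rewrite -!mulrA ler_wpM2r//.
    by rewrite mulr_ge0// exprn_ge0// (le_trans ler01).
  by rewrite lerDl.
have [w [wW w1 Kn ->]] := hK nu Knu nnat.
have [g1 _] := hc w wW w1.
set n := Num.truncn nu in Kn *.
have r1 : cmod (rising w (n - K)) <= C2 * ((1 + eps) ^+ n * n`!%:R).
  apply: (le_trans (hC2 w _ wW)); rewrite -mulrA ler_wpM2l ?(ltW C20)//.
  apply: ler_pM => //; first by rewrite exprn_ge0// (le_trans ler01).
    by rewrite ler_weXn2l// leq_subr.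
  by rewrite ler_nat; apply: leq_fact; rewrite leq_subr.
apply: (@le_trans _ _ (C2 * c / cmod (cGamma alpha) * ((1 + eps) ^+ n * n`!%:R))).
  have -> : C2 * c / cmod (cGamma alpha) * ((1 + eps) ^+ n * n`!%:R)
     = (C2 * ((1 + eps) ^+ n * n`!%:R)) * c / cmod (cGamma alpha) by ring.
  by rewrite ler_wpM2r ?invr_ge0 ?cmod_ge0// ler_pM ?cmod_ge0.
have T0 : 0 <= (1 + eps) ^+ n * n`!%:R.
  by rewrite mulr_ge0// exprn_ge0// (le_trans ler01).
by rewrite -[leRHS]mulrA; apply: ler_wpM2r => //; rewrite lerDr ltW.
Qed.

(** The shift by [K] in the factorial is harmless for the use made of this bound,
    which compares superexponential growth rates. *)
Lemma pochhammer_lower : ~ nonpos_integer alpha -> exists (K : nat) (C : R), 0 < C /\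
  forall nu : R, K%:R <= nu ->
  (Num.truncn nu - K)`!%:R <= C * 2 ^+ Num.truncn nu * cmod (pochhammer alpha nu).
Proof.
move=> an; have [K [W [W0 hK]]] := pochhammer_strip.
have [C1 C10 hC1] := rising_ge ltr01 (fun n => rising_neq0 n an).
have [c c0 hc] := cGamma_strip W0.
have ga0 : 0 < cmod (cGamma alpha) by rewrite cmod_gt0 cGamma_neq0.
have Cge0 : 0 <= c * cmod (cGamma alpha) by rewrite mulr_ge0 ?cmod_ge0// ltW.
exists K, (C1 + c * cmod (cGamma alpha)); split; first by rewrite ltr_wpDr.
move=> nu Knu; set n := Num.truncn nu.
have two0 : 0 <= (2 : R) ^+ n by rewrite exprn_ge0.
rewrite -mulrA mulrDl; case: (boolP (nu \is a Num.nat)) => [nunat|nnat].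
  rewrite pochhammer_nat//; apply: ler_wpDr; first by rewrite !mulr_ge0 ?cmod_ge0// ltW.
  have := hC1 n; rewrite -mulrA; apply: le_trans.
  by rewrite ler_nat; apply: leq_fact; rewrite leq_subr.
have [w [wW w1 Kn ->]] := hK nu Knu nnat; rewrite -/n.
have [_ g1] := hc w wW w1.
apply: ler_wpDl.
  by rewrite !mulr_ge0 ?invr_ge0 ?cmod_ge0// ltW.
have -> : c * cmod (cGamma alpha) * (2 ^+ n * (cmod (rising w (n - K)) *
    cmod (cGamma w) / cmod (cGamma alpha)))
  = (cmod (cGamma alpha) / cmod (cGamma alpha)) * (2 ^+ n *
    (cmod (rising w (n - K)) * (c * cmod (cGamma w)))) by ring.
rewrite divff ?gt_eqF// mul1r.
have h1 := Re_ge_rising (n - K) w1.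
apply: (le_trans h1); rewrite -[leLHS]mul1r; apply: ler_pM => //.
- exact: cmod_ge0.
- by rewrite exprn_ege1// ler1n.
- by rewrite ler_peMr ?cmod_ge0.
Qed.

(** Only finitely many indices [rho * M + N] are below the threshold of
    [pochhammer_upper] when [rho] is positive; when [rho] is 0 all indices are
    natural and there is no threshold. *)
Lemma pochhammer_lattice_upper (rho eps : R) : 0 <= rho -> 0 < eps ->
  exists2 C : R, 0 < C & forall M N n : nat,
  n = Num.truncn (rho * M%:R + N%:R) ->
  cmod (pochhammer alpha (rho * M%:R + N%:R)) <= C * (1 + eps) ^+ n * n`!%:R.
Proof.
move=> rho0 eps0; move: rho0; rewrite le_eqVlt => /orP[/eqP <-|rho0].
  have [C C0 hC] := pochhammer_nat_upper eps0; exists C => // M N _ ->.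
  by apply: hC; rewrite mul0r add0r natr_nat.
have [K [C [C0 hC]]] := pochhammer_upper eps0.
have [B1 hB1] := archi_nat (K%:R / rho).
pose B := maxn B1 K.
pose S := \sum_(M < B) \sum_(N < B) cmod (pochhammer alpha (rho * M%:R + N%:R)).
have S0 : 0 <= S by rewrite sumr_ge0// => M _; rewrite sumr_ge0// => N _; rewrite cmod_ge0.
exists (C + S); first by rewrite ltr_wpDr.
move=> M N n nE; have e1 : 1 <= 1 + eps by rewrite lerDl ltW.
have T1 : 1 <= (1 + eps) ^+ n * n`!%:R.
  rewrite -[leLHS]mulr1; apply: ler_pM => //; first exact: exprn_ege1.
  by rewrite ler1n fact_gt0.
rewrite -mulrA; have T0 := le_trans ler01 T1.
have big : (B <= M)%N \/ (B <= N)%N ->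
    cmod (pochhammer alpha (rho * M%:R + N%:R)) <= (C + S) * ((1 + eps) ^+ n * n`!%:R).
  move=> h; have := hC (rho * M%:R + N%:R); rewrite -nE -mulrA => hC'.
  apply: (@le_trans _ _ (C * ((1 + eps) ^+ n * n`!%:R))); last by rewrite ler_wpM2r// lerDl.
  apply: hC'; case: h => h.
    apply: ler_wpDr => //; rewrite mulrC -ler_pdivrMr//.
    by apply: hB1; apply: leq_trans h; rewrite leq_maxl.
  apply: ler_wpDl; first by rewrite mulr_ge0// ltW.
  by rewrite ler_nat (leq_trans _ h)// leq_maxr.
have [MB|BM] := ltnP M B; last by apply: big; left.
have [NB|BN] := ltnP N B; last by apply: big; right.
apply: (@le_trans _ _ S).
  rewrite /S (bigD1 (Ordinal MB))//= (bigD1 (Ordinal NB))//= -addrA lerDl addr_ge0//.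
    by rewrite sumr_ge0// => i _; rewrite cmod_ge0.
  by rewrite sumr_ge0// => i _; rewrite sumr_ge0// => j _; rewrite cmod_ge0.
rewrite -[leLHS]mulr1; apply: ler_pM => //.
by rewrite lerDr ltW.
Qed.

End PochhammerBounds.

(** * Majorants for multiple series *)

Section Combinatorics.
Variable R : realType.

Lemma fact_superexp (T : R) : 0 < T -> exists2 C : R, 0 < C &
  forall n, T ^+ n <= C * n`!%:R.
Proof.
move=> T0; have [N hN] := archi_nat T.
have [] := @eventually_geometric R (fun n => T ^+ n / n`!%:R) 1 N ltr01.
- by move=> n; rewrite divr_ge0// exprn_ge0// ltW.
- move=> n Nn; rewrite mul1r exprS factS natrM invfM mulrACA.
  rewrite ler_piMl//; first by rewrite divr_ge0// exprn_ge0// ltW.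
  rewrite ler_pdivrMr ?ltr0n// mul1r (le_trans (hN n Nn))//.
  by rewrite ler_nat.
move=> C C0 hC; exists C => // n.
by have := hC n; rewrite expr1n mulr1 ler_pdivrMr ?ltr0n ?fact_gt0.
Qed.

Lemma double_fact_le p : ((p.*2)`!%:R : R) <= 4 ^+ p * (p`!%:R * p`!%:R).
Proof.
have := @bin_fact p.*2 p; rewrite -addnn addnK => /(_ (leq_addr _ _)) <-.
rewrite !natrM ler_wpM2r ?mulr_ge0//.
have := @binomial_term_le R 1 1 (p + p) p ler01 ler01.
have -> : (1 + 1 : R) ^+ (p + p) = 4 ^+ p.
  by rewrite exprD -exprMn; congr (_ ^+ _); ring.
by rewrite !expr1n mulr1.
Qed.

(** A single term of the multinomial expansion. *)
Lemma multinomial_term_le (I : Type) (s : seq I) (a : I -> nat) (y : I -> R) :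
  (forall i, 0 <= y i) ->
  (\sum_(i <- s) a i)`!%:R * \prod_(i <- s) (y i ^+ a i / (a i)`!%:R)
  <= (\sum_(i <- s) y i) ^+ (\sum_(i <- s) a i).
Proof.
move=> y0; elim: s => [|i s IH]; first by rewrite !big_nil mulr1.
rewrite !big_cons; set Q := (\sum_(j <- s) a j)%N in IH *.
set Y := \sum_(j <- s) y j in IH *; set P := \prod_(j <- s) _ in IH *.
have Y0 : 0 <= Y by rewrite sumr_ge0.
have := @binomial_term_le R Y (y i) (a i + Q) (a i) Y0 (y0 i).
rewrite addKn [Y + _]addrC; apply: le_trans.
have := bin_fact (leq_addr Q (a i)); rewrite addKn => <-.
rewrite !natrM.
have f0 : ((a i)`!%:R : R) != 0 by rewrite pnatr_eq0 -lt0n fact_gt0.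
have -> : 'C(a i + Q, a i)%:R * ((a i)`!%:R * Q`!%:R) * (y i ^+ a i / (a i)`!%:R * P)
  = 'C(a i + Q, a i)%:R * (y i ^+ a i) * (Q`!%:R * P) :> R by field.
rewrite -[leRHS]mulr_natr [leRHS]mulrC [Y ^+ _ * _]mulrC [leRHS]mulrA.
by rewrite ler_wpM2l// mulr_ge0// exprn_ge0.
Qed.

Lemma sum_sub_uniq (I : eqType) (s L : seq I) (f : I -> R) : (forall i, 0 <= f i) ->
  uniq s -> uniq L -> {subset s <= L} -> \sum_(i <- s) f i <= \sum_(i <- L) f i.
Proof.
move=> f0 us uL sL; rewrite [leRHS](bigID (mem s)) /=.
apply: ler_wpDr; first by rewrite sumr_ge0.
rewrite -[leRHS]big_filter le_eqVlt; apply/orP; left; apply/eqP.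
apply/perm_big/uniq_perm; rewrite ?filter_uniq//.
move=> i; rewrite mem_filter /=; case: (boolP (i \in s)) => //= /sL ->//.
Qed.

(** A finite set of multi-indices lies in a box, over which the sum is a product of
    finite geometric sums. *)
Lemma summable_geometric_ffun (r : nat) (eta : R) : 0 <= eta < 1 ->
  summable_bound (fun p : {ffun 'I_r -> nat} => eta ^+ (\sum_i p i)).
Proof.
move=> /andP[e0 e1]; split=> [p|]; first by rewrite exprn_ge0.
exists ((1 - eta)^-1 ^+ r) => F.
pose N := (\max_(p <- F) \max_i p i).+1.
pose lift (g : {ffun 'I_r -> 'I_N}) : {ffun 'I_r -> nat} := [ffun i => val (g i)].
have lift_inj : injective lift.
  move=> g h /ffunP gh; apply/ffunP => i; apply: val_inj.
  by have := gh i; rewrite !ffunE.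
apply: (@le_trans _ _ (\sum_(p <- [seq lift g | g <- enum {ffun 'I_r -> 'I_N}])
  eta ^+ (\sum_i p i))).
  apply: sum_sub_uniq.
  - by move=> p; rewrite exprn_ge0.
  - exact: fset_uniq.
  - by rewrite map_inj_uniq// enum_uniq.
  move=> p pF.
  have pN i : (p i < N)%N.
    have := leq_bigmax_seq (P := xpredT)
      (F := fun q : {ffun 'I_r -> nat} => (\max_i q i)%N) p pF isT.
    rewrite ltnS; apply: leq_trans.
    exact: (leq_bigmax i).
  apply/mapP; exists [ffun i => Ordinal (pN i)]; first by rewrite mem_enum.
  by apply/ffunP => i; rewrite !ffunE.
rewrite big_map big_enum /=.
apply: (@le_trans _ _ (\sum_(g : {ffun 'I_r -> 'I_N}) \prod_i eta ^+ g i)).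
  apply: ler_sum => g _; rewrite -prodrXr.
  by rewrite le_eqVlt; apply/orP; left; apply/eqP; apply: eq_bigr => i _; rewrite ffunE.
rewrite -(bigA_distr_bigA (fun (i : 'I_r) (j : 'I_N) => eta ^+ j)) /=.
rewrite -[r in leRHS]card_ord -prodr_const; apply: ler_prod => i _.
rewrite sumr_ge0 => [|j _]; last by rewrite exprn_ge0.
by rewrite geometric_sum_le// e0.
Qed.

End Combinatorics.

Section IndexGrowth.
Variable R : realType.

Lemma archi_mul (a : R) : 0 < a -> exists L : nat, (0 < L)%N /\ 1 <= L%:R * a.
Proof.
move=> a0; have [L hL] := archi_nat a^-1; exists L.+1; split=> //.
by rewrite -ler_pdivrMr// div1r hL.
Qed.

(** The gap between [n] and [2 M + N] grows linearly in [M], and the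
    factorial of the gap beats any geometric sequence. Hence for [rho < 2] the first
    [k] variables may be multiplied by an arbitrarily small constant. *)
Lemma fact_index_small (rho th : R) : 0 <= rho < 2 -> 0 < th <= 1 ->
  exists2 C : R, 0 < C & forall M N n : nat, n = Num.truncn (rho * M%:R + N%:R) ->
  (n`!%:R : R) <= C * th ^+ M.*2 * (M.*2 + N)`!%:R.
Proof.
move=> /andP[rho0 rho2] /andP[th0 th1].
have d0 : 0 < 2 - rho by rewrite subr_gt0.
have [L [L0 hL]] := archi_mul d0.
have T0 : 0 < (th ^+ 2) ^- L by rewrite invr_gt0 !exprn_gt0.
have [C C0 hC] := fact_superexp T0; exists C => // M N n nE.
have nu0 : 0 <= rho * M%:R + N%:R by rewrite addr_ge0// mulr_ge0.
have nle : n%:R <= rho * M%:R + N%:R :> R.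
  by rewrite nE; case/andP: (truncn_itv nu0).
have M2 : (M.*2%:R : R) = 2 * M%:R by rewrite -muln2 natrM mulrC.
have rM : rho * M%:R <= 2 * M%:R by rewrite ler_wpM2r// ltW.
have nQ : (n <= M.*2 + N)%N.
  by rewrite -(ler_nat R) natrD M2 (le_trans nle)// lerD2r.
set D := (M.*2 + N - n)%N.
have DE : (D%:R : R) = 2 * M%:R + N%:R - n%:R by rewrite natrB// natrD M2.
have LD : (M <= L * D)%N.
  rewrite -(ler_nat R) natrM.
  have h1 : (2 - rho) * M%:R <= D%:R by rewrite DE; move: nle; lra.
  have h2 := ler_wpM2l (ler0n R L) h1.
  apply: le_trans h2; rewrite mulrA -[leLHS]mul1r ler_wpM2r//.
have thM : (th ^+ 2) ^+ (L * D) <= th ^+ M.*2.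
  rewrite -mul2n [leRHS]exprM; apply: ler_wiXn2l => //; first by rewrite exprn_ge0// ltW.
  by rewrite exprn_ile1// ltW.
have hD := hC D.
have fD : (n`!%:R * D`!%:R : R) <= (M.*2 + N)`!%:R.
  by rewrite -natrM ler_nat -{1}(subnKC nQ) fact_mul_le.
have TD : ((th ^+ 2) ^- L) ^+ D * (th ^+ 2) ^+ (L * D) = 1.
  by rewrite exprVn (exprM _ L D) mulVf // !expf_neq0 // gt_eqF.
have X0 : 0 <= (th ^+ 2) ^+ (L * D) by rewrite !exprn_ge0// ltW.
have one : 1 <= C * D`!%:R * th ^+ M.*2.
  rewrite -[leLHS]TD; apply: ler_pM; [|exact: X0|exact: hD|exact: thM].
  by rewrite exprn_ge0// ltW.
apply: (@le_trans _ _ (n`!%:R * (C * D`!%:R * th ^+ M.*2))).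
  by rewrite ler_peMr.
have -> : n`!%:R * (C * D`!%:R * th ^+ M.*2) = C * th ^+ M.*2 * (n`!%:R * D`!%:R) by ring.
by rewrite ler_wpM2l// mulr_ge0 ?exprn_ge0// ltW.
Qed.

End IndexGrowth.

(** * Enlarging the domain of convergence in the first variable *)

Section Region.
Variables (R : realType) (r k : nat) (rho : R) (alpha : R[i]).
Variables (beta gamma x : 'I_r -> R[i]).
Hypothesis rho0 : 0 <= rho.
Implicit Types p : {ffun 'I_r -> nat}.

Let Mi p := (\sum_(i < r | (i < k)%N) p i)%N.
Let Ni p := (\sum_(i < r | (k <= i)%N) p i)%N.

(** Doubling the exponents of the first [k] variables turns the denominators
    [(p i)! ^ 2] of their terms into [(2 p i)!], up to a factor [4 ^ p i], and the
    series into a multinomial one. *)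
Definition majorant_exponent p (i : 'I_r) := if (i < k)%N then (p i).*2 else p i.
Definition majorant_weight (th : R) (i : 'I_r) : R :=
  if (i < k)%N then 2 * th * Num.sqrt (cmod (x i)) else cmod (x i).

Let majorant_exponentE p : (\sum_i majorant_exponent p i)%N = ((Mi p).*2 + Ni p)%N.
Proof.
rewrite (bigID (fun i : 'I_r => (i < k)%N)) /=; congr addn.
  rewrite /Mi -mul2n big_distrr /=; apply: eq_bigr => i ik.
  by rewrite /majorant_exponent ik mul2n.
rewrite /Ni; under [RHS]eq_bigl do rewrite leqNgt.
by apply: eq_bigr => i /negbTE ik; rewrite /majorant_exponent ik.
Qed.

Let majorant_weightE th : \sum_i majorant_weight th i =
  2 * th * (\sum_(i < r | (i < k)%N) Num.sqrt (cmod (x i)))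
  + \sum_(i < r | (k <= i)%N) cmod (x i).
Proof.
rewrite (bigID (fun i : 'I_r => (i < k)%N)) /=; congr +%R.
  by rewrite mulr_sumr; apply: eq_bigr => i ik; rewrite /majorant_weight ik.
under [RHS]eq_bigl do rewrite leqNgt.
by apply: eq_bigr => i /negbTE ik; rewrite /majorant_weight ik.
Qed.

(** For [rho = 2] the region is exactly the condition that the weights sum to less
    than 1 with [th = 1]; for [rho < 2] the weights of the first [k] variables can
    be made small; for [k = 0] there is no such variable. *)
Lemma pochhammer_index_upper : k = 0%N \/ rho <= 2 -> E_region k rho x ->
  exists th : R, [/\ 0 < th, \sum_i majorant_weight th i < 1 & forall eps : R, 0 < eps ->
  exists2 C : R, 0 < C & forall p,
  cmod (pochhammer alpha (E_index k rho p))
  <= C * (1 + eps) ^+ (\sum_i majorant_exponent p i)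
     * (th ^+ (Mi p).*2 * (\sum_i majorant_exponent p i)`!%:R)].
Proof.
move=> hk reg; rewrite /E_region in reg.
set S := \sum_(i < r | (i < k)%N) _ in reg; set X := \sum_(i < r | (k <= i)%N) _ in reg.
have S0 : 0 <= S by rewrite sumr_ge0// => i _; rewrite sqrtr_ge0.
have X0 : 0 <= X by rewrite sumr_ge0// => i _; rewrite cmod_ge0.
suff [th [th0 thq [C1 C10 hC1]]] : exists th : R, [/\ 0 < th, \sum_i majorant_weight th i < 1 &
  exists2 C : R, 0 < C & forall p n, n = Num.truncn (E_index k rho p) ->
   (n <= \sum_i majorant_exponent p i)%N /\
   (n`!%:R : R) <= C * (th ^+ (Mi p).*2 * (\sum_i majorant_exponent p i)`!%:R)].
  exists th; split=> // eps eps0.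
  have [C2 C20 hC2] := pochhammer_lattice_upper alpha rho0 eps0.
  have e1 : 1 <= 1 + eps by rewrite lerDl ltW.
  exists (C2 * C1); first by rewrite mulr_gt0.
  move=> p; have [nQ nF] := hC1 p _ erefl.
  apply: (le_trans (hC2 (Mi p) (Ni p) _ erefl)).
  rewrite -/(E_index k rho p); set n := Num.truncn _ in nQ nF *.
  set Q := (\sum_i _)%N in nQ nF *.
  have -> : C2 * C1 * (1 + eps) ^+ Q * (th ^+ (Mi p).*2 * Q`!%:R) =
     (C2 * (1 + eps) ^+ Q) * (C1 * (th ^+ (Mi p).*2 * Q`!%:R)) by ring.
  apply: ler_pM => //.
    by rewrite mulr_ge0 ?(ltW C20)// exprn_ge0// (le_trans ler01).
  by apply: ler_wpM2l; [exact: ltW|rewrite ler_weXn2l].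
have [rho2|rho2] := ltP rho 2.
  (* This choice gives 2 th S + X = 1 - th < 1. *)
  pose th := (1 - X) / (2 * S + 1).
  have X1 : X < 1 by apply: le_lt_trans reg; rewrite lerDr mulr_ge0.
  have d0 : 0 < 2 * S + 1 by rewrite ltr_wpDl// mulr_ge0.
  have th0 : 0 < th by rewrite divr_gt0// subr_gt0.
  have th1 : th <= 1.
    by rewrite ler_pdivrMr// mul1r; move: X0 S0; lra.
  have rr : 0 <= rho < 2 by rewrite rho0.
  have tt : 0 < th <= 1 by rewrite th0.
  have [C C0 hC] := fact_index_small rr tt.
  exists th; split=> //.
    rewrite majorant_weightE -/S -/X.
    have e : th * (2 * S + 1) = 1 - X by rewrite /th divfK// gt_eqF.
    by move: e th0; lra.
  exists C => // p n nE; rewrite majorant_exponentE; split; last by rewrite mulrA; exact: hC.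
  rewrite -(ler_nat R) natrD -muln2 natrM.
  have nu0 : 0 <= E_index k rho p by rewrite addr_ge0// mulr_ge0.
  have : n%:R <= E_index k rho p by rewrite nE; case/andP: (truncn_itv nu0).
  rewrite /E_index -/(Mi p) -/(Ni p) => h; apply: (le_trans h).
  by rewrite lerD2r mulrC ler_wpM2l// ltW.
exists 1; split=> //.
  rewrite majorant_weightE -/S -/X mulr1; case: hk => [k0|rle].
    move: reg; have -> : S = 0 by rewrite /S big_pred0// => i; rewrite k0.
    by rewrite !mulr0.
  by have -> : (2 : R) = rho by apply/eqP; rewrite eq_le rho2.
exists 1 => // p n nE.
have nQ : (n <= \sum_i majorant_exponent p i)%N.
  rewrite majorant_exponentE nE; case: hk => [k0|rle].
    have M0 : Mi p = 0%N by rewrite /Mi big_pred0// => i; rewrite k0.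
    by rewrite /E_index -/(Mi p) -/(Ni p) M0 mulr0 add0r natrK.
  have r2 : rho = 2 by apply/eqP; rewrite eq_le rle.
  rewrite /E_index -/(Mi p) -/(Ni p) r2.
  have -> : 2 * (Mi p)%:R + (Ni p)%:R = ((Mi p).*2 + Ni p)%:R :> R.
    by rewrite natrD -mul2n natrM.
  by rewrite natrK.
by split=> //; rewrite expr1n !mul1r ler_nat leq_fact.
Qed.

Definition E_factor (y : 'I_r -> R[i]) (i : 'I_r) (n : nat) : R :=
  (if (k <= i)%N then cmod (rising (beta i) n) else 1) / cmod (rising (gamma i) n)
  * (cmod (y i) ^+ n / n`!%:R).

Lemma E_factor_ge0 y i n : 0 <= E_factor y i n.
Proof.
rewrite /E_factor mulr_ge0 ?divr_ge0 ?cmod_ge0 ?exprn_ge0 ?cmod_ge0//.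
by case: ifP => _; rewrite ?cmod_ge0.
Qed.

Lemma E_term_cmod (y : 'I_r -> R[i]) p :
  cmod (E_term k rho alpha beta gamma y p)
  = cmod (pochhammer alpha (E_index k rho p)) * \prod_i E_factor y i (p i).
Proof.
rewrite /E_term !cmodM cmodV !cmod_prod -mulrA; congr (_ * _).
rewrite [in RHS]big_split /= big_split /=; congr (_ * _ * _).
- by rewrite big_mkcond.
- by rewrite prodfV.
- by apply: eq_bigr => i _; rewrite cmodM cmodV cmodX cmod_nat.
Qed.

(** Each Pochhammer symbol is replaced by a factorial, at the cost of powers of
    [1 + eps]. *)
Lemma E_factor_upper (th eps : R) (y : 'I_r -> R[i]) (i : 'I_r) :
  0 < th -> 0 < eps ->
  (forall n, rising (gamma i) n != 0) -> cmod (y i) <= (1 + eps) * cmod (x i) ->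
  exists2 C : R, 0 < C & forall n,
  (if (i < k)%N then th ^+ n.*2 else 1) * E_factor y i n
  <= C * (1 + eps) ^+ (3 * n)
     * (majorant_weight th i ^+ (if (i < k)%N then n.*2 else n)
        / (if (i < k)%N then n.*2 else n)`!%:R).
Proof.
move=> th0 eps0 g0 yx.
have e1 : 1 <= 1 + eps by rewrite lerDl ltW.
have e0 : 0 <= 1 + eps := le_trans ler01 e1.
have [C1 C10 hC1] := rising_ge eps0 g0.
have [C2 C20 hC2] := rising_le (beta i) eps0.
have f0 n : 0 < (n`!%:R : R) by rewrite ltr0n fact_gt0.
have en m n : (m <= n)%N -> (1 + eps) ^+ m <= (1 + eps) ^+ n by move=> mn; rewrite ler_weXn2l.
have gV n : (cmod (rising (gamma i) n))^-1 <= C1 * (1 + eps) ^+ n / n`!%:R.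
  rewrite ler_pdivlMr// mulrC ler_pdivrMr ?cmod_gt0//.
have xn n : cmod (y i) ^+ n <= (1 + eps) ^+ n * cmod (x i) ^+ n.
  by rewrite -exprMn lerXn2r ?nnegrE ?mulr_ge0 ?cmod_ge0.
have yV n : cmod (y i) ^+ n / n`!%:R <= (1 + eps) ^+ n * cmod (x i) ^+ n / n`!%:R.
  by rewrite ler_wpM2r ?invr_ge0.
have [ik|ki] := ltnP i k.
  exists C1 => // n; rewrite /E_factor /majorant_weight ik leqNgt ik /= mul1r.
  have x0 := cmod_ge0 (x i).
  apply: (@le_trans _ _ (th ^+ n.*2 *
     ((C1 * (1 + eps) ^+ n / n`!%:R) * ((1 + eps) ^+ n * cmod (x i) ^+ n / n`!%:R)))).
    apply: ler_wpM2l; first by rewrite exprn_ge0// ltW.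
    by apply: ler_pM; rewrite ?invr_ge0 ?cmod_ge0 ?divr_ge0 ?exprn_ge0 ?cmod_ge0.
  have s2 : Num.sqrt (cmod (x i)) ^+ n.*2 = cmod (x i) ^+ n.
    by rewrite -mul2n exprM sqr_sqrtr.
  rewrite !exprMn s2.
  have -> : (2 : R) ^+ n.*2 = 4 ^+ n.
    by rewrite -mul2n exprM; congr (_ ^+ _); ring.
  have -> : th ^+ n.*2 * ((C1 * (1 + eps) ^+ n / n`!%:R) *
     ((1 + eps) ^+ n * cmod (x i) ^+ n / n`!%:R)) =
     (C1 * th ^+ n.*2 * cmod (x i) ^+ n) * (((1 + eps) ^+ n * (1 + eps) ^+ n) *
     (n`!%:R^-1 * n`!%:R^-1)) by ring.
  have -> : C1 * (1 + eps) ^+ (3 * n) * (4 ^+ n * th ^+ n.*2 * cmod (x i) ^+ n / (n.*2)`!%:R) =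
     (C1 * th ^+ n.*2 * cmod (x i) ^+ n) * ((1 + eps) ^+ (3 * n) * (4 ^+ n / (n.*2)`!%:R)).
    by ring.
  apply: ler_wpM2l; first by rewrite !mulr_ge0 ?exprn_ge0// ltW.
  apply: ler_pM.
  - by rewrite mulr_ge0// exprn_ge0.
  - by rewrite mulr_ge0 ?invr_ge0.
  - by rewrite -exprD; apply: en; rewrite !mulSn addnA leq_addr.
  rewrite ler_pdivlMr// -invfM ler_pdivrMl ?mulr_gt0//.
  by rewrite mulrC; exact: double_fact_le.
exists (C1 * C2); first by rewrite mulr_gt0.
move=> n; rewrite /E_factor /majorant_weight ltnNge ki /= mul1r.
have x0 := cmod_ge0 (x i).
apply: (@le_trans _ _ ((C2 * (1 + eps) ^+ n * n`!%:R) * (C1 * (1 + eps) ^+ n / n`!%:R)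
   * ((1 + eps) ^+ n * cmod (x i) ^+ n / n`!%:R))).
  apply: ler_pM; rewrite ?mulr_ge0 ?invr_ge0 ?cmod_ge0 ?exprn_ge0 ?cmod_ge0//.
  by apply: ler_pM; rewrite ?invr_ge0 ?cmod_ge0.
have -> : (3 * n = n + n + n)%N by rewrite !mulSn mul0n addn0 addnA.
rewrite !exprD le_eqVlt; apply/orP; left; apply/eqP.
by field; rewrite gt_eqF.
Qed.

(** A term is at most a constant times [(1 + eps) ^ (4 Q) * q ^ Q], where [Q] is the
    sum of the exponents and [q < 1] the sum of the weights, by comparison with a
    single multinomial term. *)
Lemma E_convergent_enlarge_small :
  (forall i n, rising (gamma i) n != 0) -> k = 0%N \/ rho <= 2 -> E_region k rho x ->
  exists2 eps : R, 0 < eps &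
    E_convergent k rho alpha beta gamma (scale_first (1 + eps)%:C x).
Proof.
move=> g0 hk reg; have [th [th0 q1 hpoch]] := pochhammer_index_upper hk reg.
set q := \sum_i majorant_weight th i in q1.
have w0 i : 0 <= majorant_weight th i.
  by rewrite /majorant_weight; case: ifP => _; rewrite ?cmod_ge0 ?mulr_ge0 ?sqrtr_ge0// ltW.
have q0 : 0 <= q by rewrite sumr_ge0.
(* As (1 + eps) ^ 4 <= 1 + 15 eps, this makes (1 + eps) ^ 4 * q < 1. *)
pose eps := (1 - q) / 16.
have eps0 : 0 < eps by rewrite divr_gt0// subr_gt0.
have eps1 : eps <= 1 by rewrite /eps; move: q0; lra.
have e1 : 1 <= 1 + eps by rewrite lerDl ltW.
have e0 : 0 <= 1 + eps := le_trans ler01 e1.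
exists eps => //; set y := scale_first _ x.
pose eta := (1 + eps) ^+ 4 * q.
have eta01 : 0 <= eta < 1.
  rewrite mulr_ge0 ?exprn_ge0//=.
  have s1 : (1 + eps) ^+ 2 <= 1 + 3 * eps by move: eps0 eps1; nra.
  have s2 : (1 + eps) ^+ 4 <= 1 + 15 * eps.
    rewrite (exprM _ 2%N 2%N); apply: (@le_trans _ _ ((1 + 3 * eps) ^+ 2)).
      by rewrite lerXn2r ?nnegrE ?exprn_ge0// (le_trans _ s1)// exprn_ge0.
    by move: eps0 eps1; nra.
  have := ler_wpM2r q0 s2; rewrite -/eta => h; apply: (le_lt_trans h).
  have : eps * q <= eps by rewrite ler_piMr ?ltW.
  have : 16 * eps = 1 - q by rewrite /eps mulrC divfK.
  by move: eps0; lra.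
have yx i : cmod (y i) <= (1 + eps) * cmod (x i).
  rewrite /y /scale_first; case: ifP => _.
    by rewrite cmodM cmodr ger0_norm// mulrC.
  by rewrite ler_peMl ?cmod_ge0.
have [C C0 hC] := hpoch _ eps0.
have /choice[D hD] : forall i : 'I_r, exists Ci : R, 0 < Ci /\ forall n,
  (if (i < k)%N then th ^+ n.*2 else 1) * E_factor y i n
  <= Ci * (1 + eps) ^+ (3 * n)
     * (majorant_weight th i ^+ (if (i < k)%N then n.*2 else n)
        / (if (i < k)%N then n.*2 else n)`!%:R).
  by move=> i; have [Ci Ci0 h] := E_factor_upper th0 eps0 (g0 i) (yx i); exists Ci.
have D0 : 0 <= \prod_i D i by rewrite prodr_ge0// => i _; rewrite ltW//; case: (hD i).
apply/summable_boundP.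
have Cge : 0 <= C * \prod_i D i by rewrite mulr_ge0// ltW.
apply: (summable_bound_le _ (summable_boundZ Cge (summable_geometric_ffun r eta01))) => p.
rewrite cmod_ge0 /= E_term_cmod.
set Q := (\sum_i majorant_exponent p i)%N.
have PQ : (\sum_i p i <= Q)%N.
  apply: leq_sum => i _; rewrite /majorant_exponent; case: ifP => // _.
  by rewrite -addnn leq_addr.
have F0 : 0 <= \prod_i E_factor y i (p i) by rewrite prodr_ge0// => i _; rewrite E_factor_ge0.
apply: (le_trans (ler_wpM2r F0 (hC p))); rewrite -/Q.
(* The powers of th are absorbed by the factors of the first k variables. *)
have thE : th ^+ (Mi p).*2 = \prod_(i < r) (if (i < k)%N then th ^+ (p i).*2 else 1).
  rewrite -big_mkcond /= /Mi -mul2n big_distrr /= -prodrXr.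
  by apply: eq_bigr => i _; rewrite mul2n.
have key : th ^+ (Mi p).*2 * \prod_i E_factor y i (p i) <=
  \prod_i (D i * (1 + eps) ^+ (3 * p i)
    * (majorant_weight th i ^+ majorant_exponent p i / (majorant_exponent p i)`!%:R)).
  rewrite thE -big_split /=; apply: ler_prod => i _.
  apply/andP; split; last by have [_] := hD i; apply.
  by rewrite mulr_ge0 ?E_factor_ge0//; case: ifP => // _; rewrite exprn_ge0// ltW.
have -> : C * (1 + eps) ^+ Q * (th ^+ (Mi p).*2 * Q`!%:R) * \prod_i E_factor y i (p i)
  = C * (1 + eps) ^+ Q * Q`!%:R * (th ^+ (Mi p).*2 * \prod_i E_factor y i (p i)) by ring.
have c0 : 0 <= C * (1 + eps) ^+ Q by rewrite mulr_ge0 ?exprn_ge0// ltW.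
apply: (le_trans (ler_wpM2l (mulr_ge0 c0 (ler0n _ _)) key)).
rewrite !big_split /= prodrXr.
have := @multinomial_term_le R _ (index_enum 'I_r) (majorant_exponent p) (majorant_weight th) w0.
rewrite -/Q -/q big_split /=; set W := \prod_i _; set V := \prod_i _ => mul.
have -> : C * (1 + eps) ^+ Q * Q`!%:R *
   (\prod_i D i * (1 + eps) ^+ (\sum_i 3 * p i) * (W * V)) =
   (C * \prod_i D i) * (((1 + eps) ^+ Q * (1 + eps) ^+ (\sum_i 3 * p i)) * (Q`!%:R * (W * V))).
  by ring.
apply: ler_wpM2l => //.
have E3 : (1 + eps) ^+ Q * (1 + eps) ^+ (\sum_i 3 * p i) <= (1 + eps) ^+ (4 * Q).
  rewrite -exprD; apply: ler_weXn2l => //.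
  by rewrite [leqRHS]mulSn leq_add2l -big_distrr /= leq_mul2l PQ orbT.
have WV0 : 0 <= Q`!%:R * (W * V).
  have W0 : 0 <= W by rewrite prodr_ge0// => i _; rewrite exprn_ge0.
  have V0 : 0 <= V by rewrite prodr_ge0.
  by rewrite !mulr_ge0.
apply: (@le_trans _ _ ((1 + eps) ^+ (4 * Q) * q ^+ Q)).
  by apply: ler_pM => //; rewrite mulr_ge0// exprn_ge0.
rewrite exprM -exprMn -/eta.
by case/andP: eta01 => a b; apply: ler_wiXn2l => //; exact: ltW.
Qed.

End Region.

Section Scaling.
Variables (R : realType) (r k : nat) (rho : R) (alpha : R[i]).
Variables (beta gamma x : 'I_r -> R[i]) (r0 : (0 < r)%N).

Lemma E_term_scale (c : R[i]) (p : {ffun 'I_r -> nat}) :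
  E_term k rho alpha beta gamma (scale_first c x) p
  = E_term k rho alpha beta gamma x p * c ^+ p (Ordinal r0).
Proof.
rewrite /E_term -!mulrA; congr (_ * (_ * (_ * _))).
rewrite (bigD1 (Ordinal r0))//= [in RHS](bigD1 (Ordinal r0))//=.
rewrite {1}/scale_first /= exprMn.
have -> : \prod_(i < r | i != Ordinal r0) (scale_first c x i ^+ p i / (p i)`!%:R)
   = \prod_(i < r | i != Ordinal r0) (x i ^+ p i / (p i)`!%:R).
  apply: eq_bigr => i i0; rewrite /scale_first ifN//.
by ring.
Qed.

Lemma index_split (E0 K J n : nat) : (E0 + K + J.*2 <= n)%N ->
  n = (K + (J + J) + (n - J.*2 - K))%N /\ (E0 <= n - J.*2 - K)%N.
Proof. by clear; lia. Qed.

(** For [rho > 2] the Pochhammer symbol at [rho * j] outgrows the square of [j!],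
    and the series cannot converge, except when the first variable is 0 or when
    [alpha] is a nonpositive integer and the series terminates. In both cases
    multiplying the first variable by a constant does not destroy convergence. *)
Lemma E_convergent_enlarge_large :
  (0 < k)%N -> 2 < rho -> E_defined k rho alpha beta gamma x ->
  exists2 eps : R, 0 < eps &
    E_convergent k rho alpha beta gamma (scale_first (1 + eps)%:C x).
Proof.
move=> k0 rho2 [pd g0 _ conv].
have rho0 : 0 <= rho by rewrite (le_trans _ (ltW rho2)).
have := conv; rewrite /E_convergent => /summable_boundP hE.
pose i0 := Ordinal r0.
have [x00|xn0] := eqVneq (x i0) 0.
  exists 1; first exact: ltr01.
  have -> : scale_first (1 + 1)%:C x = x; last exact: conv.
  apply/funext => i; rewrite /scale_first; case: eqP => // ii.
  have -> : i = i0 by apply: val_inj.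
  by rewrite x00 mul0r.
(* If alpha = - n0, only terms with p i0 <= n0 are nonzero, so that scaling the
   first variable by 2 multiplies the terms by at most 2 ^ n0. *)
have [[n0 an]|anp] := pselect (nonpos_integer alpha).
  exists 1; first exact: ltr01.
  apply/summable_boundP.
  have two0 : 0 <= (2 : R) ^+ n0 by rewrite exprn_ge0.
  apply: (summable_bound_le _ (summable_boundZ two0 hE)) => p.
  rewrite cmod_ge0 /= E_term_scale cmodM cmodX cmodr mulrC.
  have nu0 : 0 <= E_index k rho p by rewrite addr_ge0// mulr_ge0.
  have [le|lt] := leqP (p i0) n0.
    rewrite ler_wpM2r ?cmod_ge0// ger0_norm// -[1 + 1]/(2 : R).
    by rewrite ler_weXn2l// ler1n.
  have -> : E_term k rho alpha beta gamma x p = 0; last by rewrite cmod0 !mulr0.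
  have nat_idx : E_index k rho p \is a Num.nat.
    by case: (pd p) => // -[na _]; exfalso; apply: na; exists n0.
  rewrite /E_term pochhammer_nat//.
  have tr : (n0 < Num.truncn (E_index k rho p))%N.
    have : (n0.+1%:R : R) <= E_index k rho p.
      rewrite /E_index; apply: ler_wpDr => //.
      apply: (@le_trans _ _ (1 * (\sum_(i < r | (i < k)%N) p i)%:R)); last first.
        by rewrite ler_wpM2r// (le_trans _ (ltW rho2))// ler1n.
      rewrite mul1r ler_nat (bigD1 i0)//=.
      by apply: leq_trans lt (leq_addr _ _).
    move=> h; have /andP[_ hi] := truncn_itv nu0.
    by rewrite -ltnS -(ltr_nat R) (le_lt_trans h).
  have -> : rising alpha (Num.truncn (E_index k rho p)) = 0.
    apply/eqP/prodf_eq0; exists (Ordinal tr) => //=.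
    by rewrite an addNr.
  by rewrite !mul0r.
exfalso.
pose single j : {ffun 'I_r -> nat} := [ffun i => if i == i0 then j else 0%N].
have idx j : E_index k rho (single j) = rho * j%:R.
  have h1 : (\sum_(i < r | (i < k)%N) single j i = j)%N.
    rewrite (bigD1 i0)//= ffunE eqxx big1 ?addn0// => i /andP[_ /negbTE ii].
    by rewrite ffunE ii.
  have h2 : (\sum_(i < r | (k <= i)%N) single j i = 0)%N.
    rewrite big1// => i ki; rewrite ffunE; case: eqP => // ii.
    by move: ki; rewrite ii /= leqNgt k0.
  by rewrite /E_index h1 h2 addr0.
have [_ [B hB]] := hE.
have term_le j : cmod (pochhammer alpha (rho * j%:R)) * cmod (x i0) ^+ j
    <= B * cmod (rising (gamma i0) j) * j`!%:R.
  have := hB [fset single j]%fset; rewrite big_seq_fset1 E_term_cmod idx.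
  rewrite (bigD1 i0)//= big1 => [|i ii]; last first.
    rewrite ffunE (negbTE ii) /E_factor /= !rising0 cmod1 expr0 fact0 !divr1.
    by case: ifP => _; rewrite mulr1.
  rewrite mulr1 ffunE eqxx /E_factor leqNgt k0 /= mul1r mulrA mulrCA mulrC.
  have g1 : 0 < cmod (rising (gamma i0) j) by rewrite cmod_gt0.
  have f1 : 0 < (j`!%:R : R) by rewrite ltr0n fact_gt0.
  move=> h; have := ler_wpM2r (ltW (mulr_gt0 g1 f1)) h.
  rewrite [B * (_ * _)]mulrA; apply: le_trans.
  rewrite le_eqVlt; apply/orP; left; apply/eqP.
  by field; rewrite !gt_eqF.
have B0 : 0 <= B by have := hB fset0; rewrite big_seq_fset0.
have [C2 C20 hC2] := rising_le (gamma i0) ltr01.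
have [K [C1 [C10 hC1]]] := pochhammer_lower anp.
have d0 : 0 < rho - 2 by rewrite subr_gt0.
have [L [L0 hL]] := archi_mul d0.
pose X := cmod (x i0); have X0 : 0 < X by rewrite cmod_gt0.
pose Y := 8 / X + 1; have Y1 : 1 <= Y by rewrite lerDr divr_ge0// ltW.
have Y0 : 0 <= Y := le_trans ler01 Y1.
pose T := 2 * Y ^+ L; have T0 : 0 < T.
  by rewrite mulr_gt0// exprn_gt0// (lt_le_trans ltr01).
pose C4 := C1 * B * C2 * 2 ^+ K * Y ^+ (L * K.+1).
have [C5 C50 hC5] := fact_superexp (mulr_gt0 (ltr0n R 2) T0).
(* With n the integral part of rho * J and E = n - 2 J - K, the bounds on the
   terms of indices (J, 0, ..., 0) give E! <= C4 * T ^ E; and E is unbounded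
   because rho > 2. *)
have growth E0 : exists2 E : nat, (E0 <= E)%N & (E`!%:R : R) <= C4 * T ^+ E.
  have [J hJ] := archi_nat ((E0 + K).+1%:R / (rho - 2)).
  have := hJ J (leqnn J); rewrite ler_pdivrMr// => jl.
  pose n := Num.truncn (rho * J%:R).
  have nu0 : 0 <= rho * J%:R by rewrite mulr_ge0.
  have /andP[nlo nhi] := truncn_itv nu0; rewrite -/n in nlo nhi.
  have nS : (n.+1%:R : R) = n%:R + 1 by rewrite natr1.
  rewrite nS in nhi.
  have big : (E0 + K + J.*2 <= n)%N.
    rewrite -ltnS -(ltr_nat R) nS natrD -muln2 natrM.
    have e : (E0 + K).+1%:R = (E0 + K)%:R + 1 :> R by rewrite natr1.
    by move: jl nhi; rewrite e; lra.
  pose E := (n - J.*2 - K)%N.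
  have [nE EE0] : n = (K + (J + J) + E)%N /\ (E0 <= E)%N.
    exact: index_split big.
  exists E; first exact: EE0.
  have Kn : K%:R <= rho * J%:R.
    by rewrite (le_trans _ nlo)// ler_nat nE -addnA leq_addr.
  have h1 := hC1 _ Kn; rewrite -/n in h1.
  have h2 := term_le J; rewrite -/X in h2.
  have h3 := hC2 J.
  have XJ : 0 < X ^+ J by rewrite exprn_gt0.
  have h4 : (J`!%:R * J`!%:R * E`!%:R : R) <= (n - K)`!%:R.
    rewrite nE -addnA addKn -!natrM ler_nat.
    apply: leq_trans (fact_mul_le _ _); rewrite leq_mul2r; apply/orP; right.
    exact: fact_mul_le.
  have JL : (J <= L * (E + K.+1))%N.
    rewrite -(ler_nat R) natrM natrD -addn1 natrD.
    have e : (n%:R : R) = K%:R + (J%:R + J%:R) + E%:R by rewrite nE !natrD.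
    have le1 : (rho - 2) * J%:R <= E%:R + (K%:R + 1) by move: nhi; rewrite e; lra.
    apply: le_trans (ler_wpM2l (ler0n R L) le1).
    by rewrite mulrA -[leLHS]mul1r ler_wpM2r.
  have F0 : 0 < (J`!%:R * J`!%:R : R) by rewrite mulr_gt0// ltr0n fact_gt0.
  have p2 m : 0 <= (2 : R) ^+ m by rewrite exprn_ge0.
  have step : J`!%:R * J`!%:R * E`!%:R * X ^+ J <=
      C1 * 2 ^+ n * (B * (C2 * 2 ^+ J * J`!%:R) * J`!%:R).
    apply: (le_trans (ler_wpM2r (ltW XJ) (le_trans h4 h1))).
    rewrite -[leLHS]mulrA; apply: ler_wpM2l; first by rewrite mulr_ge0// ltW.
    apply: (le_trans h2); rewrite ler_wpM2r// ler_wpM2l//.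
  have step2 : E`!%:R * X ^+ J <= C1 * B * C2 * (2 ^+ n * 2 ^+ J).
    rewrite -(ler_pM2l F0).
    have -> : J`!%:R * J`!%:R * (E`!%:R * X ^+ J) = J`!%:R * J`!%:R * E`!%:R * X ^+ J by ring.
    by apply: (le_trans step); rewrite le_eqVlt; apply/orP; left; apply/eqP; ring.
  have step3 : E`!%:R <= C1 * B * C2 * (2 ^+ K * 2 ^+ E * (8 / X) ^+ J).
    rewrite -(ler_pM2r XJ); apply: (le_trans step2).
    have e8 : (8 / X) ^+ J * X ^+ J = 2 ^+ J * 2 ^+ J * 2 ^+ J.
      by rewrite -!exprMn divfK ?gt_eqF//; congr (_ ^+ _); ring.
    have -> : C1 * B * C2 * (2 ^+ K * 2 ^+ E * (8 / X) ^+ J) * X ^+ J =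
       C1 * B * C2 * (2 ^+ K * 2 ^+ E * ((8 / X) ^+ J * X ^+ J)) by ring.
    rewrite e8 nE !exprD le_eqVlt; apply/orP; left; apply/eqP; ring.
  apply: (le_trans step3).
  have YJ : (8 / X) ^+ J <= Y ^+ (L * (E + K.+1)).
    apply: (@le_trans _ _ (Y ^+ J)); last by rewrite ler_weXn2l.
    rewrite lerXn2r ?nnegrE ?lerDl// divr_ge0// ltW//.
  have C0 : 0 <= C1 * B * C2 by rewrite !mulr_ge0// ltW.
  have -> : C4 * T ^+ E = C1 * B * C2 * (2 ^+ K * 2 ^+ E * Y ^+ (L * (E + K.+1))).
    by rewrite /C4 /T exprMn mulnDr exprD -(exprM Y L E); ring.
  by apply: ler_wpM2l => //; apply: ler_wpM2l => //; rewrite mulr_ge0.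
have [E0 hE0] := archi_nat (C5 * C4).
have [E /hE0 E0E hE1] := growth E0.
have TE : 0 < T ^+ E by rewrite exprn_gt0.
have : (2 * T) ^+ E <= C5 * C4 * T ^+ E.
  by rewrite (le_trans (hC5 E))// -mulrA ler_wpM2l// ltW.
rewrite exprMn ler_pM2r// => h.
have : (2 ^+ E : R) <= E%:R := le_trans h E0E.
by rewrite -natrX ler_nat leqNgt ltn_expl.
Qed.

(** This provides the analyticity at 1 that [taylor_series_value] requires. *)
Lemma E_convergent_enlarge : 0 <= rho -> E_defined k rho alpha beta gamma x ->
  exists2 eps : R, 0 < eps &
    E_convergent k rho alpha beta gamma (scale_first (1 + eps)%:C x).
Proof.
move=> rho0 def; have [_ g0 reg _] := def.
have [rho2|rho2] := leP rho 2.
  by apply: E_convergent_enlarge_small => //; right.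
have [/eqP k0|k0] := posnP k; first by apply: E_convergent_enlarge_small => //; left; apply/eqP.
exact: E_convergent_enlarge_large.
Qed.

End Scaling.

(** * Contiguity in the first lower parameter *)

Section Contiguity.
Variable R : realType.
Implicit Types (b y : R[i]).

Lemma risingD y m n : rising y (m + n) = rising y m * rising (y + m%:R) n.
Proof.
elim: n => [|n IH]; first by rewrite addn0 rising0 mulr1.
by rewrite addnS !risingS IH natrD; ring.
Qed.

(** Both sides are products over the same [q] consecutive points, in opposite order. *)
Lemma rising_reflect y q : rising (1 - y) q = (-1) ^+ q * rising (y - q%:R) q.
Proof.
elim: q => [|q IH]; first by rewrite !rising0 mulr1.
rewrite risingS IH rising_shift exprS -[q.+1%:R]natr1.
have -> : y - (q%:R + 1) + 1 = y - q%:R by ring.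
by ring.
Qed.

Lemma cbinomE b n : cbinom (b + n%:R - 1) n = binc b n.
Proof.
rewrite /cbinom /binc /rising; congr (_ / _).
rewrite (reindex_inj rev_ord_inj) /=; apply: eq_bigr => i _.
rewrite natrB ?ltn_ord// -[i.+1%:R]natr1; ring.
Qed.

(** Up to the same sign, the cross products are the two ways of cutting
    [rising (b - q) (q + n)] into consecutive blocks. *)
Lemma binc_contiguity b q n : rising (1 - b) q != 0 -> rising (1 - b - n%:R) q != 0 ->
  binc b n / rising (1 - b - n%:R) q = binc (b - q%:R) n / rising (1 - b) q.
Proof.
move=> h1 h2; apply/eqP; rewrite eqr_div//; apply/eqP.
rewrite /binc mulrAC [RHS]mulrAC; congr (_ / _).
have -> : 1 - b - n%:R = 1 - (b + n%:R) by ring.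
rewrite !rising_reflect.
have e : rising (b - q%:R) q * rising b n
       = rising (b - q%:R) n * rising (b + n%:R - q%:R) q.
  have := risingD (b - q%:R) q n; rewrite subrK => <-.
  by rewrite addnC risingD addrAC.
by rewrite mulrCA [rising b n * _]mulrC e; ring.
Qed.

(** Termwise form of the identity: the terms of the series with first lower
    parameter shifted by [n] are those of the unshifted series times coefficients of
    [(1 - t)] to the power [p_1 - lambda - m]. *)
Lemma E_term_shift (r k : nat) (rho : R) (alpha lambda : R[i])
    (beta gamma x : 'I_r -> R[i]) (r0 : (0 < r)%N) (m n : nat)
    (p : {ffun 'I_r -> nat}) :
  (forall i j, rising (gamma_shift lambda gamma m i) j != 0) ->
  (forall i j, rising (gamma_shift lambda gamma (m + n) i) j != 0) ->
  cbinom (lambda + m%:R + n%:R - 1) n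
    * E_term k rho alpha beta (gamma_shift lambda gamma (m + n)) x p
  = E_term k rho alpha beta (gamma_shift lambda gamma m) x p
    * binc (lambda + m%:R - (p (Ordinal r0))%:R) n.
Proof.
move=> gm gmn; set i0 := Ordinal r0; set b := lambda + m%:R.
have gE j : gamma_shift lambda gamma j i0 = 1 - lambda - j%:R by [].
have prodE j : \prod_(i < r) rising (gamma_shift lambda gamma j i) (p i)
   = rising (1 - lambda - j%:R) (p i0) *
     \prod_(i < r | i != i0) rising (gamma i) (p i).
  rewrite (bigD1 i0)//= gE; congr (_ * _).
  by apply: eq_bigr => i ii; rewrite /gamma_shift /replace_first ifN.
have e1 : 1 - b = 1 - lambda - m%:R by rewrite /b; ring.
have e2 : 1 - b - n%:R = 1 - lambda - (m + n)%:R by rewrite /b natrD; ring.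
have c1 : rising (1 - b) (p i0) != 0 by rewrite e1 -gE.
have c2 : rising (1 - b - n%:R) (p i0) != 0 by rewrite e2 -gE.
have h := binc_contiguity c1 c2; rewrite e2 e1 in h.
rewrite cbinomE /E_term !prodE !invfM.
set P := pochhammer _ _; set Z := \prod_(i < r | _ ) rising _ _.
set W := (\prod_(i < r | _ ) rising _ _)^-1; set V := \prod_(i < r) _.
transitivity (binc b n / rising (1 - lambda - (m + n)%:R) (p i0) * (P * (Z * W) * V)).
  by ring.
by rewrite h; ring.
Qed.

End Contiguity.

(* The last hypothesis only concerns the convergence of the series in t on the
   left-hand side, which can diverge although |t| < 1 and both arguments are
   in the region: either it is assumed, or it is deduced from the convergence
   of the series of Psi_m at (s x_1, x_2, ..., x_r) for some s > 1 + |t|. *)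
Theorem theorem5 (R : realType) (r k : nat) (rho : R)
    (alpha lambda : R[i]) (beta gamma x : 'I_r -> R[i]) (m : nat) (t : R[i])
    (r_gt0 : (0 < r)%N) (k_le_r : (k <= r)%N) (rho_ge0 : 0 <= rho)
    (t_lt1 : cmod t < 1)
    (defined_l : forall n : nat,
       E_defined k rho alpha beta (gamma_shift lambda gamma (m + n)) x)
    (defined_r :
       E_defined k rho alpha beta (gamma_shift lambda gamma m)
         (scale_first (1 - t) x))
    (convergent_l :
       cvgn (series (fun n : nat =>
         cbinom (lambda + m%:R + n%:R - 1) n
         * Psi k rho alpha beta gamma lambda (m + n) x * t ^+ n : R[i]^o))
       \/ exists2 s : R, 1 + cmod t < s
          & E_convergent k rho alpha beta (gamma_shift lambda gamma m)
              (scale_first s%:C x)) :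
  series (fun n : nat =>
    cbinom (lambda + m%:R + n%:R - 1) n
    * Psi k rho alpha beta gamma lambda (m + n) x * t ^+ n : R[i]^o) @ \oo
  --> (cpow (1 - t) (- lambda - m%:R)
       * Psi k rho alpha beta gamma lambda m (scale_first (1 - t) x) : R[i]^o).
Proof.
have defined_m : E_defined k rho alpha beta (gamma_shift lambda gamma m) x.
  by have := defined_l 0%N; rewrite addn0.
pose e (p : {ffun 'I_r -> nat}) := p (Ordinal r_gt0).
pose A := E_term k rho alpha beta (gamma_shift lambda gamma m) x.
pose b := lambda + m%:R.
have termE : (fun n : nat => cbinom (lambda + m%:R + n%:R - 1) n
      * Psi k rho alpha beta gamma lambda (m + n) x * t ^+ n)
    = (fun n => csum (fun p => A p * binc (b - (e p)%:R) n) * t ^+ n).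
  apply/funext => n; congr (_ * _).
  have [_ gn _ /summable_boundP hn] := defined_l n; have [_ gm _ _] := defined_m.
  rewrite -(csumZ _ hn (fun p => lexx _)); congr csum; apply/funext => p.
  exact: E_term_shift.
have sumE : Psi k rho alpha beta gamma lambda m (scale_first (1 - t) x)
    = csum (fun p => A p * (1 - t) ^+ e p).
  rewrite /Psi /E -/(csum _); congr csum; apply/funext => p.
  by rewrite (E_term_scale _ _ _ _ _ _ r_gt0).
have scaled (s : R[i]) :
    E_convergent k rho alpha beta (gamma_shift lambda gamma m) (scale_first s x) ->
    summable_bound (fun p => cmod (A p) * cmod s ^+ e p).
  move=> /summable_boundP; congr summable_bound; apply/funext => p.
  by rewrite (E_term_scale _ _ _ _ _ _ r_gt0) cmodM cmodX.
have bE : - lambda - m%:R = - b by rewrite /b opprD.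
rewrite bE sumE termE; rewrite termE in convergent_l.
case: convergent_l => [/cvg_ex[S hS]|[s ts /scaled hA]].
  have [eps eps0 /scaled hA] := E_convergent_enlarge r_gt0 rho_ge0 defined_m.
  have e1 : cmod (1 + eps)%:C = 1 + eps.
    by rewrite cmodr ger0_norm// addr_ge0// ltW.
  rewrite e1 in hA.
  have [_ _ _ /scaled hAt] := defined_r.
  rewrite -(generating_convergent eps0 t_lt1 hA hAt hS).
  exact: hS.
have t0 := cmod_ge0 t.
have s0 : 0 <= s by move: ts t0; lra.
have es : cmod s%:C = s by rewrite cmodr ger0_norm.
rewrite es in hA.
have s1 : 0 < s - 1 by move: ts t0; lra.
have hA' : summable_bound (fun p => cmod (A p) * (1 + (s - 1)) ^+ e p).
  by rewrite addrC subrK.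
have ts1 : cmod t <= s - 1 by move: ts; lra.
exact: (@generating_radius R _ A e b t (s - 1) s1 t_lt1 hA' ts1).
Qed.
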